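(* Let $(R,\pi R)$ be a complete discrete valuation ring, let $A = R[[X_1, \cdots, X_n]]$ and $B = R[[Y_1, \cdots, Y_m]]$. Let $M$ and $N$ be finitely generated $A$- and $B$-modules respectively. If $N$ is flat over $R$, then $$e(M \widehat{\otimes}_R N) \geq e(M)e(N).$$
   Context: $A\widehat\otimes_R B$ is the completed tensor product over $R$, which is the power series ring $C=R[[X_1,\dots,X_n,Y_1,\dots,Y_m]]$; for finitely generated modules $M$ over $A$ and $N$ over $B$, the completed tensor product is the finitely generated $C$-module $M\widehat\otimes_R N=(M\otimes_A C)\otimes_C(N\otimes_B C)$. For a finitely generated module $E$ of dimension $d$ over a Noetherian local ring with maximal ideal $\mathfrak m$, $e(E)=\lim_{n\to\infty} d!\,\ell(E/\mathfrak m^{n+1}E)/n^d$ is the Hilbert-Samuel multiplicity with respect to $\mathfrak m$. The multiplicities $e(M)$, $e(N)$, $e(M\widehat\otimes_RN)$ are taken over the local rings $A$, $B$, $A\widehat\otimes_R B$ respectively. *)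

(* Defs.v *)
From HB Require Import structures.
From mathcomp Require Import all_boot all_order all_algebra.
From mathcomp Require Import mpoly freeg.
From mathcomp Require Import boolp classical_sets reals.
From mathcomp Require Import topology normedtype sequences.

Set Implicit Arguments.
Unset Strict Implicit.
Unset Printing Implicit Defensive.

Import GRing.Theory.
Import numFieldNormedType.Exports.

Local Open Scope classical_set_scope.
Local Open Scope ring_scope.

(* Submodules are boolean predicates satisfying GRing.submod_closed, and ideals
   those satisfying idealr_closed (which includes 1 \notin I). *)

Section Span.
Variables (R : pzRingType) (V : lmodType R) (S : set V).

Definition span : {pred V} := fun x =>
  `[< forall P : {pred V}, GRing.submod_closed P ->
        (forall y, S y -> y \in P) -> x \in P >].

Lemma span_submod : GRing.submod_closed span.
Proof.
split=> [|a x y /asboolP xS /asboolP yS]; first by apply/asboolP=> P [].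
apply/asboolP=> P cP SP; have [_ linP] := cP.
by apply: linP; [apply: xS | apply: yS].
Qed.

Lemma span_sub x : S x -> x \in span.
Proof. by move=> Sx; apply/asboolP=> P _; apply. Qed.

Lemma span_min (P : {pred V}) : GRing.submod_closed P ->
  (forall y, S y -> y \in P) -> {subset span <= P}.
Proof. by move=> cP SP x /asboolP; apply. Qed.

HB.instance Definition _ := GRing.isSubmodClosed.Build R V span
  (GRing.submod_closed_semi span_submod).

End Span.

Section QuotientModule.
Local Open Scope quotient_scope.
Variables (R : pzRingType) (V : lmodType R) (S : set V).

(* V / <S> *)
Definition quot_mod : Type := ring_quotient.Quotient.quot (span S).

HB.instance Definition _ := GRing.Zmodule.on quot_mod.

Definition quot_pi (x : V) : quot_mod := \pi_(ring_quotient.Quotient.quot (span S)) x.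
Definition quot_repr (x : quot_mod) : V := repr (x : ring_quotient.Quotient.quot (span S)).

Lemma quot_reprK x : quot_pi (quot_repr x) = x.
Proof. exact: reprK. Qed.

Lemma quot_pi_eq x y : (quot_pi x == quot_pi y) = (x - y \in span S).
Proof. by rewrite Quotient.idealrBE. Qed.

Lemma quot_piB x y : quot_pi (x - y) = quot_pi x - quot_pi y.
Proof. by rewrite /quot_pi raddfB. Qed.

Lemma quot_piD x y : quot_pi (x + y) = quot_pi x + quot_pi y.
Proof. by rewrite /quot_pi raddfD. Qed.

Definition quot_scale a x := quot_pi (a *: quot_repr x).

Lemma quot_scaleE a x : quot_scale a (quot_pi x) = quot_pi (a *: x).
Proof.
apply/eqP; rewrite quot_pi_eq -scalerBr rpredZ //.
by rewrite -quot_pi_eq quot_reprK.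
Qed.

Fact quot_scaleA a b x : quot_scale a (quot_scale b x) = quot_scale (a * b) x.
Proof. by rewrite -[x]quot_reprK !quot_scaleE scalerA. Qed.
Fact quot_scale1 : left_id 1 quot_scale.
Proof. by move=> x; rewrite -[x]quot_reprK !quot_scaleE scale1r. Qed.
Fact quot_scaleDr : right_distributive quot_scale +%R.
Proof.
move=> a x y; rewrite -[x]quot_reprK -[y]quot_reprK -quot_piD !quot_scaleE.
by rewrite scalerDr quot_piD.
Qed.
Fact quot_scaleDl x : {morph quot_scale^~ x : a b / a + b}.
Proof.
by move=> a b; rewrite -[x]quot_reprK !quot_scaleE scalerDl quot_piD.
Qed.

HB.instance Definition _ := GRing.Zmodule_isLmodule.Build R quot_mod
  quot_scaleA quot_scale1 quot_scaleDr quot_scaleDl.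

Fact quot_pi_linear : linear quot_pi.
Proof. by move=> a x y; rewrite quot_piD -quot_scaleE. Qed.

HB.instance Definition _ := GRing.isLinear.Build R V quot_mod *:%R quot_pi
  quot_pi_linear.

End QuotientModule.

(* For a morphism phi : A -> C, an A-module M and a C-module P, the C-module
   M (x)_A P, with c (x (x) p) = x (x) cp : the free C-module on M x P modulo
   the A-balanced, C-bilinear relations. It is the base change M (x)_A C when
   P = C, and the tensor product over C of two C-modules when phi is the
   identity. The lemmas tensor_lift* state its universal property. *)
Section Tensor.
Variables (A C : comNzRingType) (phi : {rmorphism A -> C}).
Variables (M : lmodType A) (P : lmodType C).

Definition pure_gen (x : M) (p : P) : {freeg (M * P) / C} :=
  Freeg [:: (1, (x, p))].

Inductive tensor_rel : set {freeg (M * P) / C} :=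
| TensorDl x y p : tensor_rel (pure_gen (x + y) p - (pure_gen x p + pure_gen y p))
| TensorDr x p q : tensor_rel (pure_gen x (p + q) - (pure_gen x p + pure_gen x q))
| TensorZl a x p : tensor_rel (pure_gen (a *: x) p - pure_gen x (phi a *: p))
| TensorZr c x p : tensor_rel (pure_gen x (c *: p) - c *: pure_gen x p).

Definition tensor : Type := quot_mod tensor_rel.
HB.instance Definition _ := GRing.Lmodule.on tensor.

Definition tmul (x : M) (p : P) : tensor := quot_pi tensor_rel (pure_gen x p).

Lemma tmulDl x y p : tmul (x + y) p = tmul x p + tmul y p.
Proof.
by apply/eqP; rewrite -quot_piD quot_pi_eq; apply/span_sub/TensorDl.
Qed.

Lemma tmulDr x p q : tmul x (p + q) = tmul x p + tmul x q.
Proof.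
by apply/eqP; rewrite -quot_piD quot_pi_eq; apply/span_sub/TensorDr.
Qed.

Lemma tmulZl a x p : tmul (a *: x) p = tmul x (phi a *: p).
Proof. by apply/eqP; rewrite quot_pi_eq; apply/span_sub/TensorZl. Qed.

Lemma tmulZr c x p : tmul x (c *: p) = c *: tmul x p.
Proof.
apply/eqP; rewrite /tmul -linearZ quot_pi_eq; exact/span_sub/TensorZr.
Qed.

Lemma tensor_ind (T : tensor -> Prop) : T 0 ->
  (forall c x p t, T t -> T (c *: tmul x p + t)) -> forall t, T t.
Proof.
move=> T0 TD t; rewrite -[t]quot_reprK; set u := quot_repr t.
rewrite -(freeg_sumE u) raddf_sum; elim: (dom u) => [|[x p] s IHs].
  by rewrite big_nil.
rewrite big_cons /=; suff -> : quot_pi tensor_rel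
    (Freeg [:: (coeff (x, p) u, (x, p))]) = coeff (x, p) u *: tmul x p.
  exact: TD.
rewrite /tmul -linearZ; congr (quot_pi _ _); apply/eqP/freeg_eqP=> k.
by rewrite coeffZ !coeffU mul1r.
Qed.

Definition tensor_lift (Q : lmodType C) (h : M -> P -> Q) (t : tensor) : Q :=
  fglift (fun xp => h xp.1 xp.2) (quot_repr t).

Section Lift.
Variables (Q : lmodType C) (h : M -> P -> Q).
Hypothesis hDl : forall x y p, h (x + y) p = h x p + h y p.
Hypothesis hlin : forall x, linear (h x).
Hypothesis hZl : forall a x p, h (a *: x) p = h x (phi a *: p).

Let hDr x p q : h x (p + q) = h x p + h x q.
Proof. by have := hlin x 1 p q; rewrite !scale1r. Qed.
Let hr0 x : h x 0 = 0.
Proof. by apply: (@addrI _ (h x 0)); rewrite -hDr !addr0. Qed.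
Let hZr c x p : h x (c *: p) = c *: h x p.
Proof. by have := hlin x c p 0; rewrite hr0 !addr0. Qed.

Let F : {freeg (M * P) / C} -> Q := fglift (fun xp => h xp.1 xp.2).

Let FB u v : F (u - v) = F u - F v.
Proof. exact: (@lift_is_additive C _ Q (fun xp : M * P => h xp.1 xp.2) u v). Qed.
Let F0 : F 0 = 0.
Proof. by have := FB 0 0; rewrite !subrr. Qed.
Let FD u v : F (u + v) = F u + F v.
Proof. by have := FB (u + v) v; rewrite addrK => ->; rewrite subrK. Qed.
Let Fsum I (r : seq I) G : F (\sum_(i <- r) G i) = \sum_(i <- r) F (G i).
Proof. exact: (big_morph F FD F0). Qed.
Let FU k x p : F (Freeg [:: (k, (x, p))]) = k *: h x p.
Proof. by rewrite /F liftU. Qed.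
Let FZ c u : F (c *: u) = c *: F u.
Proof.
rewrite -(freeg_sumE u) scaler_sumr !Fsum scaler_sumr; apply: eq_bigr.
move=> [x p] _; rewrite FU scalerA -FU; congr F.
by apply/eqP/freeg_eqP=> k; rewrite coeffZ !coeffU mulrA.
Qed.

Let F_span u : u \in span tensor_rel -> F u = 0.
Proof.
pose Z : {pred {freeg (M * P) / C}} := fun v => F v == 0.
suff ZS : {subset span tensor_rel <= Z} by move/ZS/eqP.
apply: span_min.
  split=> [|c v w /eqP v0 /eqP w0]; apply/eqP; first exact: F0.
  by rewrite FD FZ v0 w0 scaler0 addr0.
move=> _ []; rewrite /pure_gen => *; apply/eqP;
  rewrite FB ?FD ?FZ !FU !scale1r /=.
- by rewrite hDl subrr.
- by rewrite hDr subrr.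
- by rewrite hZl subrr.
- by rewrite hZr subrr.
Qed.

Let lift_pi u : tensor_lift h (quot_pi tensor_rel u) = F u.
Proof.
apply/eqP; rewrite -subr_eq0 -FB; apply/eqP/F_span.
by rewrite -quot_pi_eq quot_reprK.
Qed.

Lemma tensor_liftE x p : tensor_lift h (tmul x p) = h x p.
Proof. by rewrite lift_pi FU scale1r. Qed.

Lemma tensor_lift_linear : linear (tensor_lift h).
Proof.
move=> c t u; rewrite -[t]quot_reprK -[u]quot_reprK -linearP !lift_pi.
by rewrite FD FZ.
Qed.

Lemma tensor_lift_uniq (g : {linear tensor -> Q}) :
  (forall x p, g (tmul x p) = h x p) -> g =1 tensor_lift h.
Proof.
move=> gE; apply: tensor_ind => [|c x p t IHt].
  have := tensor_lift_linear (-1) 0 0.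
  by rewrite scaler0 addr0 scaleN1r addNr linear0 => ->.
by rewrite linearP tensor_lift_linear gE tensor_liftE IHt.
Qed.

End Lift.
End Tensor.

Section TensorMap.
Variables (A C : comNzRingType) (phi : {rmorphism A -> C}).
Variables (M M' : lmodType A) (P : lmodType C) (f : {linear M -> M'}).

Definition tensor_map : tensor phi M P -> tensor phi M' P :=
  tensor_lift (fun x p => tmul phi (f x) p).

Lemma tensor_mapE x p : tensor_map (tmul phi x p) = tmul phi (f x) p.
Proof.
apply: tensor_liftE => [y z q|y a q r|a y q].
- by rewrite linearD tmulDl.
- by rewrite tmulDr tmulZr.
- by rewrite linearZ_LR tmulZl.
Qed.

Lemma tensor_map_linear : linear tensor_map.
Proof.
apply: tensor_lift_linear => [y z q|y a q r|a y q].
- by rewrite linearD tmulDl.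
- by rewrite tmulDr tmulZr.
- by rewrite linearZ_LR tmulZl.
Qed.

End TensorMap.

Arguments tensor_map {A C} phi {M M'} P f.

(* Flatness over R of a B-module N, along phi : R -> B. *)
Definition flat_over (R B : comNzRingType) (phi : {rmorphism R -> B})
    (N : lmodType B) : Prop :=
  forall (P Q : lmodType R) (f : {linear P -> Q}),
    injective f -> injective (tensor_map phi N f).

Definition fin_gen (A : comNzRingType) (E : lmodType A) : Prop :=
  exists s : seq E, forall x, x \in span [set` s].

Section Ideals.
Variable A : comNzRingType.

Definition maximal_ideal (I : {pred A}) : Prop :=
  idealr_closed I /\
  forall J : {pred A}, idealr_closed J -> {subset I <= J} -> {subset J <= I}.

Definition prime_ideal (I : {pred A}) : Prop :=
  idealr_closed I /\ prime_idealr_closed I.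

(* The maximal ideal of the ring A, which is meant to be local. *)
Definition maxideal : {pred A} :=
  xget (pred0 : A -> bool) [set I : A -> bool | maximal_ideal I].

Fixpoint ideal_exp (I : {pred A}) (k : nat) : {pred A} :=
  if k is k'.+1 then
    span (V := A^o)
      [set z | exists x y, [/\ x \in I, y \in ideal_exp I k' & z = x * y]]
  else predT.

Definition principal (t : A) : {pred A} := fun x => `[< exists y, x = y * t >].

End Ideals.

Arguments maxideal : clear implicits.

Section Chains.
Variables (V : Type) (Q : {pred V} -> Prop).

Definition has_chain (k : nat) : Prop :=
  exists c : nat -> {pred V},
    (forall i, (i <= k)%N -> Q (c i)) /\
    (forall i, (i < k)%N ->
       {subset c i <= c i.+1} /\ ~ {subset c i.+1 <= c i}).

(* The greatest length of a strict chain c_0 < c_1 < ... < c_k of sets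
   satisfying Q; it is 0 if there is no such chain or if they have unbounded
   length. *)
Definition max_chain : nat :=
  xget 0%N [set k | has_chain k /\ forall j, has_chain j -> (j <= k)%N].

End Chains.

Section Multiplicity.
Variables (A : comNzRingType) (E : lmodType A).

Definition mod_length : nat := max_chain (fun P : {pred E} => GRing.submod_closed P).

Definition annihilator : {pred A} := fun a => `[< forall x : E, a *: x = 0 >].

(* Dimension of A / Ann E; it is 0 when E = 0. *)
Definition mod_dim : nat :=
  max_chain (fun P : {pred A} => prime_ideal P /\ {subset annihilator <= P}).

Definition ideal_smul (I : {pred A}) : set E :=
  [set z | exists a x, a \in I /\ z = a *: x].

End Multiplicity.

Arguments ideal_smul {A} E I.

(* When E = 0, this is the limit of 0. *)
Definition multiplicity (K : realType) (A : comNzRingType) (E : lmodType A) : K :=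
  let d := mod_dim E in
  lim ((fun n : nat =>
    d`!%:R *
    (mod_length (quot_mod (ideal_smul E (ideal_exp (maxideal A) n.+1))))%:R /
    n%:R ^+ d : K) @ \oo).

(* A local PID which is not a field, with maximal ideal (t); the last two
   clauses say that R -> lim_n R / (t^n) is injective and surjective. *)
Definition complete_dvr (R : idomainType) (t : R) : Prop :=
  [/\ t != 0,
      forall I : {pred R^o}, GRing.submod_closed I ->
        exists a : R, I =i principal a,
      maximal_ideal (principal t) /\
        (forall I, maximal_ideal I -> I =i principal t),
      forall x, (forall n, x \in principal (t ^+ n)) -> x = 0 &
      forall u : nat -> R, (forall n, u n.+1 - u n \in principal (t ^+ n)) ->
        exists l, forall n, u n - l \in principal (t ^+ n)].

(* R[[X_1, ..., X_n]]: a series is the family of its coefficients. *)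
Definition pseries (R : comNzRingType) (n : nat) : Type := 'X_{1..n} -> R.

Section PowerSeries.
Variable (R : comNzRingType).

Section Ring.
Variable n : nat.
Implicit Types f g h : pseries R n.

HB.instance Definition _ := Choice.copy (pseries R n) ('X_{1..n} -> R).

Let psopp f : pseries R n := fun k => - f k.
Let psadd f g : pseries R n := fun k => f k + g k.

Fact psaddA : associative psadd.
Proof. by move=> f g h; apply: funext => k; apply: addrA. Qed.
Fact psaddC : commutative psadd.
Proof. by move=> f g; apply: funext => k; apply: addrC. Qed.
Fact psadd0 : left_id (fun=> 0) psadd.
Proof. by move=> f; apply: funext => k; apply: add0r. Qed.
Fact psaddN : left_inverse (fun=> 0) psopp psadd.
Proof. by move=> f; apply: funext => k; apply: addNr. Qed.

HB.instance Definition _ := GRing.isZmodule.Build (pseries R n)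
  psaddA psaddC psadd0 psaddN.

Lemma psDE f g k : (f + g) k = f k + g k. Proof. by []. Qed.
Lemma psBE f g k : (f - g) k = f k - g k. Proof. by []. Qed.

Definition psone : pseries R n := fun k => (k == 0%MM)%:R.

Definition psmul f g : pseries R n := fun k =>
  \sum_(a : 'X_{1..n < (mdeg k).+1} | (a <= k)%MM) f a * g (k - a)%MM.

Let trunc d f : {mpoly R[n]} := \sum_(a : 'X_{1..n < d}) f a *: 'X_[a].

Let mcoeff_trunc d f k : (mdeg k < d)%N -> (trunc d f)@_k = f k.
Proof.
move=> kd; rewrite raddf_sum (bigD1 (BMultinom kd)) //= mcoeffZ mcoeffX eqxx.
rewrite mulr1 big1 ?addr0 // => a; rewrite bmeqP /= => /negPf ak.
by rewrite mcoeffZ mcoeffX ak mulr0.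
Qed.

Let mcoeff_mul (p q : {mpoly R[n]}) d k : (mdeg k < d)%N ->
  (p * q)@_k = \sum_(a : 'X_{1..n < d} | (a <= k)%MM) p@_a * q@_(k - a).
Proof. exact: mcoeff_poly_mul_lin. Qed.

Let psmul_trunc d f g k : (mdeg k < d)%N ->
  psmul f g k = (trunc d f * trunc d g)@_k.
Proof.
move=> kd; rewrite (mcoeff_mul _ _ (ltnSn _)).
apply: eq_bigr => a ak; rewrite !mcoeff_trunc //.
  by rewrite (leq_ltn_trans _ kd) // mdegB.
by rewrite (leq_ltn_trans _ kd) //; case: (a) => /= m; rewrite ltnS.
Qed.

Lemma psmulE d f g k : (mdeg k < d)%N ->
  psmul f g k = \sum_(a : 'X_{1..n < d} | (a <= k)%MM) f a * g (k - a)%MM.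
Proof.
move=> kd; rewrite (psmul_trunc _ _ kd) (mcoeff_mul _ _ kd).
apply: eq_bigr => a ak; rewrite !mcoeff_trunc //; last exact: bmdeg.
by rewrite (leq_ltn_trans _ kd) // mdegB.
Qed.

Let trunc_mul d f g k : (mdeg k < d)%N ->
  (trunc d (psmul f g))@_k = (trunc d f * trunc d g)@_k.
Proof. by move=> kd; rewrite mcoeff_trunc // (psmul_trunc _ _ kd). Qed.

Fact psmulC : commutative psmul.
Proof.
by move=> f g; apply: funext => k; rewrite !(psmul_trunc _ _ (ltnSn _)) mulrC.
Qed.

Fact psmulA : associative psmul.
Proof.
move=> f g h; apply: funext => k.
rewrite !(psmul_trunc _ _ (ltnSn _)).
set d := (mdeg k).+1; have kd : (mdeg k < d)%N by [].
transitivity ((trunc d f * (trunc d g * trunc d h))@_k).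
  rewrite !(mcoeff_mul _ _ kd); apply: eq_bigr => a ak; congr (_ * _).
  by apply: trunc_mul; rewrite (leq_ltn_trans _ kd) // mdegB.
rewrite mulrA !(mcoeff_mul _ _ kd); apply: eq_bigr => a ak; congr (_ * _).
by rewrite trunc_mul // bmdeg.
Qed.

Fact psmul1 : left_id psone psmul.
Proof.
move=> f; apply: funext => k; rewrite /psmul.
have k0 : (mdeg (0%MM : 'X_{1..n}) < (mdeg k).+1)%N by rewrite mdeg0.
rewrite (bigD1 (BMultinom k0)) /=; last by apply/mnm_lepP=> i; rewrite mnmE.
rewrite /psone eqxx mul1r big1 ?addr0 => [|a /andP[_]].
  by congr f; apply/mnmP=> i; rewrite mnmBE mnmE subn0.
by rewrite bmeqP /= => /negPf ->; rewrite mul0r.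
Qed.

Fact psmulDl : left_distributive psmul +%R.
Proof.
move=> f g h; apply: funext => k; rewrite psDE /psmul -big_split.
by apply: eq_bigr => a _; rewrite psDE mulrDl.
Qed.

Fact psone_neq0 : psone != 0.
Proof.
by apply/eqP => /(congr1 (fun f => f 0%MM))/eqP; rewrite /psone eqxx oner_eq0.
Qed.

HB.instance Definition _ := GRing.Zmodule_isComNzRing.Build (pseries R n)
  psmulA psmulC psmul1 psmulDl psone_neq0.

Lemma ps1E k : (1 : pseries R n) k = (k == 0%MM)%:R.
Proof. by []. Qed.

Lemma psME f g d k : (mdeg k < d)%N ->
  (f * g) k = \sum_(a : 'X_{1..n < d} | (a <= k)%MM) f a * g (k - a)%MM.
Proof. exact: psmulE. Qed.

Definition psC (c : R) : pseries R n := fun k => if k == 0%MM then c else 0.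

Fact psC_zmod : zmod_morphism psC.
Proof.
move=> c c'; apply: funext => k; rewrite psBE /psC.
by case: ifP; rewrite ?subrr.
Qed.

Fact psC_monoid : monoid_morphism psC.
Proof.
split=> [|c c']; apply: funext => k; rewrite /psC.
  by rewrite ps1E; case: eqP.
rewrite (psME _ _ (ltnSn _)).
have k0 : (mdeg (0%MM : 'X_{1..n}) < (mdeg k).+1)%N by rewrite mdeg0.
rewrite (bigD1 (BMultinom k0)) /=; last by apply/mnm_lepP=> i; rewrite mnmE.
rewrite /psC eqxx big1 ?addr0 => [|a /andP[_]]; last first.
  by rewrite bmeqP /= => /negPf ->; rewrite mul0r.
have -> : (k - 0)%MM = k by apply/mnmP=> i; rewrite mnmBE mnmE subn0.
by case: ifP; rewrite ?mulr0.
Qed.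

HB.instance Definition _ := GRing.isZmodMorphism.Build R (pseries R n) psC psC_zmod.
HB.instance Definition _ := GRing.isMonoidMorphism.Build R (pseries R n) psC psC_monoid.

End Ring.

(* Renaming of variables X_i |-> X_(s i), for s injective: the coefficient at k
   vanishes unless k only involves the variables in the image of s. *)
Definition rename n N (s : 'I_n -> 'I_N) (f : pseries R n) : pseries R N :=
  fun k => if [forall j, (j \in codom s) || (k j == 0%N)]
           then f [multinom k (s i) | i < n] else 0.

Section Rename.
Variables (n N : nat) (s : 'I_n -> 'I_N).
Hypothesis s_inj : injective s.

Let supp (k : 'X_{1..N}) := [forall j, (j \in codom s) || (k j == 0%N)].
Let res (k : 'X_{1..N}) : 'X_{1..n} := [multinom k (s i) | i < n].
Let ext (a : 'X_{1..n}) : 'X_{1..N} := (\sum_i U_(s i) *+ a i)%MM.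

Let ext_im a i : ext a (s i) = a i.
Proof.
rewrite mnm_sumE (bigD1 i) //= mulmnE mnm1E eqxx mul1n big1 ?addn0 // => j ji.
by rewrite mulmnE mnm1E (inj_eq s_inj) (negPf ji).
Qed.

Let ext_out a j : j \notin codom s -> ext a j = 0%N.
Proof.
move=> js; rewrite mnm_sumE big1 // => i _; rewrite mulmnE mnm1E.
by case: eqP js => // <-; rewrite codom_f.
Qed.

Let res_ext a : res (ext a) = a.
Proof. by apply/mnmP=> i; rewrite mnmE ext_im. Qed.

Let ext_res k : supp k -> ext (res k) = k.
Proof.
move=> /forallP ks; apply/mnmP=> j; case: (boolP (j \in codom s)) => [|js].
  by case/codomP=> i ->; rewrite ext_im mnmE.
by rewrite ext_out //; apply/esym/eqP; have := ks j; rewrite (negPf js).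
Qed.

Let supp_ext a : supp (ext a).
Proof.
by apply/forallP=> j; case: (boolP (j \in codom s)) => //= /ext_out ->.
Qed.

Let supp_le k a : supp k -> (a <= k)%MM -> supp a.
Proof.
move=> /forallP ks /mnm_lepP ak; apply/forallP=> j; have := ks j.
by case: (j \in codom s) => //= /eqP k0; rewrite -leqn0 -k0.
Qed.

Let supp_split k a : (a <= k)%MM -> supp a -> supp (k - a)%MM -> supp k.
Proof.
move=> /mnm_lepP ak /forallP as_ /forallP bs; apply/forallP=> j.
have := as_ j; have := bs j; case: (j \in codom s) => //=; rewrite mnmBE.
by move=> /eqP b0 /eqP a0; rewrite -leqn0 -b0 a0 subn0.
Qed.

Let mdeg_ext a : mdeg (ext a) = mdeg a.
Proof.
rewrite mdeg_sum mdegE; apply: eq_bigr => i _.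
by rewrite mdegMn mdeg1 mul1n.
Qed.

Let resB k a : res (k - a)%MM = (res k - res a)%MM.
Proof. by apply/mnmP=> i; rewrite !mnmE. Qed.

Lemma rename_zmod : zmod_morphism (rename s).
Proof.
move=> f g; apply: funext => k; rewrite psBE /rename.
by case: ifP; rewrite ?subrr.
Qed.

Lemma rename_monoid : monoid_morphism (rename s).
Proof.
split=> [|f g]; apply: funext => k.
  rewrite /rename !ps1E -/(supp k) -/(res k).
  have -> : (k == 0%MM) = supp k && (res k == 0%MM).
    apply/eqP/andP=> [->|[ks /eqP k0]].
      by split; [apply/forallP=> j|apply/eqP/mnmP=> i]; rewrite !mnmE ?orbT.
    rewrite -(ext_res ks) k0; apply/mnmP=> j; rewrite mnm_sumE mnmE big1 // => i _.
    by rewrite mulmnE mnm0E muln0.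
  by case: ifP.
rewrite [RHS](psME _ _ (ltnSn _)) {1}/rename -/(supp k) -/(res k); case: (boolP (supp k)) => ks; last first.
  rewrite big1 // => a ak; rewrite /rename -/(supp a) -/(supp (k - a)%MM).
  case: (boolP (supp a)) => as_; rewrite ?mul0r //.
  case: (boolP (supp (k - a)%MM)) => bs; rewrite ?mulr0 //.
  by rewrite (supp_split ak as_ bs) in ks.
have kd : (mdeg k < (mdeg k).+1)%N by [].
have rd : (mdeg (res k) < (mdeg k).+1)%N by rewrite -mdeg_ext ext_res.
rewrite (psME _ _ rd).
have extd (a : 'X_{1..n < (mdeg k).+1}) : (mdeg (ext a) < (mdeg k).+1)%N.
  by rewrite mdeg_ext bmdeg.
have resd (a : 'X_{1..N < (mdeg k).+1}) : (mdeg (res a) < (mdeg k).+1)%N.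
  apply: leq_ltn_trans (bmdeg a); rewrite -mdeg_ext mdegE (mdegE a).
  apply: leq_sum => j _; case: (boolP (j \in codom s)) => [|js].
    by case/codomP=> i ->; rewrite ext_im mnmE.
  by rewrite ext_out.
rewrite [RHS](reindex_onto (fun a => BMultinom (extd a))
  (fun a => BMultinom (resd a))) /=; last first.
  by move=> a ak; apply/eqP; rewrite bmeqP /= ext_res // (supp_le ks).
apply: eq_big => [a|a ak].
  have -> : (BMultinom (resd (BMultinom (extd a))) == a) = true.
    by rewrite bmeqP /= res_ext eqxx.
  rewrite andbT; apply/mnm_lepP/mnm_lepP=> [ak j|ak i].
    case: (boolP (j \in codom s)) => [/codomP[i ->]|js]; last by rewrite ext_out.
    by rewrite ext_im; have := ak i; rewrite mnmE.
  by have := ak (s i); rewrite ext_im mnmE.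
have eak : (ext a <= k)%MM.
  apply/mnm_lepP=> j; case: (boolP (j \in codom s)) => [/codomP[i ->]|js].
    by rewrite ext_im; have /mnm_lepP/(_ i) := ak; rewrite mnmE.
  by rewrite ext_out.
rewrite /rename -/(supp _) -/(supp _) supp_ext -/(res _) -/(res _) res_ext.
have -> : supp (k - ext a)%MM by apply: (supp_le ks); apply: lem_subr.
by rewrite resB res_ext.
Qed.

End Rename.

Variables n m : nat.

(* The inclusions of R[[X_1, ..., X_n]] and R[[Y_1, ..., Y_m]] into
   R[[X_1, ..., X_n, Y_1, ..., Y_m]]. *)
Definition psX : pseries R n -> pseries R (n + m) := rename (@lshift n m).
Definition psY : pseries R m -> pseries R (n + m) := rename (@rshift n m).

HB.instance Definition _ := GRing.isZmodMorphism.Build _ _ psX (rename_zmod _).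
HB.instance Definition _ := GRing.isMonoidMorphism.Build _ _ psX
  (rename_monoid (@lshift_inj n m)).
HB.instance Definition _ := GRing.isZmodMorphism.Build _ _ psY (rename_zmod _).
HB.instance Definition _ := GRing.isMonoidMorphism.Build _ _ psY
  (rename_monoid (@rshift_inj n m)).

(* (M (x)_A C) (x)_C (N (x)_B C) *)
Definition ctensor (M : lmodType (pseries R n)) (N : lmodType (pseries R m)) : Type :=
  tensor (idfun : {rmorphism pseries R (n + m) -> pseries R (n + m)})
    (tensor psX M (pseries R (n + m))^o)
    (tensor psY N (pseries R (n + m))^o).

HB.instance Definition _ M N := GRing.Lmodule.on (ctensor M N).

End PowerSeries.

Arguments psC {R n}.

(* Main.v *)
Require Import Defs.
From HB Require Import structures.
From mathcomp Require Import all_boot all_order all_algebra.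
From mathcomp Require Import mpoly.
From mathcomp Require Import boolp classical_sets reals.
From mathcomp Require Import topology normedtype sequences.
From mathcomp Require Import zify ring lra.

Set Implicit Arguments.
Unset Strict Implicit.
Unset Printing Implicit Defensive.

Import GRing.Theory Num.Theory Order.TTheory.
Import numFieldNormedType.Exports.

Local Open Scope classical_set_scope.
Local Open Scope ring_scope.

(** Let m denote the maximal ideal, F k, G k and p k the lengths of M / m ^ k M,
    N / m ^ k N and P / m ^ k P, where P is the completed tensor product, and
    let a and b be the dimensions of M and N. These functions are eventually
    polynomial, of degrees the dimensions, and the multiplicity is the
    normalized leading coefficient. If e(M) or e(N) vanishes there is nothing
    to prove, so suppose not. Two bounds carry the inequality.

    The upper bound fixes the dimension of P. Filter M by a composition series
    over R; each simple quotient is R / t, and tensored with N it contributes a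
    quotient of N / t N. Hence p k <= F k * H k, where H is the Hilbert-Samuel
    function of N / t N [colen_tensor_le]. Since N is flat, t is injective on
    N, so by Artin-Rees H has degree at most b - 1 and p has degree at most
    a + b - 1.

    The lower bound compares leading terms [colen_tensor_ge]. Present M as a
    quotient of a free A-module and treat t as one more variable: monomials
    t ^ s X ^ a e_i outside the leading module of the relations are called
    standard, and F k counts those of degree less than k. As an R-module, P
    modulo m ^ k is the direct sum over the strands X ^ a e_i of quotients of
    N, modulo the relations of M. On each strand the leading monomials are the
    multiples by powers of t of a single one, so one relation per strand
    suffices, and it is known to which power of m its coefficients belong.
    Counting lengths gives
      p k >= \sum_(i < k) (F i.+1 - F i) * (G (k - i) - G (k - i).-1).
    If F and G grow like e(M) k ^ a / a`! and e(N) k ^ b / b`!, the right side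
    grows like e(M) e(N) k ^ (a + b - 1) / (a + b - 1)`! [conv_leading].
    So p has degree exactly a + b - 1, which is the dimension of P, and its
    normalized leading coefficient e(P) is at least e(M) e(N).

    That Hilbert-Samuel functions are eventually polynomial comes from
    Dickson's lemma applied to standard monomials [hs_evpoly], and the same
    monomials give Artin-Rees by division with remainder [artin_rees]. That
    the degree is the length of the longest chain of primes over the
    annihilator [mod_dimE] is shown by building chains from ideals maximal
    among those of a given growth [prime_above], and by the drop in growth
    caused by a nonzerodivisor. *)

(** * Length of abelian groups with operators *)

Section OperatorLength.
Variable T : Type.

Section OneGroup.
Variables (V : zmodType) (act : T -> V -> V).

Definition opsub (U : set V) : Prop :=
  [/\ U 0, forall x y, U x -> U y -> U (x - y) &
      forall a x, U x -> U (act a x)].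

Definition addset (U W : set V) : set V :=
  [set z | exists x y, [/\ U x, W y & z = x + y]].

Definition covers (U W : set V) : Prop :=
  [/\ U `<=` W, ~ W `<=` U &
      forall D, opsub D -> U `<=` D -> D `<=` W -> D `<=` U \/ W `<=` D].

(** Composition series of W / U. Every length below is read off this relation,
    which is functional in its last argument by Jordan-Hoelder. Operators are
    used instead of scalars because the same group is measured over A, where
    multiplicities are defined, and over R, where tensor products are
    compared. *)
Inductive clen : set V -> set V -> nat -> Prop :=
| clen0 U : clen U U 0
| clenS U U1 W l : opsub U1 -> covers U U1 -> clen U1 W l -> clen U W l.+1.

Lemma opsubN U x : opsub U -> U x -> U (- x).
Proof. by case=> U0 UB _ Ux; rewrite -sub0r; apply: UB. Qed.

Lemma opsubB U x y : opsub U -> U x -> U y -> U (x - y).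
Proof. by case=> _ UB _; apply: UB. Qed.

Lemma opsubD U x y : opsub U -> U x -> U y -> U (x + y).
Proof. by move=> sU Ux Uy; rewrite -(opprK y); apply: (opsubB sU) => //; apply: opsubN. Qed.

Lemma opsubI U W : opsub U -> opsub W -> opsub (U `&` W).
Proof.
move=> [U0 UB UZ] [W0 WB WZ]; split=> // [x y [? ?] [? ?]|a x [? ?]].
  by split; [apply: UB|apply: WB].
by split; [apply: UZ|apply: WZ].
Qed.

Hypothesis actD : forall a x y, act a (x + y) = act a x + act a y.

Lemma opsub_add U W : opsub U -> opsub W -> opsub (addset U W).
Proof.
move=> [U0 UB UZ] [W0 WB WZ]; split.
- by exists 0, 0; rewrite addr0.
- move=> _ _ [x [y [? ? ->]]] [x' [y' [? ? ->]]].
  by exists (x - x'), (y - y'); split; [apply: UB|apply: WB|rewrite opprD addrACA].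
- move=> a _ [x [y [? ? ->]]].
  by exists (act a x), (act a y); split; [apply: UZ|apply: WZ|].
Qed.

Lemma addset_subl U W : opsub W -> U `<=` addset U W.
Proof. by case=> W0 _ _ x Ux; exists x, 0; rewrite addr0. Qed.

Lemma addset_subr U W : opsub U -> W `<=` addset U W.
Proof. by case=> U0 _ _ x Ux; exists 0, x; rewrite add0r. Qed.

Lemma addset_min U W D : opsub D -> U `<=` D -> W `<=` D -> addset U W `<=` D.
Proof. by move=> sD UD WD _ [x [y [/UD ? /WD ? ->]]]; apply: opsubD. Qed.

Lemma clen_sub U W l : clen U W l -> U `<=` W.
Proof.
elim=> {U W l} [U|U U1 W l _ [UU1 _ _] _]; first exact: subset_refl.
exact: subset_trans.
Qed.

Lemma clen_cat U V' W a b : clen U V' a -> clen V' W b -> clen U W (a + b).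
Proof.
elim=> {U V' a} [//|U U1 V' a sU1 cU _ IH] cW.
by rewrite addSn; apply: clenS sU1 cU (IH cW).
Qed.

Lemma covers_meet U W D : opsub U -> opsub W -> opsub D -> covers U W ->
  ~ (W `&` D `<=` U) -> covers (U `&` D) (W `&` D) /\ W `<=` addset U D.
Proof.
move=> sU sW sD [UW _ cUW] nWD.
have join E : opsub E -> E `<=` W -> ~ E `<=` U -> W `<=` addset U E.
  move=> sE EW EU; case: (cUW (addset U E)) => //.
  - exact: opsub_add.
  - exact: addset_subl.
  - exact: addset_min.
  - by move=> h; case: EU; apply: subset_trans h; apply: addset_subr.
split; last first.
  move=> x /(join _ (opsubI sW sD) (@subIsetl _ _ _) nWD) [y [z [Uy [_ Dz] ->]]].
  by exists y, z.
split.
- by move=> x [/UW].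
- by move=> h; apply: nWD => x /h[].
- move=> E sE hE EW; case: (EM (E `<=` U)) => EU.
    by left=> x Ex; split; [apply: EU|case: (EW _ Ex)].
  right=> x [Wx Dx]; have [y [z [Uy Ez xE]]] : addset U E x.
    by apply: join => // y /EW[].
  rewrite xE; apply: opsubD => //; apply: hE; split=> //.
  have -> : y = x - z by rewrite xE addrK.
  by apply: (opsubB sD) => //; case: (EW _ Ez).
Qed.

End OneGroup.

Section Morphism.
Variables (V W : zmodType) (actV : T -> V -> V) (actW : T -> W -> W).
Hypothesis actWD : forall a x y, actW a (x + y) = actW a x + actW a y.
Variable f : V -> W.
Hypothesis fB : forall x y, f (x - y) = f x - f y.
Hypothesis fZ : forall a x, f (actV a x) = actW a (f x).

Lemma opm0 : f 0 = 0.
Proof. by have := fB 0 0; rewrite !subrr. Qed.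

Lemma opmN x : f (- x) = - f x.
Proof. by rewrite -sub0r fB opm0 sub0r. Qed.

Lemma opmD x y : f (x + y) = f x + f y.
Proof. by rewrite -{1}(opprK y) fB opmN opprK. Qed.

Lemma opsub_preim U D : opsub actV U -> opsub actW D -> opsub actV (U `&` f @^-1` D).
Proof.
move=> sU [D0 DB DZ]; apply: opsubI => //; split=> /=.
- by rewrite opm0.
- by move=> x y ? ?; rewrite fB; apply: DB.
- by move=> a x ?; rewrite fZ; apply: DZ.
Qed.

Lemma opsub_image U : opsub actV U -> opsub actW (f @` U).
Proof.
move=> [U0 UB UZ]; split.
- by exists 0; rewrite ?opm0.
- by move=> _ _ [x Ux <-] [y Uy <-]; exists (x - y); rewrite ?fB //; apply: UB.
- by move=> a _ [x Ux <-]; exists (actV a x); rewrite ?fZ //; apply: UZ.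
Qed.

Lemma covers_image U U1 W0 : opsub actV U -> opsub actV U1 -> opsub actW W0 ->
  covers actV U U1 -> f @` U `<=` W0 ->
  addset W0 (f @` U1) = W0 \/ covers actW W0 (addset W0 (f @` U1)).
Proof.
move=> sU sU1 sW0 [UU1 _ cU] fU; set W1 := addset _ _.
have sfU1 := opsub_image sU1.
have W01 : W0 `<=` W1 by apply: addset_subl sfU1.
case: (EM (W1 `<=` W0)) => W10; first by left; apply/seteqP.
right; split=> // D sD W0D DW1.
case: (cU (U1 `&` f @^-1` D)).
- exact: opsub_preim.
- by move=> x Ux; split; [apply: UU1|apply/W0D/fU; exists x].
- by move=> x [].
- move=> hU; left=> d Dd; have [w [_ [W0w [u U1u <-] dE]]] := DW1 _ Dd.
  rewrite dE; apply: (opsubD sW0 W0w); apply: fU; exists u => //; apply: hU.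
  split=> //=; have -> : f u = d - w by rewrite dE addrC addKr.
  by apply: (opsubB sD) => //; apply: W0D.
- move=> hU; right; apply: (addset_min sD) => // _ [u U1u <-].
  by case: (hU _ U1u).
Qed.

(** Each simple step of the source maps onto a step that is trivial or simple
    again. *)
Lemma clen_image U U1 W0 l : opsub actV U -> opsub actV U1 -> opsub actW W0 ->
  clen actV U U1 l -> f @` U `<=` W0 ->
  exists2 l', (l' <= l)%N & clen actW W0 (addset W0 (f @` U1)) l'.
Proof.
move=> sU sU1 sW0 cU.
elim: cU sU sU1 W0 sW0 => {U U1 l} [U|U U' U1 l sU' cU c IH] sU sU1 W0 sW0 fU.
  exists 0%N => //; have -> : addset W0 (f @` U) = W0; last exact: clen0.
  apply/seteqP; split; last exact: (addset_subl (opsub_image sU)).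
  exact: (addset_min sW0).
have sW1 := opsub_add actWD sW0 (opsub_image sU').
have [|l' ll' c'] := IH sU' sU1 _ sW1.
  exact: (addset_subr sW0).
have E : addset (addset W0 (f @` U')) (f @` U1) = addset W0 (f @` U1).
  apply/seteqP; split=> z.
    move=> [_ [_ [[w [_ [Ww [u U'u <-] ->]]] [v U1v <-] ->]]].
    exists w, (f u + f v); split=> //; last by rewrite addrA.
    exists (u + v); last by rewrite opmD.
    by apply: opsubD sU1 _ U1v; apply: (clen_sub c).
  move=> [w [v [Ww U1v ->]]]; exists w, v; split=> //.
  exact: (addset_subl (opsub_image sU')).
rewrite E in c'.
have [E1|cW] := covers_image sU sU' sW0 cU fU.
  by exists l'; [exact: leqW|rewrite E1 in c'].
by exists l'.+1 => //; apply: (clenS sW1 cW).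
Qed.

Lemma clen_preim D U U1 l : opsub actV D -> opsub actW U -> opsub actW U1 ->
  U1 `<=` f @` D -> clen actW U U1 l ->
  clen actV (D `&` f @^-1` U) (D `&` f @^-1` U1) l.
Proof.
move=> sD sU sU1 U1D cU; elim: cU sU sU1 U1D => {U U1 l} [*|U U' U1 l sU' [UU' nU cU] c IH sU sU1 U1D].
  exact: clen0.
have U'D : U' `<=` f @` D by apply: subset_trans U1D; apply: clen_sub c.
apply: (clenS (opsub_preim sD sU')); last exact: IH.
split.
- by move=> x [Dx /UU'].
- move=> h; apply: nU => y U'y; have [x Dx xy] := U'D _ U'y.
  by rewrite -xy; have [] : (D `&` f @^-1` U) x by apply: h; rewrite /= -xy in U'y *.
- move=> E sE UE EU'; case: (cU (f @` E)).
  + exact: opsub_image.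
  + move=> y Uy; have [x Dx xy] := U'D _ (UU' _ Uy).
    by exists x => //; apply: UE; rewrite /= xy.
  + by move=> _ [x /EU'[_ ?] <-].
  + by move=> h; left=> x Ex; split; [case: (EU' _ Ex)|apply: h; exists x].
  + move=> h; right=> x [Dx U'x]; have [y Ey yx] := h _ U'x.
    rewrite -(subrK y x); apply: (opsubD sE) => //; apply: UE; split.
      by apply: (opsubB sD) => //; case: (EU' _ Ey).
    by rewrite /= fB yx subrr; case: sU.
Qed.

Lemma covers_quot U U1 : opsub actV U -> opsub actV U1 ->
  (forall x, f x = 0 -> U x) -> covers actV U U1 -> covers actW (f @` U) (f @` U1).
Proof.
move=> sU sU1 kU [UU1 nU cU]; split.
- by move=> _ [x Ux <-]; exists x => //; apply: UU1.
- move=> h; apply: nU => x U1x; have [|y Uy yx] := h (f x); first by exists x.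
  by rewrite -(subrK y x); apply: (opsubD sU) => //; apply: kU; rewrite fB yx subrr.
- move=> D sD UD DU1; case: (cU (U1 `&` f @^-1` D)).
  + exact: opsub_preim.
  + by move=> x Ux; split; [apply: UU1|apply: UD; exists x].
  + by move=> x [].
  + move=> h; left=> d Dd; have [x U1x xd] := DU1 _ Dd.
    by exists x => //; apply: h; split=> //=; rewrite xd.
  + by move=> h; right=> _ [x U1x <-]; have [] := h _ U1x.
Qed.

Lemma clen_quot U U1 l : opsub actV U -> opsub actV U1 ->
  (forall x, f x = 0 -> U x) -> clen actV U U1 l -> clen actW (f @` U) (f @` U1) l.
Proof.
move=> sU sU1 kU c; elim: c sU sU1 kU => {U U1 l} [U|U U' U1 l sU' cU c IH] sU sU1 kU.
  exact: clen0.
apply: (clenS (opsub_image sU') (covers_quot sU sU' kU cU)); apply: IH => // x /kU.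
by case: cU => h _ _ /h.
Qed.

End Morphism.

Section JordanHolder.
Variables (V : zmodType) (act : T -> V -> V).
Hypothesis actD : forall a x y, act a (x + y) = act a x + act a y.

(** By modularity, each step of the series survives in exactly one of its
    intersection with D and its sum with D. *)
Lemma clen_meet_join U W D l : opsub act U -> opsub act W -> opsub act D ->
  clen act U W l ->
  exists l1 l2, [/\ l = (l1 + l2)%N, clen act (U `&` D) (W `&` D) l1 &
    clen act (addset U D) (addset W D) l2].
Proof.
move=> sU sW sD c; elim: c sU sW => {U W l} [U|U U1 W l sU1 cU c IH] sU sW.
  by exists 0%N, 0%N; split=> //; apply: clen0.
have [l1 [l2 [-> c1 c2]]] := IH sU1 sW.
have [UU1 nU _] := cU.
case: (EM (U1 `&` D `<=` U)) => h.
  exists l1, l2.+1; split; first by rewrite addnS.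
    have -> : U `&` D = U1 `&` D; last exact: c1.
    by apply/seteqP; split=> x [? ?]; split=> //; [apply: UU1|apply: h].
  apply: (clenS (opsub_add actD sU1 sD) _ c2).
  have sUD := opsub_add actD sU sD.
  have sub : [set id x | x in U] `<=` addset U D.
    by rewrite image_id; apply: (addset_subl sD).
  have EU : addset (addset U D) [set id x | x in U1] = addset U1 D.
    rewrite image_id.
    apply/seteqP; split=> [_ [_ [z [[x [y [Ux Dy ->]]] U1z ->]]]|_ [x [y [U1x Dy ->]]]].
      by exists (x + z), y; split=> //; [apply: (opsubD sU1) => //; apply: UU1|rewrite addrAC].
    by exists y, x; split=> //; [apply: (addset_subr sU)|rewrite addrC].
  have := covers_image (f := id) (actV := act) (actW := act) (fun _ _ => erefl) (fun _ _ => erefl) sU sU1 sUD cU sub.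
  rewrite EU => -[E|//]; case: nU => x U1x.
  have [y [z [Uy Dz xE]]] : addset U D x by rewrite -E; apply: (addset_subl sD).
  rewrite xE; apply: (opsubD sU) => //; apply: h; split=> //.
  have -> : z = x - y by rewrite xE addrC addKr.
  by apply: (opsubB sU1) => //; apply: UU1.
have [cD U1D] := covers_meet actD sU sU1 sD cU h.
exists l1.+1, l2; split=> //; first exact: (clenS (opsubI sU1 sD) cD).
have -> : addset U D = addset U1 D; last exact: c2.
apply/seteqP; split; first by move=> _ [x [y [/UU1 ? ? ->]]]; exists x, y.
apply: (addset_min (opsub_add actD sU sD)); first exact: U1D.
exact: (addset_subr sU).
Qed.

Lemma clen_split U W D l : opsub act U -> opsub act W -> opsub act D ->
  U `<=` D -> D `<=` W -> clen act U W l ->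
  exists l1 l2, [/\ l = (l1 + l2)%N, clen act U D l1 & clen act D W l2].
Proof.
move=> sU sW sD UD DW /(clen_meet_join sU sW sD)[l1 [l2 [-> c1 c2]]].
exists l1, l2; split=> //.
  by rewrite (setIidl UD) (setIidr DW) in c1.
have [E1 E2] : addset U D = D /\ addset W D = W; last by rewrite E1 E2 in c2.
split; apply/seteqP; split.
- exact: (addset_min sD).
- exact: (addset_subr sU).
- exact: (addset_min sW).
- exact: (addset_subl sD).
Qed.

Lemma clen_trivial U W l : opsub act W -> clen act U W l -> W `<=` U -> l = 0%N.
Proof.
move=> sW c; case: c sW => // {U W l} U U1 W l _ [_ nU _] c _ WU.
by case: nU; apply: subset_trans WU; apply: clen_sub c.
Qed.

Lemma clen_covers U W l : opsub act U -> opsub act W -> covers act U W ->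
  clen act U W l -> l = 1%N.
Proof.
move=> sU sW cU c; case: c cU sU sW => {U W l} [U|U U1 W l sU1 [UU1 nU _] c] [UW nUW cU] sU sW.
  by case: nUW.
have U1W := clen_sub c; case: (cU _ sU1 UU1 U1W) => // WU1.
by rewrite (clen_trivial sW c WU1).
Qed.

Lemma clen_uniq U W l l' : opsub act U -> opsub act W ->
  clen act U W l -> clen act U W l' -> l = l'.
Proof.
move=> sU sW c; elim: c sU sW l' => {U W l} [U|U U1 W l sU1 cU c IH] sU sW l' c'.
  by rewrite (clen_trivial sU c').
have [||l1 [l2 [-> c1 c2]]] := clen_split sU sW sU1 _ _ c'.
- by case: cU.
- exact: clen_sub c.
by rewrite (clen_covers sU sU1 cU c1) (IH sU1 sW _ c2).
Qed.

Lemma clen_le U W U' W' l l' : opsub act U -> opsub act W -> opsub act U' ->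
  opsub act W' -> U `<=` U' -> W' `<=` W ->
  clen act U W l -> clen act U' W' l' -> (l' <= l)%N.
Proof.
move=> sU sW sU' sW' UU' WW' c c'; have U'W' := clen_sub c'.
have [|a [b [-> _ c1]]] := clen_split sU sW sU' UU' _ c.
  exact: subset_trans WW'.
have [a' [b' [-> c2 _]]] := clen_split sU' sW sW' U'W' WW' c1.
by rewrite (clen_uniq sU' sW' c' c2); lia.
Qed.

Lemma clen_chain U W l (c : nat -> set V) k : opsub act U -> opsub act W ->
  clen act U W l -> (forall i, (i <= k)%N -> opsub act (c i)) ->
  U `<=` c 0%N -> c k `<=` W ->
  (forall i, (i < k)%N -> c i `<=` c i.+1 /\ ~ c i.+1 `<=` c i) -> (k <= l)%N.
Proof.
move=> sU sW; elim: k l W sW => [//|k IH] l W sW cl sc Uc cW step.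
have [cc nc] := step _ (ltnSn k).
have Uck : U `<=` c k.
  have : forall i, (i <= k)%N -> U `<=` c i.
    elim=> // i IHi ik; apply: subset_trans (IHi (ltnW ik)) _.
    by case: (step i) => //; apply: ltnW.
  exact.
have [|l1 [l2 [-> c1 c2]]] := clen_split sU sW (sc k (leqnSn k)) Uck _ cl.
  exact: subset_trans cW.
have kl1 : (k <= l1)%N.
  apply: (IH _ _ (sc k (leqnSn k)) c1) => // [i ik|i ik]; first by apply: sc; lia.
  by apply: step; lia.
case: l2 c2 => [c2|l2 _]; last lia.
case: nc; apply: subset_trans cW _; inversion c2; exact: subset_refl.
Qed.

Lemma clen_series U W l : opsub act U -> clen act U W l ->
  exists c : nat -> set V, [/\ c 0%N = U, forall i, (i <= l)%N -> opsub act (c i) &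
    forall i, (i < l)%N -> c i `<=` c i.+1 /\ ~ c i.+1 `<=` c i].
Proof.
move=> sU c; elim: c sU => {U W l} [U|U U1 W l sU1 cU _ IH] sU.
  by exists (fun=> U); split.
have [c [c0 sc nc]] := IH sU1; exists (fun i => if i is i'.+1 then c i' else U).
split=> // [[|i]|[|i]] // il; [exact: sc|by rewrite c0; case: cU|exact: nc].
Qed.

End JordanHolder.

(** Second isomorphism theorem, for the image of a morphism. *)
Lemma clen_iso (V W : zmodType) (actV : T -> V -> V) (actW : T -> W -> W) (f : V -> W)
    (W0 : set W) l :
  (forall a x y, actW a (x + y) = actW a x + actW a y) ->
  (forall x y, f (x - y) = f x - f y) -> (forall a x, f (actV a x) = actW a (f x)) ->
  opsub actW W0 -> clen actW W0 (addset W0 (f @` setT)) l ->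
  clen actV (f @^-1` W0) setT l.
Proof.
move=> actWD fB fZ sW0 c.
have sT : opsub actV setT by [].
have sI := opsub_image fB fZ sT.
have sS := opsub_add actWD sW0 sI.
have [l1 [l2 [-> c1 c2]]] := clen_meet_join actWD sW0 sS sI c.
have -> : l2 = 0%N.
  apply: (clen_trivial _ c2); first exact: opsub_add.
  apply: (addset_min sS) => //; exact: (addset_subr sW0).
rewrite addn0; have := clen_preim fB fZ sT (opsubI sW0 sI) (opsubI sS sI) _ c1.
have -> : setT `&` f @^-1` (W0 `&` [set f x | x in [set: V]]) = f @^-1` W0.
  by apply/seteqP; split=> x /= => [[_ []]|?] //; do 2?split=> //; exists x.
have -> : setT `&` f @^-1` (addset W0 [set f x | x in [set: V]] `&` [set f x | x in [set: V]]) = setT.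
  apply/seteqP; split=> x // _; split=> //; split; last by exists x.
  by apply: (addset_subr sW0); exists x.
by apply; apply: subIsetr.
Qed.

End OperatorLength.

(** * Power series over a complete discrete valuation ring *)

Section Divisibility.
Variables (R : idomainType) (t : R).

Definition tdvd (s : nat) (x : R) : Prop := exists y, x = y * t ^+ s.

Lemma tdvd_0n x : tdvd 0 x.
Proof. by exists x; rewrite mulr1. Qed.

Lemma tdvdn0 s : tdvd s 0.
Proof. by exists 0; rewrite mul0r. Qed.

Lemma tdvdX s : tdvd s (t ^+ s).
Proof. by exists 1; rewrite mul1r. Qed.

Lemma tdvdB s x y : tdvd s x -> tdvd s y -> tdvd s (x - y).
Proof. by move=> [a ->] [b ->]; exists (a - b); rewrite mulrBl. Qed.

Lemma tdvdN s x : tdvd s x -> tdvd s (- x).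
Proof. by move=> hx; rewrite -sub0r; apply: tdvdB => //; apply: tdvdn0. Qed.

Lemma tdvdD s x y : tdvd s x -> tdvd s y -> tdvd s (x + y).
Proof. by move=> hx hy; rewrite -(opprK y); apply/tdvdB/tdvdN. Qed.

Lemma tdvdM a b x y : tdvd a x -> tdvd b y -> tdvd (a + b) (x * y).
Proof. by move=> [u ->] [v ->]; exists (u * v); rewrite mulrACA exprD. Qed.

Lemma tdvd_le a b x : (a <= b)%N -> tdvd b x -> tdvd a x.
Proof.
move=> ab [u ->]; exists (u * t ^+ (b - a)).
by rewrite -mulrA -exprD subnK.
Qed.

Lemma tdvdMl s x y : tdvd s y -> tdvd s (x * y).
Proof. by move=> hy; rewrite -[s]add0n; apply: tdvdM => //; apply: tdvd_0n. Qed.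

Lemma tdvd_sum s I (r : seq I) (P : pred I) F :
  (forall i, P i -> tdvd s (F i)) -> tdvd s (\sum_(i <- r | P i) F i).
Proof.
by move=> h; elim/big_ind: _ => //; [apply: tdvdn0|move=> ? ? ? ?; apply: tdvdD].
Qed.

Section CompleteDVR.
Hypothesis hR : complete_dvr t.

Lemma dvr_t0 : t != 0. Proof. by case: hR. Qed.

Lemma tdvd_cancel a b x : tdvd (a + b) (t ^+ a * x) -> tdvd b x.
Proof.
move=> [y]; rewrite exprD mulrCA => /(mulfI (expf_neq0 a dvr_t0)) ->.
by exists y.
Qed.

Lemma tdvd_sep x : (forall s, tdvd s x) -> x = 0.
Proof. by case: hR => _ _ _ h _ hx; apply: h => s; apply/asboolP/hx. Qed.

Lemma dvr_complete (u : nat -> R) : (forall n, tdvd n (u n.+1 - u n)) ->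
  exists l, forall n, tdvd n (u n - l).
Proof.
case: hR => _ _ _ _ h hu; have [|l hl] := h u; first by move=> n; apply/asboolP/hu.
by exists l => n; have /asboolP := hl n.
Qed.

Lemma geometric_unit a : exists y, (1 - a * t) * y = 1.
Proof.
pose u N := \sum_(i < N) (a * t) ^+ i.
have hX n : tdvd n ((a * t) ^+ n) by exists (a ^+ n); rewrite exprMn.
have [|l hl] := @dvr_complete u.
  by move=> n; rewrite /u big_ord_recr /= addrAC subrr add0r.
exists l; apply/eqP; rewrite -subr_eq0; apply/eqP/tdvd_sep => n.
have uE : (1 - a * t) * u n = 1 - (a * t) ^+ n.
  by rewrite -opprB mulNr -subrX1 opprB.
have -> : (1 - a * t) * l - 1 = - ((1 - a * t) * (u n - l)) - (a * t) ^+ n.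
  by rewrite mulrBr uE opprB -addrA -opprD subrK.
by apply: tdvdB => //; apply/tdvdN/tdvdMl.
Qed.

Lemma tdvd1_1 : ~ tdvd 1 1.
Proof.
case: hR => _ _ [[[_ /negP h _] _] _] _ _ [y hy]; apply: h.
by apply/asboolP; exists y.
Qed.

Lemma tdvd_unit x : ~ tdvd 1 x -> exists y, x * y = 1.
Proof.
move=> nx; case: (hR) => _ _ [[_ maxt] _] _ _.
pose J : {pred R} := fun z => `[< exists a b, z = a * t + b * x >].
have [/asboolP[a [b ab]]|nJ] := boolP (1 \in J).
  have [y hy] := geometric_unit a; exists (b * y).
  by rewrite mulrCA mulrA -{1}(addKr (a * t) (b * x)) -ab addrC hy.
case: nx; have : x \in principal t.
  apply: (maxt J).
  - split=> //; first by apply/asboolP; exists 0, 0; rewrite !mul0r addr0.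
    move=> c _ _ /asboolP[a [b ->]] /asboolP[a' [b' ->]]; apply/asboolP.
    by exists (c * a + a'), (c * b + b'); ring.
  - by move=> z /asboolP[a ->]; apply/asboolP; exists a, 0; rewrite mul0r addr0.
  - by apply/asboolP; exists 0, 1; rewrite mul0r mul1r add0r.
by move=> /asboolP[y ->]; exists y.
Qed.

Lemma tdvd_exact s x : tdvd s x -> ~ tdvd s.+1 x ->
  exists u v, [/\ x = u * t ^+ s & u * v = 1].
Proof.
move=> [u ->] h; have [|v uv] := @tdvd_unit u; last by exists u, v.
by move=> [w wE]; apply: h; exists w; rewrite wE expr1 -mulrA -exprS.
Qed.

End CompleteDVR.
End Divisibility.

Section Series.
Variables (R : idomainType) (t : R) (n : nat).
Local Notation A := (pseries R n).
Implicit Types f g h : A.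

Definition psmono (b : 'X_{1..n}) : A := fun k => (k == b)%:R.

Lemma pssumE I (r : seq I) (P : pred I) (F : I -> A) k :
  (\sum_(i <- r | P i) F i) k = \sum_(i <- r | P i) F i k.
Proof. by elim/big_rec2: _ => // i x y _ <-. Qed.

Lemma psmonoE b f k :
  (psmono b * f) k = if (b <= k)%MM then f (k - b)%MM else 0.
Proof.
rewrite (psME _ _ (ltnSn (mdeg k))); case: ifPn => bk.
  have bd : (mdeg b < (mdeg k).+1)%N by rewrite ltnS; apply: lemc_mdeg; apply: lem_leo.
  rewrite (bigD1 (BMultinom bd)) //= /psmono eqxx mul1r big1 ?addr0 // => a /andP[_].
  by rewrite bmeqP /= => /negPf ->; rewrite mul0r.
rewrite big1 // => a ak; rewrite /psmono; case: eqP => [ab|]; rewrite ?mul0r //.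
by rewrite -ab ak in bk.
Qed.

Lemma psmono0 : psmono 0%MM = 1.
Proof. by apply: funext => k; rewrite ps1E. Qed.


Lemma psCmul c f k : (psC c * f) k = c * f k.
Proof.
rewrite (psME _ _ (ltnSn (mdeg k))).
have k0 : (mdeg (0%MM : 'X_{1..n}) < (mdeg k).+1)%N by rewrite mdeg0.
rewrite (bigD1 (BMultinom k0)) /=; last by apply/mnm_lepP=> i; rewrite mnmE.
rewrite /psC eqxx subm0 big1 ?addr0 // => a /andP[_].
by rewrite bmeqP /= => /negPf ->; rewrite mul0r.
Qed.

(** The m-adic filtration; m = (t, X) makes f lie in m ^ k exactly when t ^+
    (k - deg a) divides each coefficient f a. *)
Definition fil (k : nat) f : Prop := forall a, tdvd t (k - mdeg a) (f a).

Lemma fil0 f : fil 0 f.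
Proof. by move=> a; rewrite sub0n; apply: tdvd_0n. Qed.

Lemma filn0 k : fil k 0.
Proof. by move=> a; apply: tdvdn0. Qed.

Lemma filB k f g : fil k f -> fil k g -> fil k (f - g).
Proof. by move=> hf hg a; rewrite psBE; apply: tdvdB. Qed.

Lemma filN k f : fil k f -> fil k (- f).
Proof. by move=> hf; rewrite -sub0r; apply: filB => //; apply: filn0. Qed.

Lemma filD k f g : fil k f -> fil k g -> fil k (f + g).
Proof. by move=> hf hg a; rewrite psDE; apply: tdvdD. Qed.

Lemma fil_sum k I (r : seq I) (P : pred I) F :
  (forall i, P i -> fil k (F i)) -> fil k (\sum_(i <- r | P i) F i).
Proof.
by move=> h; elim/big_ind: _ => //; [apply: filn0|move=> ? ? ? ?; apply: filD].
Qed.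

Lemma fil_le a b f : (a <= b)%N -> fil b f -> fil a f.
Proof. by move=> ab hf k; apply: tdvd_le (hf k); apply: leq_sub2r. Qed.

Lemma filM a b f g : fil a f -> fil b g -> fil (a + b) (f * g).
Proof.
move=> hf hg k; rewrite (psME _ _ (ltnSn (mdeg k))); apply: tdvd_sum => c ck.
apply: tdvd_le (tdvdM (hf c) (hg (k - c)%MM)).
have : mdeg k = (mdeg c + mdeg (k - c)%MM)%N by rewrite -mdegD addmC submK.
lia.
Qed.

Lemma filMl k f g : fil k g -> fil k (f * g).
Proof. by move=> hg; rewrite -[k]add0n; apply: filM => //; apply: fil0. Qed.

Lemma fil_mono b : fil (mdeg b) (psmono b).
Proof.
move=> a; rewrite /psmono; case: eqP => [->|_]; last exact: tdvdn0.
by rewrite subnn; apply: tdvd_0n.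
Qed.

Lemma fil_psC s c : tdvd t s c -> fil s (psC c).
Proof.
move=> hc a; rewrite /psC; case: eqP => _; last exact: tdvdn0.
by apply: tdvd_le hc; apply: leq_subr.
Qed.

Lemma fil1P f : fil 1 f <-> tdvd t 1 (f 0%MM).
Proof.
split=> [/(_ 0%MM)|h a]; first by rewrite mdeg0.
have [->|a0] := eqVneq a 0%MM; first by rewrite mdeg0.
by have -> : (1 - mdeg a = 0)%N; [rewrite -mdeg_eq0 in a0; lia|apply: tdvd_0n].
Qed.

Hypothesis hR : complete_dvr t.

Lemma fil_sep f : (forall k, fil k f) -> f = 0.
Proof.
move=> h; apply: funext => a; apply: (tdvd_sep hR) => s.
by have := h (s + mdeg a)%N a; rewrite addnK.
Qed.

Lemma fil_complete (c : nat -> A) : (forall N, fil N (c N.+1 - c N)) ->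
  exists l, forall N, fil N (c N - l).
Proof.
move=> hc.
have /choice[l hl] : forall a : 'X_{1..n}, exists x, forall N,
    tdvd t N (c (N + mdeg a)%N a - x).
  move=> a; apply: (dvr_complete hR) => N.
  by have := hc (N + mdeg a)%N a; rewrite addnK addSn.
exists l => N a; rewrite psBE.
have [Na|aN] := leqP N (mdeg a).
  by have -> : (N - mdeg a = 0)%N; [lia|apply: tdvd_0n].
by have := hl a (N - mdeg a)%N; rewrite subnK // ltnW.
Qed.

Lemma fil_unit f : ~ fil 1 f -> exists g, f * g = 1.
Proof.
move=> /fil1P/(tdvd_unit hR)[v uv]; pose g := 1 - psC v * f.
have g1 : fil 1 g.
  apply/fil1P; rewrite /g psBE psCmul ps1E eqxx mulrC uv subrr; exact: tdvdn0.
have gX N : fil N (g ^+ N).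
  elim: N => [|N IH]; first exact: fil0.
  by rewrite exprS -add1n; apply: filM.
pose u N := \sum_(i < N) g ^+ i.
have [|l hl] := @fil_complete u.
  by move=> N; rewrite /u big_ord_recr /= addrAC subrr add0r.
suff gl : (1 - g) * l = 1.
  by exists (psC v * l); rewrite -{}gl /g opprB addrCA subrr addr0 mulrCA mulrA.
apply/eqP; rewrite -subr_eq0; apply/eqP/fil_sep => N.
have uE : (1 - g) * u N = 1 - g ^+ N by rewrite -opprB mulNr -subrX1 opprB.
have -> : (1 - g) * l - 1 = - ((1 - g) * (u N - l)) - g ^+ N.
  by rewrite mulrBr uE; ring.
by apply: filB => //; apply/filN/filMl.
Qed.

Lemma ideal_sub_fil1 (J : {pred A}) : idealr_closed J -> forall f, f \in J -> fil 1 f.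
Proof.
move=> [J0 /negP J1 JD] f fJ; apply: contrapT => /fil_unit[g fg]; apply: J1.
by have := JD g _ _ fJ J0; rewrite addr0 mulrC fg.
Qed.

Lemma fil1_ideal : idealr_closed (fun f : A => `[< fil 1 f >]).
Proof.
split; first by apply/asboolP/filn0.
  apply/negP => /asboolP/fil1P; rewrite ps1E eqxx; exact: tdvd1_1.
by move=> a u v /asboolP hu /asboolP hv; apply/asboolP/filD => //; apply: filMl.
Qed.

Lemma maxidealP f : f \in maxideal A <-> fil 1 f.
Proof.
have mm : maximal_ideal (fun f : A => `[< fil 1 f >]).
  split; first exact: fil1_ideal.
  by move=> J cJ _ g /(ideal_sub_fil1 cJ) h; apply/asboolP.
have [c1 c2] : maximal_ideal (maxideal A).
  by rewrite /maxideal; case: xgetP => [I _ //|/(_ _ mm)].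
split; first exact: ideal_sub_fil1.
move=> h; apply: (c2 _ fil1_ideal); last by apply/asboolP.
by move=> g /(ideal_sub_fil1 c1) ?; apply/asboolP.
Qed.

(** Each nonconstant monomial is filed under the first variable occurring in
    it; this splits a series as f 0 plus multiples of the variables. *)
Lemma series_split f : exists2 g : 'I_n -> A,
  f = psC (f 0%MM) + \sum_i psmono U_(i)%MM * g i &
  forall k, fil k.+1 f -> forall i, fil k (g i).
Proof.
pose g (i : 'I_n) : A := fun a =>
  if [forall j : 'I_n, (j < i)%N ==> (a j == 0%N)] then f (a + U_(i))%MM else 0.
exists g; last first.
  move=> k hf i a; rewrite /g; case: ifP => _; last exact: tdvdn0.
  by have := hf (a + U_(i))%MM; rewrite mdegD mdeg1 addn1 subSS.
apply: funext => k; rewrite psDE pssumE.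
have [->|k0] := eqVneq k 0%MM.
  rewrite {1}/psC eqxx big1 ?addr0 // => i _; rewrite psmonoE.
  case: ifP => // /mnm_lepP/(_ i); by rewrite mnm1E eqxx mnm0E.
have [i0 ki0] : exists i, k i != 0%N.
  apply/existsP; apply: contraNT k0 => /existsPn h; apply/eqP/mnmP => i.
  by rewrite mnm0E; apply/eqP; have := h i; rewrite negbK.
pose i1 := [arg min_(i < i0 | k i != 0%N) (i : nat)].
have [k1 kmin] : k i1 != 0%N /\ forall j, k j != 0%N -> (i1 <= j)%N.
  by rewrite /i1; case: arg_minnP.
rewrite {1}/psC (negPf k0) add0r (bigD1 i1) //= psmonoE.
have U1 i : (U_(i) <= k)%MM = (k i != 0%N).
  apply/mnm_lepP/idP => [/(_ i)|ki j]; first by rewrite mnm1E eqxx lt0n.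
  by rewrite mnm1E; case: eqP => //= <-; rewrite lt0n.
rewrite U1 k1 /g.
have -> : [forall j : 'I_n, (j < i1)%N ==> ((k - U_(i1))%MM j == 0%N)].
  apply/forallP => j; apply/implyP => ji; rewrite mnmBE mnm1E.
  case: (i1 =P j) => [e|_]; first by rewrite -e ltnn in ji.
  by rewrite subn0; apply: contraTT ji => /kmin; rewrite -leqNgt.
rewrite submK ?U1 // big1 ?addr0 // => i ii1; rewrite psmonoE U1.
case: ifPn => // ki; case: ifPn => // /forallP/(_ i1).
have -> : (i1 < i)%N by have := kmin _ ki; rewrite leq_eqVlt eq_sym val_eqE (negPf ii1).
by rewrite /= mnmBE mnm1E (negPf ii1) subn0 (negPf k1).
Qed.

Lemma ideal_expP k f : f \in ideal_exp (maxideal A) k <-> fil k f.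
Proof.
elim: k f => [|k IH] f; first by split=> // _; apply: fil0.
split=> /=.
  pose P : {pred A^o} := fun f => `[< fil k.+1 f >].
  move=> hf; apply/asboolP; move: f hf.
  apply: (@span_min A A^o _ P).
    split; first by apply/asboolP/filn0.
    by move=> a u v /asboolP hu /asboolP hv; apply/asboolP/filD => //; apply: filMl.
  move=> _ [x [y [/maxidealP hx /IH hy ->]]]; apply/asboolP.
  by rewrite -add1n; apply: filM.
move=> hf; have [g fE hg] := series_split f.
set S := (X in Defs.span X); have sS := span_submod (V := A^o) S.
have [S0 SD] := sS.
have SA x y : x \in Defs.span (V := A^o) S -> y \in Defs.span (V := A^o) S -> x + y \in Defs.span (V := A^o) S.
  by move=> hx hy; rewrite -[x]scale1r; apply: SD.
rewrite fE; apply: (SA).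
  have [y fy] := hf 0%MM; rewrite mdeg0 subn0 in fy.
  apply: span_sub; exists (psC t), (psC (y * t ^+ k)); split.
  - by apply/maxidealP/fil_psC; exists 1; rewrite mul1r.
  - by apply/IH/fil_psC; exists y.
  - by rewrite fy -rmorphM exprS mulrCA.
elim/big_ind: _ => [||i _]; [exact: S0|exact: SA|apply: span_sub].
exists (psmono U_(i)%MM), (g i).
split=> //; last by apply/IH/hg.
by apply/maxidealP; have := fil_mono U_(i)%MM; rewrite mdeg1.
Qed.

End Series.

Arguments psmono {R n} b.

(** * Standard monomials *)

Section Enumeration.

Fixpoint nseqs (N D : nat) : seq (seq nat) :=
  if N is N'.+1 then
    flatten [seq [seq i :: v | v <- nseqs N' (D - i)] | i <- iota 0 D]
  else if (0 < D)%N then [:: [::]] else [::].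

Lemma mem_nseqs N D v : (v \in nseqs N D) = (size v == N) && (sumn v < D)%N.
Proof.
elim: N D v => [|N IH] D v /=.
  by case: ifP => D0; rewrite !inE; case: v => [|a v] //=; rewrite ?D0.
apply/flatten_mapP/idP => [[i]|].
  rewrite mem_iota add0n => /andP[_ iD] /mapP[w]; rewrite IH => /andP[/eqP <- wD] ->.
  by rewrite /= eqxx /=; lia.
case: v => [//|i v] /= /andP[sv vD]; exists i; first by rewrite mem_iota; lia.
by apply/mapP; exists v => //; rewrite IH -eqSS sv /=; lia.
Qed.

Lemma uniq_nseqs N D : uniq (nseqs N D).
Proof.
elim: N D => [|N IH] D /=; first by case: ifP.
have consI i : injective (cons i : seq nat -> seq nat) by move=> u v [].
elim: (iota 0 D) (iota_uniq 0 D) => //= i s IHs /andP[si /IHs us].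
rewrite cat_uniq map_inj_uniq // IH us andbT /=.
apply/hasPn => v /flatten_mapP[k ks /mapP[w _ ->]].
by apply/mapP => -[w' _ [ki _]]; rewrite -ki ks in si.
Qed.

End Enumeration.

Arguments nseqs : simpl never.

Section StandardMonomials.
Variables (R : idomainType) (t : R) (n : nat) (J : finType).
Local Notation A := (pseries R n).
Local Notation F := {ffun J -> A^o}.

(** (s, a, j) stands for t ^ s X ^ a e_j in the free module on J: the
    uniformizer is treated as one more variable. *)
Definition mon : Type := nat * 'X_{1..n} * J.
HB.instance Definition _ := Choice.on mon.

Definition mondeg (u : mon) : nat := (u.1.1 + mdeg u.1.2)%N.

Definition mlt (u v : mon) : bool :=
  (mondeg u < mondeg v)%N || (mondeg u == mondeg v) &&
  ((u.1.2 < v.1.2)%O || (u.1.2 == v.1.2) && (enum_rank u.2 < enum_rank v.2)%N).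

Definition monmul (s : nat) (b : 'X_{1..n}) (u : mon) : mon :=
  ((s + u.1.1)%N, (b + u.1.2)%MM, u.2).

Lemma mondegM s b u : mondeg (monmul s b u) = (s + mdeg b + mondeg u)%N.
Proof. by rewrite /mondeg /= mdegD addnACA. Qed.

Lemma mlt_irr u : mlt u u = false.
Proof. by rewrite /mlt !ltnn ltxx !eqxx. Qed.

Lemma mlt_trans u v w : mlt u v -> mlt v w -> mlt u w.
Proof.
rewrite /mlt => /orP[uv|/andP[/eqP -> uv]] /orP[vw|/andP[/eqP <- vw]].
- by rewrite (ltn_trans uv vw).
- by rewrite uv.
- by rewrite vw.
rewrite ltnn eqxx /=.
case/orP: uv => [uv|/andP[/eqP -> uv]]; case/orP: vw => [vw|/andP[/eqP <- vw]].
- by rewrite (lt_trans uv vw).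
- by rewrite uv.
- by rewrite vw.
- by rewrite ltxx eqxx (ltn_trans uv vw).
Qed.

Lemma mlt_total u v : [\/ mlt u v, u = v | mlt v u].
Proof.
rewrite /mlt; case: (ltngtP (mondeg u) (mondeg v)) => duv; rewrite ?orbT /=;
  [exact: Or31|exact: Or33|].
case: (ltgtP u.1.2 v.1.2) => [auv|auv|auv] /=; [exact: Or31|exact: Or33|].
case: (ltngtP (enum_rank u.2) (enum_rank v.2)) => juv; [exact: Or31|exact: Or33|].
apply: Or32; move: u v duv auv juv => [[s a] j] [[s' a'] j'] /= + aa' /val_inj/enum_rank_inj jj'.
by rewrite /mondeg /= aa' jj' => /addIn ->.
Qed.

Lemma mltM s b u v : mlt u v -> mlt (monmul s b u) (monmul s b v).
Proof.
rewrite /mlt !mondegM /= ltn_add2l eqn_add2l ltmc_add2r.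
by rewrite (inj_eq (@addmI _ b)).
Qed.

Lemma mlt_deg u v : (mondeg u < mondeg v)%N -> mlt u v.
Proof. by rewrite /mlt => ->. Qed.

Lemma mlt_le_deg u v : mlt u v -> (mondeg u <= mondeg v)%N.
Proof. by rewrite /mlt => /orP[/ltnW|/andP[/eqP ->]]. Qed.

(* Initial segments grow by one greatest monomial at a time, so that lengths
   can be computed by induction on them. *)
Inductive initial : seq mon -> Prop :=
| initial_nil : initial [::]
| initial_rcons l u : initial l -> (forall v, (v \in l) = mlt v u) ->
    initial (rcons l u).

Lemma sorted_initial l : sorted mlt l ->
  (forall u v, u \in l -> mlt v u -> v \in l) -> initial l.
Proof.
have tr : transitive mlt by move=> v u w; apply: mlt_trans.
elim/last_ind: l => [|l u IH] sl dl; first exact: initial_nil.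
have lu v : v \in l -> mlt v u.
  move=> vl; move: sl; rewrite (sorted_pairwise tr) pairwise_rcons => /andP[/allP h _].
  exact: h.
have ul v : mlt v u -> v \in l.
  move=> vu; have := dl u v; rewrite !mem_rcons !inE eqxx => /(_ isT vu).
  by case/orP => // /eqP vE; rewrite vE mlt_irr in vu.
apply: initial_rcons; last by move=> v; apply/idP/idP => [/lu|/ul].
apply: IH; first by move: sl; rewrite !(sorted_pairwise tr) pairwise_rcons => /andP[].
by move=> v w vl wv; apply/ul/(mlt_trans wv)/lu.
Qed.

Definition mon_of (v : seq nat) (j : J) : mon :=
  (head 0%N v, [multinom nth 0%N (behead v) i | i < n], j).

Definition mons (D : nat) : seq mon := [seq mon_of v j | v <- nseqs n.+1 D, j <- enum J].

Lemma mem_mons D u : (u \in mons D) = (mondeg u < D)%N.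
Proof.
have sumE (a : 'X_{1..n}) : sumn a = mdeg a by rewrite /mdeg sumnE.
apply/allpairsP/idP => [[[v j] /= [vD _ ->]]|uD].
  move: vD; rewrite mem_nseqs; case: v => [//|s v] /= /andP[/eqP[sv] vD].
  rewrite /mondeg /=; move: vD; suff -> : mdeg [multinom nth 0%N v i | i < n] = sumn v by [].
  rewrite mdegE sumnE (big_nth 0%N) sv big_mkord.
  by apply: eq_bigr => i _; rewrite mnmE.
case: u uD => [[s a] j] uD; exists (s :: (a : seq nat), j); split.
- by rewrite mem_nseqs /= size_tuple eqxx sumE.
- by rewrite mem_enum.
- congr (_, _, _); apply/mnmP => i; by rewrite mnmE (mnm_nth 0%N).
Qed.

Lemma uniq_mons D : uniq (mons D).
Proof.
apply: allpairs_uniq; [exact: uniq_nseqs|exact: enum_uniq|].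
move=> [v j] [v' j'] /allpairsP[[w k] /= [wD _ [-> ->]]] /allpairsP[[w' k'] /= [wD' _ [-> ->]]].
move: wD wD'; rewrite !mem_nseqs.
case: w => [//|s w] /andP[/eqP[sw] _]; case: w' => [//|s' w'] /andP[/eqP[sw'] _].
move=> e; have /= -> := congr1 (fun u : mon => u.1.1) e.
have /= -> := congr1 (fun u : mon => u.2) e; congr (_ :: _, _).
apply: (@eq_from_nth _ 0%N); first by rewrite sw sw'.
move=> i; rewrite sw => iN; have := congr1 (fun u : mon => u.1.2 (Ordinal iN)) e.
by rewrite !mnmE.
Qed.

(** The coefficient of x at (a, j) involves neither t ^ s X ^ a e_j nor the
    lower powers of t on the same strand. *)
Definition small (x : F) (u : mon) : Prop := tdvd t u.1.1.+1 ((x u.2 : A) u.1.2).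

Definition mge (u : mon) : set F := [set x | forall v, mlt v u -> small x v].
Definition mgt (u : mon) : set F := [set x | mge u x /\ small x u].
Definition smallon (l : seq mon) : set F := [set x | forall v, v \in l -> small x v].
Definition filF (k : nat) : set F := [set x | forall j, fil t k (x j : A)].

(** The leading monomials of K. *)
Definition inmon (K : set F) (u : mon) : Prop := exists x, [/\ K x, mge u x & ~ small x u].

Definition stdmon (K : set F) (u : mon) : bool := ~~ `[< inmon K u >].

(** By clen_hs this is the Hilbert-Samuel function of the quotient by K. *)
Definition hs (K : set F) (D : nat) : nat := count (stdmon K) (mons D).

Lemma small0 u : small 0 u.
Proof. by rewrite /small ffunE; apply: tdvdn0. Qed.

Lemma smallB x y u : small x u -> small y u -> small (x - y) u.
Proof. by move=> hx hy; rewrite /small !ffunE; apply: tdvdB. Qed.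

Lemma smallZ (c : A) x u : (forall b, small x (u.1.1, (u.1.2 - b)%MM, u.2)) -> small (c *: x) u.
Proof.
move=> h; rewrite /small ffunE [_ *: _](_ : _ = c * (x u.2 : A)) //.
rewrite (psME _ _ (ltnSn (mdeg u.1.2))); apply: tdvd_sum => b _.
exact/tdvdMl/h.
Qed.

Lemma mon_subP u b :
  (u.1.1, (u.1.2 - b)%MM, u.2) = u \/ mlt (u.1.1, (u.1.2 - b)%MM, u.2) u.
Proof.
case: u => [[s a] j] /=.
have [ab|ab] := leqP (mdeg a) (mdeg (a - b)%MM); last first.
  by right; apply: mlt_deg; rewrite /mondeg /= ltn_add2l.
left; have e := submK (lem_subr a b).
have /eqP : mdeg (a - (a - b))%MM = 0%N.
  by have := congr1 (@mdeg n) e; rewrite mdegD; lia.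
by rewrite mdeg_eq0 => /eqP a0; rewrite a0 add0m in e; rewrite -{2}e.
Qed.

Lemma mlt_sub u v b : mlt u v -> mlt (u.1.1, (u.1.2 - b)%MM, u.2) v.
Proof. by case: (mon_subP u b) => [->//|]; apply: mlt_trans. Qed.

Lemma mge_opsub u : opsub (fun (c : A) (x : F) => c *: x) (mge u).
Proof.
split.
- by move=> v _; apply: small0.
- by move=> x y hx hy v vu; apply: smallB; [apply: hx|apply: hy].
- by move=> c x hx v vu; apply: smallZ => b; apply/hx/mlt_sub.
Qed.

Lemma filF_opsub k : opsub (fun (c : A) (x : F) => c *: x) (filF k).
Proof.
split.
- by move=> j; rewrite ffunE; apply: filn0.
- by move=> x y hx hy j; rewrite !ffunE; apply: filB.
- by move=> c x hx j; rewrite ffunE; apply: filMl.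
Qed.

Lemma smallon_mons D l : (forall v, (v \in l) = (v \in mons D)) -> smallon l = filF D.
Proof.
move=> lD; apply/seteqP; split=> x hx.
  move=> j a; have [Da|aD] := leqP D (mdeg a).
    by have -> : (D - mdeg a = 0)%N; [lia|apply: tdvd_0n].
  have := hx ((D - mdeg a).-1, a, j); rewrite lD mem_mons /small /mondeg /=.
  have -> : (D - mdeg a).-1.+1 = (D - mdeg a)%N by lia.
  by apply; lia.
case=> [[s a] j]; rewrite lD mem_mons /mondeg /= => sD.
by apply: tdvd_le (hx j a); rewrite /=; lia.
Qed.

Lemma mge_tdvd u x : mge u x -> tdvd t u.1.1 ((x u.2 : A) u.1.2).
Proof.
case: u => [[[|s] a] j] hx /=; first exact: tdvd_0n.
by apply: (hx (s, a, j)); apply: mlt_deg; rewrite /mondeg /=; lia.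
Qed.

Lemma mge_filF u x : mge u x -> filF (mondeg u) x.
Proof.
move=> hx j a; have [Da|aD] := leqP (mondeg u) (mdeg a).
  by have -> : (mondeg u - mdeg a = 0)%N; [lia|apply: tdvd_0n].
have := hx ((mondeg u - mdeg a).-1, a, j); rewrite /small /=.
have -> : (mondeg u - mdeg a).-1.+1 = (mondeg u - mdeg a)%N by lia.
by apply; apply: mlt_deg; rewrite [X in (X < _)%N]/mondeg /=; lia.
Qed.

Lemma mgt_opsubR u : opsub (fun (r : R) (x : F) => psC r *: x) (mgt u).
Proof.
have [h0 hB hZ] := mge_opsub u; split.
- by split=> //; apply: small0.
- by move=> x y [? ?] [? ?]; split; [apply: hB|apply: smallB].
- move=> r x [hx sx]; split; first exact: hZ.
  rewrite /small ffunE [_ *: _](_ : _ = psC r * (x u.2 : A)) // psCmul; exact: tdvdMl.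
Qed.

Hypothesis hR : complete_dvr t.

Lemma mge_reduce u x y : mge u x -> mge u y -> ~ small x u ->
  exists r : R, mgt u (y - psC r *: x).
Proof.
move=> hx hy nx.
have [a [b [xE ab]]] := tdvd_exact hR (mge_tdvd hx) nx.
have [c yE] := mge_tdvd hy; exists (c * b).
have [_ hB hZ] := mge_opsub u; split; first by apply: hB => //; apply: hZ.
rewrite /small !ffunE psBE [_ *: _](_ : _ = psC (c * b) * (x u.2 : A)) // psCmul.
rewrite xE yE mulrA -(mulrA c) [b * a]mulrC ab mulr1 subrr; exact: tdvdn0.
Qed.

Definition monelt (u : mon) : F :=
  [ffun j => if j == u.2 then psC (t ^+ u.1.1) * psmono u.1.2 else 0 : A].

Lemma moneltE u j a :
  (monelt u j : A) a = if (j == u.2) && (a == u.1.2) then t ^+ u.1.1 else 0.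
Proof.
rewrite ffunE; case: eqP => //= _; rewrite psCmul /psmono.
by case: eqP; rewrite ?mulr1 ?mulr0.
Qed.

Lemma monelt_mge u : mge u (monelt u).
Proof.
case: u => [[s a] j] [[s' a'] j'] /= vu; rewrite /small moneltE /=.
case: (j' =P j) => [jj|_] /=; last exact: tdvdn0.
case: (a' =P a) => [aa|_] /=; last exact: tdvdn0.
move: vu; rewrite jj aa /mlt /mondeg /= ltxx eqxx ltnn /= andbF orbF ltn_add2r => ss.
exact: tdvd_le ss (tdvdX t s).
Qed.

Lemma monelt_small u : ~ small (monelt u) u.
Proof.
rewrite /small moneltE !eqxx /= -[u.1.1.+1]addn1 -[t ^+ _]mulr1 => /(tdvd_cancel hR).
exact: tdvd1_1.
Qed.

Local Notation actA := (fun (c : A) (x : F) => c *: x).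
Local Notation actR := (fun (r : R) (x : F) => psC r *: x).

Lemma opsub_restrict U : opsub actA U -> opsub actR U.
Proof. by move=> [? ? hZ]; split=> // r x; apply: hZ. Qed.

(** Modulo mgt u, an element of mge u is determined by one coefficient modulo
    t. So the two sums with K differ by at most one copy of R / t, and they
    coincide when K has an element with leading monomial u. *)
Lemma std_step K u : opsub actA K ->
  if stdmon K u then covers actR (addset K (mgt u)) (addset K (mge u))
  else addset K (mge u) = addset K (mgt u).
Proof.
move=> sK; have sKR := opsub_restrict sK.
have sU := opsub_add (fun r x y => scalerDr (psC r) x y) sKR (mgt_opsubR u).
have KU : K `<=` addset K (mgt u) by apply: (addset_subl (mgt_opsubR u)).
have UW : addset K (mgt u) `<=` addset K (mge u).
  by move=> _ [k [x [Kk [gx _] ->]]]; exists k, x.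
rewrite /stdmon; case: asboolP => /= hin.
  apply/seteqP; split=> // _ [k [y [Kk gy ->]]].
  have [x [Kx gx nx]] := hin; have [r gr] := mge_reduce gx gy nx.
  exists (k + psC r *: x), (y - psC r *: x); split=> //; last by rewrite addrACA subrr addr0.
  by apply: (opsubD sK) => //; case: sK => _ _; apply.
split=> //.
  move=> h; have : addset K (mgt u) (monelt u).
    by apply/h/(addset_subr sKR)/monelt_mge.
  move=> [k [x [Kk [gx sx] e]]]; apply: hin; exists k; split=> //.
    have -> : k = monelt u - x by rewrite e addrK.
    by apply: (opsubB (mge_opsub u)) => //; apply: monelt_mge.
  move=> sk; apply: (@monelt_small u); rewrite e.
  by rewrite -(opprK x); apply: smallB => //; rewrite -sub0r; apply: smallB => //; apply: small0.
move=> D sD UD DW; case: (EM (D `<=` addset K (mgt u))); first by left.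
move=> /existsNP[d /not_implyP[Dd nUd]]; right=> _ [k' [y [Kk' gy ->]]].
have [k [x [Kk gx dE]]] := DW _ Dd.
have Dx : D x.
  have -> : x = d - k by rewrite dE addrC addKr.
  by apply: (opsubB sD) => //; apply/UD/KU.
have nx : ~ small x u by move=> sx; apply: nUd; exists k, x.
have [r gr] := mge_reduce gx gy nx.
apply: (opsubD sD); first exact/UD/KU.
rewrite -(subrK (psC r *: x) y); apply: (opsubD sD); last by case: sD => _ _; apply.
exact/UD/(addset_subr sKR).
Qed.

Lemma initial_closed l u v : initial l -> u \in l -> mlt v u -> v \in l.
Proof.
move=> il; elim: il u => // {}l w _ IH lw u; rewrite !mem_rcons !inE.
move=> /orP[/eqP ->|ul] vu; first by rewrite lw vu orbT.
by rewrite (IH _ ul vu) orbT.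
Qed.

Lemma smallon_opsub l : initial l -> opsub actA (smallon l).
Proof.
move=> il; split.
- by move=> v _; apply: small0.
- by move=> x y hx hy v vl; apply: smallB; [apply: hx|apply: hy].
- move=> c x hx v vl; apply: smallZ => b; apply: hx.
  by case: (mon_subP v b) => [->//|]; apply: initial_closed vl.
Qed.

Lemma clen_initial K l : opsub actA K -> initial l ->
  clen actA (addset K (smallon l)) setT (count (stdmon K) l) /\
  clen actR (addset K (smallon l)) setT (count (stdmon K) l).
Proof.
move=> sK; elim=> [|{}l u il [IHA IHR] lu].
  have -> : addset K (smallon [::]) = setT; last by split; apply: clen0.
  apply/seteqP; split=> // x _; exists 0, x; rewrite add0r.
  by split=> //; case: sK.
have El : smallon l = mge u.
  by apply/seteqP; split=> x hx v; have := hx v; rewrite lu.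
have Eu : smallon (rcons l u) = mgt u.
  apply/seteqP; split=> x hx.
    split; last by apply: hx; rewrite mem_rcons inE eqxx.
    by move=> v vu; apply: hx; rewrite mem_rcons inE lu vu orbT.
  move=> v; rewrite mem_rcons inE lu => /orP[/eqP ->|]; first by case: hx.
  by case: hx => h _; apply: h.
have sW : opsub actA (addset K (smallon l)).
  by apply: opsub_add => //; [move=> c x y; apply: scalerDr|apply: smallon_opsub].
have sU : opsub actA (addset K (smallon (rcons l u))).
  apply: opsub_add => //; first by move=> c x y; apply: scalerDr.
  exact/smallon_opsub/initial_rcons.
rewrite -cats1 count_cat /= addn0 addnC cats1.
have := std_step u sK; rewrite -El -Eu; case: (stdmon K u) => [cR|<-] //.
split; last exact: (clenS (opsub_restrict sW) cR).
apply: (clenS sW _ IHA); case: cR => h1 h2 h3; split=> // D sD.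
by apply: h3; apply: opsub_restrict.
Qed.

Lemma initial_mons D : exists2 l, initial l & perm_eq l (mons D).
Proof.
pose mle u v := (u == v) || mlt u v.
have tot : total mle.
  by move=> u v; rewrite /mle; case: (mlt_total u v) => [->|->|->]; rewrite ?eqxx ?orbT.
have ul : uniq (sort mle (mons D)) by rewrite sort_uniq uniq_mons.
have tr : transitive mle.
  move=> v u w; rewrite /mle => /orP[/eqP ->//|uv] /orP[/eqP <-|vw].
    by rewrite uv orbT.
  by rewrite (mlt_trans uv vw) orbT.
exists (sort mle (mons D)); last by rewrite perm_sort.
apply: sorted_initial; last first.
  by move=> u v; rewrite !mem_sort !mem_mons => uD /mlt_le_deg; lia.
have trl : transitive mlt by move=> v u w; apply: mlt_trans.
have := sort_sorted tot (mons D); move: ul; rewrite !sorted_pairwise // uniq_pairwise.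
move=> p1 p2; have := pairwise_relI (fun u v => u != v) mle (sort mle (mons D)).
rewrite p1 p2 /= => h; apply: sub_pairwise h => u v /= /andP[/negPf uv].
by rewrite /mle uv.
Qed.

Lemma clen_hs K D : opsub actA K ->
  clen actA (addset K (filF D)) setT (hs K D) /\
  clen actR (addset K (filF D)) setT (hs K D).
Proof.
move=> sK; have [l il pl] := initial_mons D.
have := clen_initial sK il; rewrite (@smallon_mons D); last exact: perm_mem.
by have /permP -> := pl.
Qed.

End StandardMonomials.

(** * Hilbert-Samuel functions are eventually polynomial *)

Section Dickson.

Lemma nondecreasing_subseq (g : nat -> nat) :
  exists phi : nat -> nat, (forall i j, (i < j)%N -> (phi i < phi j)%N) /\
    forall i j, (i <= j)%N -> (g (phi i) <= g (phi j))%N.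
Proof.
have /choice[m hm] : forall k, exists m, (k <= m)%N /\ forall i, (k <= i)%N -> (g m <= g i)%N.
  move=> k; suff : forall v i, (k <= i)%N -> (g i <= v)%N ->
      exists m, (k <= m)%N /\ forall i, (k <= i)%N -> (g m <= g i)%N.
    by move=> /(_ (g k) k (leqnn k) (leqnn _)).
  elim=> [|v IH] i ki iv; first by exists i; split=> // j _; lia.
  case: (EM (exists2 j, (k <= j)%N & (g j <= v)%N)) => [[j kj jv]|h].
    exact: (IH j).
  exists i; split=> // j kj; have [ij|ji] := leqP (g i) (g j) => //.
  by case: h; exists j => //; lia.
pose phi := fix phi k := if k is k'.+1 then m (phi k').+1 else m 0%N.
have phiS k : (phi k < phi k.+1)%N by have [] := hm (phi k).+1.
have phi_lt i j : (i < j)%N -> (phi i < phi j)%N.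
  elim: j => // j IH; rewrite ltnS leq_eqVlt => /orP[/eqP -> //|/IH].
  by move/ltn_trans; apply.
exists phi; split=> // i j; rewrite leq_eqVlt => /orP[/eqP -> //|/phi_lt ij].
by case: i ij => [|i] ij; [have [_] := hm 0%N|have [_] := hm (phi i).+1]; apply;
  rewrite ?(leq_trans _ ij) //; have := phiS i; lia.
Qed.

(** Dickson's lemma: extract a subsequence with increasing tails, by induction,
    and from it one with increasing heads. *)
Lemma dickson N (f : nat -> seq nat) : (forall i, size (f i) = N) ->
  exists phi : nat -> nat, (forall i j, (i < j)%N -> (phi i < phi j)%N) /\
    forall i j, (i <= j)%N -> all2 leq (f (phi i)) (f (phi j)).
Proof.
elim: N f => [|N IH] f sf.
  exists id; split=> // i j _; have := sf i; have := sf j.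
  by move=> /size0nil -> /size0nil ->.
have [|p1 [p1lt p1le]] := IH (fun i => behead (f i)).
  by move=> i; rewrite size_behead sf.
have [p2 [p2lt p2le]] := nondecreasing_subseq (fun i => head 0%N (f (p1 i))).
exists (p1 \o p2); split=> [i j ij|i j ij] /=; first exact/p1lt/p2lt.
have := p2le _ _ ij; have : (p2 i <= p2 j)%N.
  by move: ij; rewrite leq_eqVlt => /orP[/eqP -> //|/p2lt/ltnW].
move=> /p1le; have := sf (p1 (p2 i)); have := sf (p1 (p2 j)).
by case: (f (p1 (p2 i))) => // a u; case: (f (p1 (p2 j))) => // b v /= _ _ -> ->.
Qed.

Definition downset N (S : pred (seq nat)) : Prop :=
  forall u v, size u = N -> size v = N -> all2 leq u v -> S v -> S u.

Lemma all2_leq_refl (v : seq nat) : all2 leq v v.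
Proof. by elim: v => //= i v ->; rewrite leqnn. Qed.

(** If the decreasing sequence of slices were never constant, the points
    witnessing infinitely many drops would contradict Dickson's lemma. *)
Lemma slices_stable N (S : pred (seq nat)) : downset N.+1 S ->
  exists i0, forall i v, (i0 <= i)%N -> size v = N -> S (i :: v) = S (i0 :: v).
Proof.
move=> dS; apply: contrapT => /forallNP h.
have dec i i' v : (i <= i')%N -> size v = N -> S (i' :: v) -> S (i :: v).
  by move=> ii sv; apply: dS; rewrite /= ?sv ?ii ?all2_leq_refl.
have /choice[w hw] : forall i0, exists w : nat * seq nat,
    [/\ (i0 < w.1)%N, size w.2 = N, S (i0 :: w.2) & ~~ S (w.1 :: w.2)].
  move=> i0; have /existsNP[i /existsNP[v /not_implyP[i0i /not_implyP[sv nS]]]] := h i0.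
  have S0 : S (i0 :: v).
    by apply/negPn/negP => nS0; apply: nS; rewrite (negPf nS0); apply/negbTE; apply: contra nS0; apply: dec.
  have nSi : ~~ S (i :: v) by apply/negP => Si; apply: nS; rewrite Si S0.
  exists (i, v); split=> //=; rewrite ltn_neqAle i0i andbT.
  by apply: contra nSi => /eqP <-.
pose I := fix I k := if k is k'.+1 then (w (I k')).1 else 0%N.
have IS k : (I k < I k.+1)%N by have [] := hw (I k).
have Ilt a b : (a < b)%N -> (I a.+1 <= I b)%N.
  elim: b => // b IH; rewrite ltnS leq_eqVlt => /orP[/eqP -> //|/IH ab].
  exact: leq_trans ab (ltnW (IS b)).
have [|phi [plt ple]] := @dickson N (fun k => (w (I k)).2).
  by move=> k; have [] := hw (I k).
have p01 := plt 0%N 1%N isT; have := ple 0%N 1%N isT; set a := phi 0%N in p01 *; set b := phi 1%N in p01 *.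
have [_ sa _ /negP na] := hw (I a); have [_ sb Sb _] := hw (I b) => ab.
apply: na; apply: (@dec _ (I b)) => //; first exact: Ilt.
by apply: dS Sb; rewrite /= ?sa ?sb ?leqnn.
Qed.

End Dickson.

Section Differences.
Implicit Types f g : nat -> int.

Definition delta f : nat -> int := fun k => f k.+1 - f k.

(** Eventually polynomial functions, as those killed eventually by some
    iterated difference: closure under sums and summation is then immediate. *)
Definition evpoly f : Prop :=
  exists e k0, forall k, (k0 <= k)%N -> iter e delta f k = 0.

Lemma delta_ext f g k0 : (forall k, (k0 <= k)%N -> f k = g k) ->
  forall k, (k0 <= k)%N -> delta f k = delta g k.
Proof. by move=> fg k kk; rewrite /delta !fg // leqW. Qed.

Lemma iter_delta_ext e f g k0 : (forall k, (k0 <= k)%N -> f k = g k) ->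
  forall k, (k0 <= k)%N -> iter e delta f k = iter e delta g k.
Proof. by move=> fg; elim: e => //= e; apply: delta_ext. Qed.

Lemma iter_delta_le e e' f k0 : (e <= e')%N ->
  (forall k, (k0 <= k)%N -> iter e delta f k = 0) ->
  forall k, (k0 <= k)%N -> iter e' delta f k = 0.
Proof.
move=> ee h; rewrite -(subnK ee); elim: (e' - e)%N => [//|d IH] k kk /=.
by rewrite /delta !IH ?subrr // leqW.
Qed.

Lemma evpoly_ext f g k0 : (forall k, (k0 <= k)%N -> f k = g k) -> evpoly f -> evpoly g.
Proof.
move=> fg [e [k1 h]]; exists e, (maxn k0 k1) => k kk.
by rewrite -(iter_delta_ext _ fg) ?h //; lia.
Qed.

Lemma evpoly0 : evpoly (fun=> 0).
Proof. by exists 0%N, 0%N. Qed.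

Lemma iter_deltaD e f g k :
  iter e delta (fun k => f k + g k) k = iter e delta f k + iter e delta g k.
Proof.
elim: e f g k => [//|e IH] f g k; rewrite !iterSr -IH; congr (iter e delta _ k).
by apply: funext => i; rewrite /delta opprD addrACA.
Qed.

Lemma evpolyD f g : evpoly f -> evpoly g -> evpoly (fun k => f k + g k).
Proof.
move=> [e [k0 he]] [e' [k1 he']]; exists (maxn e e'), (maxn k0 k1) => k kk.
rewrite iter_deltaD (@iter_delta_le e _ f k0) ?(@iter_delta_le e' _ g k1) ?addr0 //; lia.
Qed.

Lemma evpoly_sum (I : Type) (r : seq I) (F : I -> nat -> int) :
  (forall i, evpoly (F i)) -> evpoly (fun k => \sum_(i <- r) F i k).
Proof.
move=> h; elim: r => [|i r IH].
  by apply: (@evpoly_ext (fun=> 0) _ 0%N) evpoly0 => k _; rewrite big_nil.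
apply: (@evpoly_ext (fun k => F i k + \sum_(i <- r) F i k) _ 0%N); last exact: evpolyD.
by move=> k _; rewrite big_cons.
Qed.

Lemma iter_delta_shift e f i k :
  iter e delta (fun k => f (k + i)%N) k = iter e delta f (k + i)%N.
Proof. by elim: e k => //= e IH k; rewrite /delta !IH addSn. Qed.

Lemma evpoly_shiftD f i : evpoly f -> evpoly (fun k => f (k + i)%N).
Proof.
move=> [e [k0 h]]; exists e, k0 => k kk; rewrite iter_delta_shift h //; lia.
Qed.

Lemma evpoly_shift f i : evpoly f -> evpoly (fun k => f (k - i)%N).
Proof.
move=> [e [k0 h]]; exists e, (k0 + i)%N => k kk.
have := iter_delta_shift e (fun k => f (k - i)%N) i (k - i)%N.
rewrite subnK; last lia.
move=> <-; rewrite (@iter_delta_ext _ _ f 0%N) ?h //; first lia.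
by move=> j _; rewrite addnK.
Qed.

Lemma evpoly_delta f : evpoly (delta f) -> evpoly f.
Proof. by move=> [e [k0 h]]; exists e.+1, k0 => k kk; rewrite iterSr h. Qed.

(** Counting by the first coordinate gives finitely many shifted functions of
    lower arity, and the sum of the stable slice. *)
Lemma evpoly_cnt N (S : pred (seq nat)) : downset N S ->
  evpoly (fun D => (count S (nseqs N D))%:Z).
Proof.
elim: N S => [|N IH] S dS.
  apply: (evpoly_delta (f := fun D => _)); exists 0%N, 1%N => -[//|k] _ /=.
  by rewrite /delta /nseqs subrr.
have dSi i : downset N (S \o cons i).
  by move=> u v su sv uv; apply: dS; rewrite /= ?su ?sv // leqnn.
pose c i D := (count (S \o cons i) (nseqs N D))%:Z.
have hc i : evpoly (c i) by apply: IH.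
have cntE D : (count S (nseqs N.+1 D))%:Z = \sum_(0 <= i < D) c i (D - i)%N.
  rewrite /nseqs -/nseqs count_flatten -map_comp sumnE big_map -natz natr_sum.
  rewrite /index_iota subn0; apply: eq_bigr => i _.
  by rewrite natz /c -count_map.
have [i0 hi0] := slices_stable dS.
have c0 i D : (i0 <= i)%N -> c i D = c i0 D.
  move=> ii; rewrite /c; congr Posz; apply: eq_in_count => v.
  by rewrite mem_nseqs => /andP[/eqP sv _] /=; apply: hi0.
pose G k := \sum_(0 <= j < k) c i0 j.+1.
have hG : evpoly G.
  apply: evpoly_delta; apply: (@evpoly_ext (fun k => c i0 (k + 1)%N) _ 0%N).
    by move=> k _; rewrite /delta /G big_nat_recr //= addrAC subrr add0r addn1.
  exact: evpoly_shiftD.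
apply: (@evpoly_ext (fun D => \sum_(0 <= i < i0) c i (D - i)%N + G (D - i0)%N) _ i0).
  move=> D iD; have -> : G (D - i0)%N = \sum_(i0 <= i < D) c i (D - i)%N.
    rewrite -{2}[i0]add0n big_addn big_nat_rev /=; apply: eq_big_nat => j jD.
    by rewrite c0; [congr (c i0 _)|]; lia.
  by rewrite cntE [RHS](big_cat_nat (n := i0)).
apply: evpolyD; last exact: evpoly_shift.
by apply: evpoly_sum => i; apply: evpoly_shift.
Qed.

End Differences.

Section HilbertPolynomial.
Variables (R : idomainType) (t : R) (n : nat) (J : finType).
Hypothesis hR : complete_dvr t.
Local Notation A := (pseries R n).
Local Notation F := {ffun J -> A^o}.

Lemma monmul_small s b (u : mon n J) (x : F) :
  small t ((psC (t ^+ s) * psmono b) *: x) (monmul s b u) <-> small t x u.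
Proof.
case: u => [[a c] j]; rewrite /small /= ffunE.
rewrite [_ *: _](_ : _ = psC (t ^+ s) * (psmono b * (x j : A))) ?mulrA //.
rewrite -mulrA psCmul psmonoE lem_addr addmC addmK -addnS; split.
  exact: tdvd_cancel.
by apply: tdvdM; apply: tdvdX.
Qed.

Lemma monmul_mge s b (u : mon n J) (x : F) : mge t u x ->
  mge t (monmul s b u) ((psC (t ^+ s) * psmono b) *: x).
Proof.
move=> hx [[a c] j] vu; rewrite /small /= ffunE.
rewrite [_ *: _](_ : _ = psC (t ^+ s) * (psmono b * (x j : A))) ?mulrA //.
rewrite -mulrA psCmul psmonoE; case: ifPn => bc; last first.
  by rewrite mulr0; apply: tdvdn0.
have [as_|sa] := ltnP a s; first by rewrite mulrC; apply/tdvdMl/(tdvd_le as_)/tdvdX.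
have -> : a.+1 = (s + (a - s).+1)%N by lia.
apply: tdvdM; first exact: tdvdX.
apply: (hx ((a - s)%N, (c - b)%MM, j)).
have vE : (a, c, j) = monmul s b ((a - s)%N, (c - b)%MM, j).
  by rewrite /monmul /= subnKC // addmC submK.
have [//|uv|uv] := mlt_total ((a - s)%N, (c - b)%MM, j) u.
  by rewrite vE uv mlt_irr in vu.
by have := mlt_trans vu (mltM s b uv); rewrite -vE mlt_irr.
Qed.

Lemma inmonM (K : set F) s b u : opsub (fun (c : A) (x : F) => c *: x) K ->
  inmon t K u -> inmon t K (monmul s b u).
Proof.
move=> [_ _ KZ] [x [Kx gx nx]]; exists ((psC (t ^+ s) * psmono b) *: x); split.
- exact: KZ.
- exact: monmul_mge.
- by rewrite monmul_small.
Qed.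

(** In each component of the free module the standard monomials form a
    down-set of N ^ (n + 1). *)
Theorem hs_evpoly (K : set F) : opsub (fun (c : A) (x : F) => c *: x) K ->
  evpoly (fun D => (hs t K D)%:Z).
Proof.
move=> sK.
have E D : (hs t K D)%:Z =
    \sum_(j <- enum J) (count (fun v => stdmon t K (mon_of n v j)) (nseqs n.+1 D))%:Z.
  rewrite /hs /mons.
  elim: (nseqs n.+1 D) => [|v s IH] /=; first by rewrite big1.
  rewrite count_cat PoszD IH count_map -sum1_count -natz natr_sum big_mkcond /=.
  rewrite -big_split /=; apply: eq_bigr => j _.
  by rewrite PoszD; case: ifP.
apply: (@evpoly_ext _ _ 0%N (fun D _ => esym (E D))); apply: evpoly_sum => j.
apply: evpoly_cnt => u v su sv uv; rewrite /stdmon; apply: contra => /asboolP hu.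
apply/asboolP.
case: u v su sv uv hu => [//|a u] [//|b v] /= [su] [sv] /andP[ab uv] hu.
have -> : mon_of n (b :: v) j = monmul (b - a) [multinom nth 0%N v i - nth 0%N u i | i < n] (mon_of n (a :: u) j).
  rewrite /monmul /mon_of /= subnK //; congr (_, _, _); apply/mnmP => i.
  rewrite mnmDE !mnmE subnK //; move: uv; rewrite all2E => /andP[_ /(all_nthP (0%N, 0%N))].
  by move=> /(_ i); rewrite size_zip su sv minnn nth_zip ?su ?sv //; apply.
exact: inmonM.
Qed.

End HilbertPolynomial.

(** * Finite standard bases and the Artin-Rees lemma *)

Section Combinations.
Variables (A : pzRingType) (V : lmodType A) (I : finType).
Implicit Types (a b : I -> A) (g : I -> V).

Lemma sumZD a b g : \sum_i (a i + b i) *: g i = \sum_i a i *: g i + \sum_i b i *: g i.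
Proof. by rewrite -big_split; apply: eq_bigr => i _; rewrite scalerDl. Qed.

Lemma sumZB a b g : \sum_i (a i - b i) *: g i = \sum_i a i *: g i - \sum_i b i *: g i.
Proof. by rewrite -sumrB; apply: eq_bigr => i _; rewrite scalerBl. Qed.

Lemma sumZ1 i0 (c d : A) a g x : x - \sum_i (a i + (if i == i0 then d * c else 0)) *: g i =
  x - \sum_i a i *: g i - d *: (c *: g i0).
Proof.
have E : \sum_i (if i == i0 then d * c else 0) *: g i = (d * c) *: g i0.
  rewrite (bigD1 i0) //= eqxx big1 ?addr0 // => i ii.
  by rewrite (negPf ii) scale0r.
by rewrite sumZD E opprD addrA scalerA.
Qed.

Lemma sumZ_sub2 (a b c : I -> A) g x : (forall i, c i = a i + b i) ->
  x - \sum_i a i *: g i - \sum_i b i *: g i = x - \sum_i c i *: g i.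
Proof.
move=> cE; have -> : \sum_i c i *: g i = \sum_i (a i + b i) *: g i.
  by apply: eq_bigr => i _; rewrite cE.
by rewrite sumZD opprD addrA.
Qed.

Lemma sumZ_change a b g x :
  x - \sum_i b i *: g i = x - \sum_i a i *: g i + \sum_i (a i - b i) *: g i.
Proof. by rewrite sumZB addrA subrK. Qed.

End Combinations.

Section StandardBasis.
Variables (R : idomainType) (t : R) (n : nat) (J : finType).
Hypothesis hR : complete_dvr t.
Local Notation A := (pseries R n).
Local Notation F := {ffun J -> A^o}.
Local Notation actA := (fun (c : A) (x : F) => c *: x).

(** The two coordinates rank j and #|J| - rank j make monomials of different
    components incomparable, which reduces to Dickson's lemma. *)
Lemma mon_dickson (f : nat -> mon n J) :
  exists i j s b, (i < j)%N /\ f j = monmul s b (f i).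
Proof.
pose code (u : mon n J) : seq nat :=
  [:: u.1.1, (enum_rank u.2 : nat), (#|J| - enum_rank u.2)%N & u.1.2 : seq nat].
have [|phi [plt ple]] := @dickson n.+3 (code \o f).
  by move=> i /=; rewrite size_tuple.
have ij := plt 0%N 1%N isT; have := ple 0%N 1%N isT.
move: (phi 0%N) (phi 1%N) ij => i j ij /= /and4P[sij r1 r2 aij].
exists i, j, ((f j).1.1 - (f i).1.1)%N, ((f j).1.2 - (f i).1.2)%MM; split=> //.
have rE : enum_rank (f i).2 = enum_rank (f j).2.
  have aux (N a b : nat) : (a < N)%N -> (b < N)%N -> (a <= b)%N ->
    (N - a <= N - b)%N -> a = b by lia.
  by apply: val_inj; apply: (aux #|J|) r1 r2; apply: ltn_ord.
rewrite /monmul subnK // (enum_rank_inj rE) submK; first by case: (f j) => [[]].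
apply/mnm_lepP => k; rewrite !(mnm_nth 0%N).
move: aij; rewrite all2E !size_tuple eqxx /= => /(all_nthP (0%N, 0%N))/(_ k).
by rewrite size_zip !size_tuple minnn nth_zip ?size_tuple //; apply.
Qed.

Lemma inmon_finite (K : set F) : exists l : seq (mon n J),
  (forall u, u \in l -> inmon t K u) /\
  forall u, inmon t K u -> exists v s b, v \in l /\ u = monmul s b v.
Proof.
apply: contrapT => /forallNP h.
have /choice[next hn] : forall l : seq (mon n J), exists u,
    (forall u, u \in l -> inmon t K u) ->
    inmon t K u /\ forall v s b, v \in l -> u <> monmul s b v.
  move=> l; case: (EM (forall u, u \in l -> inmon t K u)) => hl; last first.
    case: (EM (exists u : mon n J, True)) => [[u _]|nu]; first by exists u.
    exfalso; apply: (h [::]); split=> // u _; exfalso; apply: nu; by exists u.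
  have /not_andP[//|] := h l.
  move=> /existsNP[u /not_implyP[Ku nu]]; exists u => _; split=> // v s b vl uE.
  by apply: nu; exists v, s, b.
pose L := fix L k := if k is k'.+1 then next (L k') :: L k' else [::].
have LK k u : u \in L k -> inmon t K u.
  elim: k u => // k IH u; rewrite inE => /orP[/eqP ->|/IH //].
  by have [] := hn (L k) IH.
have Lmem i j : (i < j)%N -> next (L i) \in L j.
  elim: j => // j IH; rewrite ltnS leq_eqVlt /= inE => /orP[/eqP ->|/IH ->].
    by rewrite eqxx.
  by rewrite orbT.
have [i [j [s [b [ij e]]]]] := mon_dickson (fun k => next (L k)).
have [_ /(_ _ s b (Lmem _ _ ij))] := hn (L j) (@LK j); exact.
Qed.

(** In a strictly increasing sequence of sets of leading monomials, choose a
    new monomial at each step: by Dickson one of them is a multiple of an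
    earlier one, hence not new. *)
Lemma inmon_maximal (Pr : set (set F)) K0 : (forall K, Pr K -> opsub actA K) -> Pr K0 ->
  exists K, Pr K /\ forall K', Pr K' -> (forall u, inmon t K u -> inmon t K' u) ->
    forall u, inmon t K' u -> inmon t K u.
Proof.
move=> sPr Pr0; apply: contrapT => /forallNP h.
have /choice[next hn] : forall K, exists Ku : set F * mon n J, Pr K ->
    [/\ Pr Ku.1, forall u, inmon t K u -> inmon t Ku.1 u,
        inmon t Ku.1 Ku.2 & ~ inmon t K Ku.2].
  move=> K; case: (EM (Pr K)) => PK; last first.
    have /not_andP[//|/existsNP[K' /not_implyP[_ /not_implyP[_ /existsNP[u _]]]]] := h K0.
    by exists (K, u).
  have /not_andP[//|/existsNP[K' /not_implyP[PK' /not_implyP[KK' /existsNP[u /not_implyP[uK' uK]]]]]] := h K.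
  by exists (K', u).
pose I := fix I k := if k is k'.+1 then (next (I k')).1 else K0.
have IPr k : Pr (I k) by elim: k => //= k /hn[].
have Ile i j u : (i <= j)%N -> inmon t (I i) u -> inmon t (I j) u.
  elim: j => [|j IH]; first by rewrite leqn0 => /eqP ->.
  rewrite leq_eqVlt => /orP[/eqP -> //|/IH{}IH /IH].
  by have [_ + _ _] := hn _ (IPr j); apply.
have [i [j [s [b [ij e]]]]] := mon_dickson (fun k => (next (I k)).2).
have [_ _ _] := hn _ (IPr j); apply; rewrite e.
apply: (inmonM hR); first exact/sPr/IPr.
by have [_ _ + _] := hn _ (IPr i); apply: (@Ile i.+1).
Qed.

Lemma filF_sep (x : F) : (forall k, filF t k x) -> x = 0.
Proof.
by move=> h; apply/ffunP => j; rewrite ffunE; apply: (fil_sep hR) => k; apply: h.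
Qed.

Lemma filF_Z a b (c : A) (x : F) : fil t a c -> filF t b x -> filF t (a + b) (c *: x).
Proof. by move=> hc hx j; rewrite ffunE; apply: filM. Qed.

Lemma filF_sum k I (r : seq I) (P : pred I) (G : I -> F) :
  (forall i, P i -> filF t k (G i)) -> filF t k (\sum_(i <- r | P i) G i).
Proof.
have sF := @filF_opsub R t n J k.
move=> h; elim/big_ind: _ => //; first by case: sF.
by move=> x y; apply: (opsubD sF).
Qed.

Lemma filF_le a b (x : F) : (a <= b)%N -> filF t b x -> filF t a x.
Proof. by move=> ab hx j; apply: fil_le (hx j). Qed.

Lemma opsub_sum (K : set F) I (r : seq I) (G : I -> F) : opsub actA K ->
  (forall i, K (G i)) -> K (\sum_(i <- r) G i).
Proof.
move=> sK h; elim/big_ind: _ => //; first by case: sK.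
by move=> x y; apply: (opsubD sK).
Qed.

(** Dividing by a finite standard basis lifts the order of vanishing to the
    quotients; the successive quotients converge by completeness. *)
Theorem artin_rees (K : set F) : opsub actA K ->
  exists c q (g : 'I_q -> F), (forall i, K (g i)) /\
    forall k z, K z -> filF t (k + c) z ->
      exists a : 'I_q -> A, (forall i, fil t k (a i)) /\ z = \sum_i a i *: g i.
Proof.
move=> sK; have [l [lK lgen]] := inmon_finite K.
pose q := size l; pose u (i : 'I_q) : mon n J := tnth (in_tuple l) i.
have uK i : inmon t K (u i) by apply/lK/mem_tnth.
have /choice[g hg] := uK.
pose c := \max_i mondeg (u i).
have ldeg i : (mondeg (u i) <= c)%N by apply: leq_bigmax.
have gfil i : filF t (mondeg (u i)) (g i) by apply: mge_filF; case: (hg i).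
have stay d z (a : 'I_q -> A) : K z -> filF t d z ->
    (forall i, fil t (d - mondeg (u i)) (a i)) ->
    K (z - \sum_i a i *: g i) /\ filF t d (z - \sum_i a i *: g i).
  move=> Kz dz ha; split.
    apply: (opsubB sK) => //; apply: opsub_sum => // i.
    by have [_ _ KZ] := sK; apply: KZ; case: (hg i).
  apply: (opsubB (@filF_opsub R t n J d)) => //; apply: filF_sum => i _.
  by apply: filF_le (filF_Z (ha i) (gfil i)); lia.
have inner d z s : K z -> filF t d z -> initial s -> exists a : 'I_q -> A,
    (forall i, fil t (d - mondeg (u i)) (a i)) /\ smallon t s (z - \sum_i a i *: g i).
  move=> Kz dz; elim=> [|{}s v is_ [a [ha sa]] sv].
    exists (fun=> 0); split=> // i; exact: filn0.
  pose z' := z - \sum_i a i *: g i; have [Kz' dz'] : K z' /\ filF t d z' := stay _ _ _ Kz dz ha.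
  have gz' : mge t v z' by move=> w wv; apply: sa; rewrite sv.
  case: (EM (small t z' v)) => sz'.
    exists a; split=> // w; rewrite mem_rcons inE => /orP[/eqP -> //|]; exact: sa.
  have [w [e [b [wl vE]]]] : exists w e b, w \in l /\ v = monmul e b w.
    by apply: lgen; exists z'.
  have /(nthP v)[k0 il wE] := wl; pose i0 : 'I_q := Ordinal il.
  have ui0 : u i0 = w by rewrite /u (tnth_nth v).
  have [_ gi0 ngi0] := hg i0; rewrite ui0 in gi0 ngi0.
  pose m : A := psC (t ^+ e) * psmono b.
  have gy : mge t v (m *: g i0) by rewrite vE; apply: monmul_mge.
  have ny : ~ small t (m *: g i0) v by rewrite vE monmul_small.
  have [r [gr sr]] := mge_reduce hR gy gz' ny.
  pose d0 (i : 'I_q) : A := if i == i0 then psC r * m else 0.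
  exists (fun i => a i + d0 i); split.
    move=> i; apply: filD; first exact: ha.
    rewrite /d0; case: (i =P i0) => [->|_]; last exact: filn0.
    apply: filMl; apply: (@fil_le _ _ _ _ (e + mdeg b)).
      have : (d <= mondeg v)%N.
        rewrite leqNgt; apply/negP => vd; apply: sz'.
        by apply: tdvd_le (dz' v.2 v.1.2); move: vd; rewrite /mondeg; lia.
      by rewrite vE mondegM ui0; lia.
    by apply: filM (fil_mono t b); apply/fil_psC/tdvdX.
  have -> : z - \sum_i (a i + d0 i) *: g i = z' - psC r *: (m *: g i0).
    exact: sumZ1.
  move=> w'; rewrite mem_rcons inE => /orP[/eqP -> //|]; rewrite sv; exact: gr.
have /choice[step hstep] : forall dz : nat * F, exists a : 'I_q -> A, K dz.2 ->
    filF t dz.1 dz.2 -> (forall i, fil t (dz.1 - mondeg (u i)) (a i)) /\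
      filF t dz.1.+1 (dz.2 - \sum_i a i *: g i).
  move=> [d z] /=; case: (EM (K z /\ filF t d z)) => [[Kz dz]|nz]; last first.
    by exists (fun=> 0) => ? ?; case: nz.
  have [s is_ ps] := initial_mons n J d.+1.
  have [a [ha sa]] := inner d z s Kz dz is_; exists a => _ _; split=> //.
  by rewrite -(@smallon_mons _ t _ _ d.+1 s) //; apply: perm_mem.
exists c, q, g; split=> [i|k z Kz kz]; first by case: (hg i).
pose Z := fix Z N := if N is N'.+1
  then Z N' - \sum_i step ((k + c + N')%N, Z N') i *: g i else z.
have hZ N : K (Z N) /\ filF t (k + c + N) (Z N).
  elim: N => [|N [KN fN]]; first by rewrite addn0.
  have [ha hf] := hstep (_, _) KN fN; split; last by rewrite addnS.
  by have [] := stay _ _ _ KN fN ha.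
pose a N i := \sum_(N' < N) step ((k + c + N')%N, Z N') i.
have afil N i : fil t (k + N) (step ((k + c + N)%N, Z N) i).
  have [KN fN] := hZ N; have [/(_ i) + _] := hstep (_, _) KN fN.
  by apply: fil_le; have := ldeg i; rewrite /=; lia.
have /choice[b hb] : forall i, exists l : A, forall N, fil t N (a N i - l).
  move=> i; apply: (fil_complete hR) => N.
  rewrite /a big_ord_recr /= addrAC subrr add0r; apply: fil_le (afil N i); lia.
exists b; split.
  move=> i; rewrite -[b i](subKr (a k i)); apply: filB => //.
  by apply: fil_sum => N _; apply: fil_le (afil N i); lia.
apply/eqP; rewrite -subr_eq0; apply/eqP/filF_sep => N.
have zE : z - \sum_i b i *: g i = Z N + \sum_i (a N i - b i) *: g i.
  have ZE : forall N, Z N = z - \sum_i a N i *: g i.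
    elim=> [|N' IH].
      rewrite big1 /=; first by rewrite subr0.
      by move=> i _; rewrite /a big_ord0; apply: scale0r.
    transitivity (z - \sum_i a N' i *: g i - \sum_i step ((k + c + N')%N, Z N') i *: g i).
      exact: (congr1 (fun w => w - \sum_i step ((k + c + N')%N, Z N') i *: g i) IH).
    by apply: sumZ_sub2 => i; rewrite /a big_ord_recr.
  transitivity (z - \sum_i a N i *: g i + \sum_i (a N i - b i) *: g i).
    exact: sumZ_change.
  exact: (congr1 (fun w => w + \sum_i (a N i - b i) *: g i) (esym (ZE N))).
rewrite zE; apply: (opsubD (@filF_opsub R t n J N)).
  by have [_] := hZ N; apply: filF_le; lia.
apply: filF_sum => i _; apply: (@filF_le N (N + 0)%N); first by rewrite addn0.
by apply: filF_Z => // j; apply: fil0.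
Qed.

End StandardBasis.

(** * Finitely generated modules *)

Section LinearLaws.
Variables (C : comNzRingType) (U V : lmodType C) (f : U -> V).
Hypothesis lf : linear f.

Lemma linD x y : f (x + y) = f x + f y.
Proof. by have := lf 1 x y; rewrite !scale1r. Qed.

Lemma lin0 : f 0 = 0.
Proof. by apply: (@addrI _ (f 0)); rewrite -linD !addr0. Qed.

Lemma linZ a x : f (a *: x) = a *: f x.
Proof. by have := lf a x 0; rewrite lin0 !addr0. Qed.

Lemma linB x y : f (x - y) = f x - f y.
Proof. by rewrite linD -scaleN1r linZ scaleN1r. Qed.

Lemma lin_sum I (r : seq I) (P : pred I) (G : I -> U) :
  f (\sum_(i <- r | P i) G i) = \sum_(i <- r | P i) f (G i).
Proof. exact: (big_morph f linD lin0). Qed.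

End LinearLaws.

Section Modules.
Variables (R : idomainType) (t : R) (n : nat).
Hypothesis hR : complete_dvr t.
Local Notation A := (pseries R n).

Definition actA (E : lmodType A) : A -> E -> E := fun c x => c *: x.
Definition actR (E : lmodType A) : R -> E -> E := fun r x => psC r *: x.

Lemma actAD (E : lmodType A) c (x y : E) : actA c (x + y) = actA c x + actA c y.
Proof. exact: scalerDr. Qed.

Lemma actRD (E : lmodType A) r (x y : E) : actR r (x + y) = actR r x + actR r y.
Proof. exact: scalerDr. Qed.

Lemma opsubR (E : lmodType A) (U : set E) : opsub (@actA E) U -> opsub (@actR E) U.
Proof. by move=> [? ? UZ]; split=> // r x; apply: UZ. Qed.

Lemma opsub_pred (E : lmodType A) (P : {pred E}) :
  GRing.submod_closed P <-> opsub (@actA E) [set x | x \in P].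
Proof.
split=> [[P0 PD]|[P0 PB PZ]].
  have PZ c x : x \in P -> c *: x \in P by move=> Px; rewrite -[_ *: _]addr0; apply: PD.
  by split=> //= x y Px Py; rewrite -scaleN1r addrC; apply: PD.
split=> // c x y Px Py; rewrite -[y]opprK; apply: PB; first exact: PZ.
by rewrite -scaleN1r; apply: PZ.
Qed.

Definition mfil (E : lmodType A) (k : nat) : set E :=
  [set x | x \in Defs.span (ideal_smul E (ideal_exp (maxideal A) k))].

Arguments mfil E k : clear implicits.

Lemma mfil_opsub (E : lmodType A) k : opsub (@actA E) (mfil E k).
Proof. exact/opsub_pred/span_submod. Qed.

Lemma mfilZ (E : lmodType A) k c (x : E) : fil t k c -> mfil E k (c *: x).
Proof. by move=> hc; apply: span_sub; exists c, x; split=> //; apply/(ideal_expP hR). Qed.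

Lemma mfil_sub (E : lmodType A) k (D : set E) : opsub (@actA E) D ->
  (forall c x, fil t k c -> D (c *: x)) -> mfil E k `<=` D.
Proof.
move=> sD hD x; move: x; pose P : {pred E} := fun x => `[< D x >].
have PD : [set x | x \in P] = D by apply/seteqP; split=> x /asboolP.
have cP : GRing.submod_closed P by apply/opsub_pred; rewrite PD.
move=> x hx; apply/asboolP; move: x hx; apply: (span_min cP).
by move=> _ [c [x [/(ideal_expP hR) hc ->]]]; apply/asboolP/hD.
Qed.

Lemma mfil_le (E : lmodType A) a b : (a <= b)%N -> mfil E b `<=` mfil E a.
Proof.
move=> ab; apply: mfil_sub; first exact: mfil_opsub.
by move=> c x /(fil_le ab); apply: mfilZ.
Qed.

Lemma mfil0 (E : lmodType A) : mfil E 0 = setT.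
Proof.
by apply/seteqP; split=> // x _; rewrite -[x]scale1r; apply: mfilZ; apply: fil0.
Qed.

Lemma mfil_mul (E : lmodType A) a b c (x : E) :
  fil t a c -> mfil E b x -> mfil E (a + b) (c *: x).
Proof.
move=> hc; pose D : set E := [set x | mfil E (a + b) (c *: x)].
have [f0 fB fZ] := mfil_opsub E (a + b).
suff : mfil E b `<=` D by apply.
apply: mfil_sub; last by move=> d y hd; rewrite /D /= scalerA; apply/mfilZ/filM.
split; rewrite /D /=.
- by rewrite scaler0.
- by move=> y z hy hz; rewrite scalerBr; apply: fB.
- by move=> d y hy; rewrite /actA scalerA mulrC -scalerA; apply: fZ.
Qed.

Section Presentation.
Variables (E : lmodType A) (J : finType) (e : J -> E).
Local Notation F := {ffun J -> A^o}.

Definition comb (x : F) : E := \sum_j (x j : A) *: e j.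

Lemma combB x y : comb (x - y) = comb x - comb y.
Proof. by rewrite /comb -sumrB; apply: eq_bigr => j _; rewrite !ffunE scalerBl. Qed.

Lemma combZ (c : A) x : comb (c *: x) = c *: comb x.
Proof. by rewrite /comb scaler_sumr; apply: eq_bigr => j _; rewrite ffunE -scalerA. Qed.

Lemma comb_delta j : comb [ffun i => (i == j)%:R] = e j.
Proof.
rewrite /comb (bigD1 j) //= ffunE eqxx scale1r big1 ?addr0 // => i /negPf ij.
by rewrite ffunE ij scale0r.
Qed.

Lemma comb_preim_opsub (F0 : set E) : opsub (@actA E) F0 ->
  opsub (fun (c : A) (x : F) => c *: x) (comb @^-1` F0).
Proof.
move=> sF0; have := @opsub_preim A F E (fun c x => c *: x) (@actA E) comb combB combZ setT F0.
by rewrite setTI; apply.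
Qed.

Definition gens : Prop := forall x, exists y, x = comb y.

Hypothesis hgens : gens.

Lemma mfil_comb k : mfil E k = comb @` filF t k.
Proof.
apply/seteqP; split; last first.
  move=> _ [y hy <-]; rewrite /comb; elim/big_ind: _ => [|x z|j _].
  - by case: (mfil_opsub E k).
  - exact: (opsubD (mfil_opsub E k)).
  - exact/mfilZ/hy.
apply: mfil_sub.
  apply: (@opsub_image A F E (fun c x => c *: x) (@actA E) comb combB combZ).
  exact: filF_opsub.
move=> c x hc; have [y ->] := hgens x; exists (c *: y); last exact: combZ.
by move=> j; rewrite ffunE [_ *: _]mulrC; apply: filMl.
Qed.

(** The map comb from the free module carries the m-adic filtration onto that
    of E, and its kernel lies in the preimage of F0. *)
Lemma clen_presentation (F0 : set E) k : opsub (@actA E) F0 ->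
  clen (@actA E) (addset F0 (mfil E k)) setT (hs t (comb @^-1` F0) k) /\
  clen (@actR E) (addset F0 (mfil E k)) setT (hs t (comb @^-1` F0) k).
Proof.
move=> sF0; set K := comb @^-1` F0.
have sK : opsub (fun (c : A) (x : F) => c *: x) K.
  exact: comb_preim_opsub.
have ET : [set: E] = comb @` setT.
  by apply/seteqP; split=> // x _; have [y ->] := hgens x; exists y.
have EK : addset F0 (mfil E k) = comb @` (addset K (filF t k)).
  rewrite mfil_comb; apply/seteqP; split=> [_ [x [_ [Fx [z fz <-] ->]]]|_ [_ [x [z [Kx fz ->]]] <-]].
    have [y yx] := hgens x; exists (y + z); first by exists y, z; split=> //; rewrite /K /= -yx.
    by rewrite (opmD combB) -yx.
  by exists (comb x), (comb z); split; [|exists z|apply: (opmD combB)].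
have sF k' := @filF_opsub R t n J k'.
have sU := opsub_add (fun c x y => scalerDr c x y) sK (sF k).
have kU x : comb x = 0 -> addset K (filF t k) x.
  move=> x0; apply: (addset_subl (sF k)); rewrite /K /= x0; by case: sF0.
have [c1 c2] := clen_hs hR k sK; rewrite EK ET; split.
  by apply: clen_quot c1 => //; [exact: combB|exact: combZ].
exact: (clen_quot (actV := fun (r : R) (x : F) => psC r *: x) (actW := @actR E)
  combB (fun r x => combZ (psC r) x) (opsub_restrict sU) _ kU c2).
Qed.

End Presentation.

Lemma fin_genP (E : lmodType A) : fin_gen E -> exists q (e : 'I_q -> E), gens e.
Proof.
move=> [s hs]; exists (size s), (tnth (in_tuple s)) => x.
have := hs x; move/asboolP.
pose P : {pred E} := fun x => `[< exists y, x = comb (tnth (in_tuple s)) y >].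
move=> /(_ P) h; apply/asboolP; apply: h.
  split; first by apply/asboolP; exists 0; rewrite (opm0 (combB _)).
  move=> c _ _ /asboolP[y ->] /asboolP[z ->]; apply/asboolP; exists (c *: y + z).
  by rewrite (opmD (combB _)) combZ.
move=> y /= /(nthP 0)[i il <-]; apply/asboolP.
exists [ffun j => (j == Ordinal il)%:R]; rewrite comb_delta (tnth_nth 0) //.
Qed.

Section FinGen.
Variable E : lmodType A.
Hypothesis fE : fin_gen E.

(** Length over R of E / (F0 + m ^ k E); by colenAP it is also the length
    over A. *)
Definition colen (F0 : set E) (k : nat) : nat :=
  xget 0%N [set l | clen (@actR E) (addset F0 (mfil E k)) setT l].

Lemma opsubT T (V : zmodType) (act : T -> V -> V) : opsub act setT.
Proof. by []. Qed.

Lemma addfil_opsub F0 k : opsub (@actA E) F0 -> opsub (@actA E) (addset F0 (mfil E k)).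
Proof. by move=> sF0; apply: opsub_add => //; [exact: actAD|exact: mfil_opsub]. Qed.

Lemma colenAP F0 k : opsub (@actA E) F0 ->
  clen (@actA E) (addset F0 (mfil E k)) setT (colen F0 k) /\
  clen (@actR E) (addset F0 (mfil E k)) setT (colen F0 k).
Proof.
move=> sF0; have [q [e he]] := fin_genP fE.
have [cA cR] := clen_presentation he k sF0.
suff -> : colen F0 k = hs t (comb e @^-1` F0) k by [].
rewrite /colen; case: xgetP => [l _ /= cl|/(_ _ cR) //].
by apply: (clen_uniq (@actRD E) (opsubR (addfil_opsub k sF0)) _ cl cR).
Qed.

Lemma colenP F0 k : opsub (@actA E) F0 ->
  clen (@actR E) (addset F0 (mfil E k)) setT (colen F0 k).
Proof. by case/(colenAP k). Qed.

Lemma colen_hs (J : finType) (e : J -> E) F0 k : gens e -> opsub (@actA E) F0 ->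
  colen F0 k = hs t (comb e @^-1` F0) k.
Proof.
move=> he sF0; have [_ cR] := clen_presentation he k sF0.
exact: (clen_uniq (@actRD E) (opsubR (addfil_opsub k sF0)) _ (colenP k sF0) cR).
Qed.

Lemma colen_evpoly F0 : opsub (@actA E) F0 -> evpoly (fun k => (colen F0 k)%:Z).
Proof.
move=> sF0; have [q [e he]] := fin_genP fE.
have sK : opsub (fun (c : A) (x : {ffun 'I_q -> A^o}) => c *: x) (comb e @^-1` F0).
  exact: comb_preim_opsub.
apply: (@evpoly_ext _ _ 0%N) (hs_evpoly hR sK) => k _.
by rewrite (colen_hs k he sF0).
Qed.

Lemma colen_mono F0 F1 k k' : opsub (@actA E) F0 -> opsub (@actA E) F1 ->
  F1 `<=` F0 -> (k <= k')%N -> (colen F0 k <= colen F1 k')%N.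
Proof.
move=> s0 s1 F10 kk.
apply: (clen_le (@actRD E) (opsubR (addfil_opsub k' s1)) _ (opsubR (addfil_opsub k s0)) _ _ _ (colenP k' s1) (colenP k s0)) => //.
by move=> _ [x [y [/F10 ? /(mfil_le kk) ? ->]]]; exists x, y.
Qed.

Lemma colen_n0 F0 : opsub (@actA E) F0 -> colen F0 0 = 0%N.
Proof.
move=> s0; apply: (clen_trivial _ (colenP 0 s0)) => // x _.
by apply: (addset_subr s0); rewrite mfil0.
Qed.

Lemma opsub0 (V : lmodType A) : opsub (@actA V) [set 0].
Proof.
split=> //= [x y -> ->|c x ->]; first by rewrite subrr.
by rewrite /actA scaler0.
Qed.

Lemma addset0 T (V : zmodType) (act : T -> V -> V) (U : set V) : addset [set 0] U = U.
Proof.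
apply/seteqP; split=> [_ [_ [x [-> ? ->]]]|x Ux]; first by rewrite add0r.
by exists 0, x; rewrite add0r.
Qed.

End FinGen.

Lemma max_chainP V (Q : {pred V} -> Prop) k : has_chain Q k ->
  (forall j, has_chain Q j -> (j <= k)%N) -> max_chain Q = k.
Proof.
move=> hk uk; rewrite /max_chain; case: xgetP => [l _ /= [hl ul]|/(_ k)[]//].
by apply/eqP; rewrite eqn_leq uk //= ul.
Qed.

Lemma mod_length_clen (E : lmodType A) l :
  clen (@actA E) [set 0] setT l -> mod_length E = l.
Proof.
move=> c; apply: max_chainP.
  have [s [s0 ss ns]] := clen_series (opsub0 E) c.
  pose P i : {pred E} := fun x => `[< s i x >].
  have Es i : [set x | x \in P i] = s i by apply/seteqP; split=> x /asboolP.
  exists P; split=> [i il|i il].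
    by apply/opsub_pred; rewrite Es; apply: ss.
  have [h1 h2] := ns i il; split=> [x /asboolP/h1 ?|h]; first exact/asboolP.
  by apply: h2 => x sx; apply/asboolP/h/asboolP.
move=> j [s [ss ns]].
apply: (clen_chain (@actAD E) (opsub0 E) (opsubT (@actA E)) c (c := fun i => [set x | x \in s i])) => //.
- by move=> i /ss/opsub_pred.
- by move=> _ ->; have [] := (opsub_pred (s 0%N)).1 (ss 0%N isT).
Qed.

Lemma mod_length_colen (E : lmodType A) k : fin_gen E ->
  mod_length (quot_mod (ideal_smul E (ideal_exp (maxideal A) k))) = colen [set (0 : E)] k.
Proof.
move=> fE; set S := ideal_smul _ _; apply: mod_length_clen.
have [cA _] := colenAP fE k (opsub0 E); rewrite (addset0 (@actA E)) in cA.
have piB := quot_piB S.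
have E0 : [set (0 : quot_mod S)] = quot_pi S @` mfil E k.
  apply/seteqP; split=> [_ ->|_ [x hx <-]] /=.
    by exists 0; [case: (mfil_opsub E k)|apply: (opm0 piB)].
  by apply/eqP; rewrite -(opm0 piB) quot_pi_eq subr0.
have ET : [set: quot_mod S] = quot_pi S @` setT.
  by apply/seteqP; split=> // x _; exists (quot_repr x); rewrite ?quot_reprK.
rewrite E0 ET; apply: clen_quot cA => //.
- by move=> c x; rewrite /actA linearZ.
- exact: mfil_opsub.
- by move=> x /eqP; rewrite -(opm0 piB) quot_pi_eq subr0.
Qed.

(** Artin-Rees is applied to the submodule F0 + f E' read in a free
    presentation of E; its finite standard basis is then lifted through f. *)
Lemma artin_rees_map (E' E : lmodType A) (f : E' -> E) (F0 : set E) :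
  fin_gen E -> linear f -> opsub (@actA E) F0 ->
  exists c, forall k x, addset F0 (mfil E (k + c)) (f x) ->
    exists2 y, mfil E' k y & F0 (f (x - y)).
Proof.
move=> fE lf sF0; have [q [e he]] := fin_genP fE.
have fZ := linZ lf; have fB := linB lf.
pose F1 := addset F0 (f @` setT).
have sI : opsub (@actA E) (f @` setT) by apply: (@opsub_image _ _ _ (@actA E')).
have sF1 : opsub (@actA E) F1 by apply: opsub_add => //; exact: actAD.
have sK : opsub (fun (c : A) (x : {ffun 'I_q -> A^o}) => c *: x) (comb e @^-1` F1).
  exact: comb_preim_opsub.
have [c [p [g [gK hg]]]] := artin_rees hR sK; exists c => k x [u [w [F0u + fE0]]].
rewrite (mfil_comb he) => -[v hv vE].
have /hg : (comb e @^-1` F1) v.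
  rewrite /= vE; have -> : w = f x - u by rewrite fE0 addrC addKr.
  apply: (opsubB sF1); first by apply: (addset_subr sF0); exists x.
  exact: (addset_subl sI).
move=> /(_ _ hv)[a [ha vsum]].
have /choice[h hh] : forall i, exists y, F0 (comb e (g i) - f y).
  by move=> i; have [w' [_ [Fw [y _ <-] ->]]] := gK i; exists y; rewrite addrK.
exists (\sum_i a i *: h i).
  elim/big_ind: _ => [|y z|i _].
  - by case: (mfil_opsub E' k).
  - exact: (opsubD (mfil_opsub E' k)).
  - exact: mfilZ.
have fsum : f (\sum_i a i *: h i) = \sum_i a i *: f (h i).
  by rewrite (lin_sum lf); apply: eq_bigr => i _; apply: fZ.
have vs : comb e v = \sum_i a i *: comb e (g i).
  rewrite vsum (big_morph (comb e) (opmD (combB e)) (opm0 (combB e))).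
  by apply: eq_bigr => i _; apply: combZ.
rewrite fB fE0 -vE vs fsum -addrA -sumrB; apply: (opsubD sF0) => //.
elim/big_ind: _ => [|y z|i _]; first by case: sF0.
  exact: (opsubD sF0).
by rewrite -scalerBr; case: sF0 => _ _; apply.
Qed.

End Modules.

Arguments mfil {R n} E k.
Arguments actA {R n} E.
Arguments actR {R n} E.

(** * Growth of Hilbert-Samuel functions and Krull dimension *)

Section Growth.
Implicit Types f g u : nat -> nat.

(** Growth of degree less than d, where the zero function alone has degree
    less than 0. With this shift the order of growth of a module is one more
    than its dimension, and passing to a hyperplane section lowers it by
    one. *)
Definition growth (d : nat) f : Prop :=
  if d is d'.+1 then exists C, forall k, (f k <= C * k.+1 ^ d')%N else forall k, f k = 0%N.

Lemma growth_le d f g : (forall k, (f k <= g k)%N) -> growth d g -> growth d f.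
Proof.
case: d => [|d] fg /= => [h k|[C hC]]; first by have := fg k; rewrite h; lia.
by exists C => k; apply: leq_trans (hC k).
Qed.

Lemma growth_ext d f g : f =1 g -> growth d f -> growth d g.
Proof. by move=> fg; apply: growth_le => k; rewrite fg. Qed.

Lemma growth0 d : growth d (fun=> 0%N).
Proof. by case: d => [|d] //=; exists 0%N. Qed.

Lemma growthS d f : growth d f -> growth d.+1 f.
Proof.
case: d => [|d] /= => [h|[C hC]]; first by exists 0%N => k; rewrite h.
exists C => k; apply: leq_trans (hC k) _; rewrite leq_mul2l expnS.
by rewrite leq_pmull ?orbT.
Qed.

Lemma growth_mon d d' f : (d <= d')%N -> growth d f -> growth d' f.
Proof. by move=> /subnK <-; elim: (d' - d)%N => // i IH /IH/growthS. Qed.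

Lemma growthD d f g : growth d f -> growth d g -> growth d (fun k => f k + g k)%N.
Proof.
case: d => [|d] /= => [hf hg k|[C hC] [D hD]]; first by rewrite hf hg.
by exists (C + D)%N => k; rewrite mulnDl leq_add.
Qed.

Lemma growthM d c f : growth d f -> growth d (fun k => c * f k)%N.
Proof.
case: d => [|d] /= => [hf k|[C hC]]; first by rewrite hf muln0.
by exists (c * C)%N => k; rewrite -mulnA leq_mul2l hC orbT.
Qed.

Lemma leq_expl a b d : (a <= b)%N -> (a ^ d <= b ^ d)%N.
Proof. by move=> ab; case: d => [//|d]; rewrite leq_exp2r. Qed.

Lemma growth_shift d c f : growth d f -> growth d (fun k => f (k + c)%N).
Proof.
case: d => [|d] /= => [hf k|[C hC]]; first by rewrite hf.
exists (C * c.+1 ^ d)%N => k; apply: leq_trans (hC _) _.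
rewrite -mulnA leq_mul2l -expnMn leq_expl ?orbT //; nia.
Qed.

Lemma growth_sum d f g : f 0%N = 0%N -> (forall k, (f k.+1 <= f k + g k.+1)%N) ->
  growth d g -> growth d.+1 f.
Proof.
move=> f0 h; case: d => [|d] /= => [hg|[C hC]].
  exists 0%N => k; rewrite mul0n; elim: k => [|k IH]; first by rewrite f0.
  by have := h k; rewrite hg; lia.
exists C => k; elim: k => [|k IH]; first by rewrite f0.
apply: leq_trans (h k) _; apply: leq_trans (leq_add IH (hC _)) _.
rewrite -mulnDr leq_mul2l; apply/orP; right.
rewrite [X in (_ <= X)%N]expnS expnS.
have := leq_expl d (leqnSn k.+1); nia.
Qed.

(** Summing the bound over [k, 2k] telescopes the increments of g, while each
    of the terms u j is at least u k. *)
Lemma growth_average d c g u : g 0%N = 0%N ->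
  (forall i j, (i <= j)%N -> (g i <= g j)%N) ->
  (forall i j, (i <= j)%N -> (u i <= u j)%N) ->
  (forall k, (u k + g (k - c)%N <= g k)%N) ->
  growth d.+1 g -> growth d u.
Proof.
move=> g0 gm um ug [C hC].
have sumu n : (\sum_(j < n) u j <= c * g n)%N.
  apply: (@leq_trans (\sum_(l < c) g (n.-1 - l)%N)); last first.
    rewrite -[X in (_ <= X * _)%N]card_ord -sum_nat_const; apply: leq_sum => l _.
    by apply: gm; lia.
  elim: n => [|n IH]; first by rewrite big_ord0.
  rewrite big_ord_recr /=; apply: leq_trans (leq_add IH (leqnn (u n))) _.
  case: c {IH} ug => [|c'] ug.
    by rewrite !big_ord0 add0n; have := ug n; rewrite subn0; lia.
  rewrite [X in (X + _ <= _)%N]big_ord_recr [X in (_ <= X)%N]big_ord_recl /=.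
  have -> : \sum_(i < c') g (n - bump 0 i)%N = \sum_(i < c') g (n.-1 - i)%N.
    by apply: eq_bigr => l _; congr g; rewrite /bump; lia.
  rewrite -addnA addnC leq_add2r subn0; have := ug n.
  have -> : (n.-1 - c')%N = (n - c'.+1)%N by lia.
  lia.
have key k : (u k * k.+1 <= c * C * (2 ^ d) * k.+1 ^ d)%N.
  have : (u k * k.+1 <= \sum_(j < k + k.+1) u j)%N.
    rewrite big_split_ord /= -[k.+1 in X in (X <= _)%N]card_ord mulnC -sum_nat_const.
    apply: leq_trans (leq_addl _ _); apply: leq_sum => j _; apply: um; lia.
  move/leq_trans; apply; apply: leq_trans (sumu _) _.
  rewrite -!mulnA leq_mul2l; apply/orP; right; apply: leq_trans (hC _) _.
  by rewrite leq_mul2l -expnMn leq_expl ?orbT //; lia.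
case: d hC key => [|d] hC key /=.
  move=> k; apply/eqP; rewrite -leqn0 leqNgt; apply/negP => uk.
  have := key (maxn k (c * C * 2))%N; have := um _ _ (leq_maxl k (c * C * 2)).
  rewrite !expn0 !muln1; set K := maxn _ _; have : (c * C * 2 <= K)%N by apply: leq_maxr.
  nia.
exists (c * C * 2 ^ d.+1)%N => k; have := key k.
by rewrite (expnSr k.+1) mulnA leq_pmul2r.
Qed.

End Growth.

(** * Length formulas for linear maps *)

Section LengthMaps.
Variables (R : idomainType) (t : R) (n : nat).
Hypothesis hR : complete_dvr t.
Local Notation A := (pseries R n).

Section OneMap.
Variables (E' E : lmodType A) (f : E' -> E) (F0 : set E).
Hypotheses (fE : fin_gen E) (fE' : fin_gen E') (lf : linear f).
Hypothesis sF0 : opsub (actA E) F0.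

Let fZ := linZ lf.
Let fB := linB lf.

Lemma image_opsub : opsub (actA E) (f @` setT).
Proof. by apply: (@opsub_image _ _ _ (actA E')). Qed.

Lemma preim_opsub (D : set E) : opsub (actA E) D -> opsub (actA E') (f @^-1` D).
Proof.
move=> sD; have := @opsub_preim A E' E (actA E') (actA E) f fB fZ setT D.
by rewrite setTI; apply.
Qed.

Lemma addset_opsub (D D' : set E) : opsub (actA E) D -> opsub (actA E) D' ->
  opsub (actA E) (addset D D').
Proof. by move=> *; apply: opsub_add => //; apply: actAD. Qed.

(** Exactness of E' -> E / F0 -> E / (F0 + f E') modulo m ^ k; the two bounds
    that follow estimate l by the Hilbert-Samuel function of the source, with
    a shift given by Artin-Rees in the second. *)
Lemma colen_map k : exists l,
  clen (actR E') (f @^-1` (addset F0 (mfil E k))) setT l /\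
  colen F0 k = (l + colen (addset F0 (f @` setT)) k)%N.
Proof.
have sU := addfil_opsub k sF0; have sI := image_opsub.
have sW := addset_opsub sF0 sI; have sD := addfil_opsub k sW.
have [||l1 [l2 [e c1 c2]]] := clen_split (@actRD _ _ E) (opsubR sU) (opsubT _) (opsubR sD) _ _ (colenP hR fE k sF0) => //.
  move=> _ [x [y [Fx my ->]]]; exists x, y; split=> //.
  exact: (addset_subl sI).
exists l1; split.
  apply: (clen_iso (actV := actR E') (actW := actR E)) => //.
  - exact: actRD.
  - by move=> r x; apply: fZ.
  - exact: opsubR.
  suff -> : addset (addset F0 (mfil E k)) [set f x | x in [set: E']] =
    addset (addset F0 [set f x | x in [set: E']]) (mfil E k) by [].
  by apply/seteqP; split=> _ [_ [y [[x [z [Fx mz ->]]] my ->]]];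
    exists (x + y), z; split=> //; do ?[exists x, y; split=> //]; rewrite addrAC.
rewrite e; congr (_ + _)%N.
exact: (clen_uniq (@actRD _ _ E) (opsubR sD) _ c2 (colenP hR fE k sW)).
Qed.

Lemma colen_map_le k :
  (colen F0 k <= colen (addset F0 (f @` setT)) k + colen (f @^-1` F0) k)%N.
Proof.
have [l [cl ->]] := colen_map k; rewrite addnC leq_add2l.
have sP := preim_opsub sF0.
apply: (clen_le (@actRD _ _ E') _ _ _ _ _ _ (colenP hR fE' k sP) cl) => //.
- exact/opsubR/addfil_opsub.
- exact/opsubR/preim_opsub/addfil_opsub.
apply: (@addset_min _ _ (actA E')); first exact/preim_opsub/addfil_opsub.
- by move=> x Fx; apply: (addset_subl (mfil_opsub E k)).
- apply: (mfil_sub hR); first exact/preim_opsub/addfil_opsub.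
  by move=> c x hc; rewrite /= fZ; apply/(addset_subr sF0)/(mfilZ hR).
Qed.


Lemma colen_map_ge : exists c, forall k,
  (colen (f @^-1` F0) (k - c) + colen (addset F0 (f @` setT)) k <= colen F0 k)%N.
Proof.
have [c hc] := artin_rees_map hR fE lf sF0.
exists c => k; have [l [cl ->]] := colen_map k; rewrite leq_add2r.
have sP := preim_opsub sF0.
have [kc|ck] := leqP k c.
  by have /eqP -> : (k - c == 0)%N; [rewrite subn_eq0|rewrite (colen_n0 hR fE' sP)].
apply: (clen_le (@actRD _ _ E') _ _ _ _ _ _ cl (colenP hR fE' (k - c) sP)) => //.
- exact/opsubR/preim_opsub/addfil_opsub.
- exact/opsubR/addfil_opsub.
move=> x /=; rewrite -{1}(subnK (ltnW ck)) => /hc[y my Fxy].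
by exists (x - y), y; rewrite subrK.
Qed.

End OneMap.

Lemma colen_mul_shift (E : lmodType A) (F0 : set E) (x : A) k :
  fin_gen E -> opsub (actA E) F0 -> fil t 1 x ->
  (colen F0 k.+1 <= colen F0 k + colen (addset F0 ( *:%R x @` setT)) k.+1)%N.
Proof.
move=> fE sF0 hx; have lf : linear ( *:%R x : E -> E).
  by move=> a u v; rewrite scalerDr !scalerA mulrC.
have [l [cl ->]] := colen_map fE lf sF0 k.+1; rewrite leq_add2r.
have sP := preim_opsub lf (addfil_opsub k.+1 sF0).
apply: (clen_le (@actRD _ _ E) _ _ _ _ _ _ (colenP hR fE k sF0) cl) => //.
- exact/opsubR/addfil_opsub.
- exact/opsubR.
apply: (@addset_min _ _ (actA E)) => // y.
  by case: sF0 => _ _ sZ Fy; apply: (addset_subl (mfil_opsub E _)); apply: sZ.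
by move=> my; apply: (addset_subr sF0); rewrite -add1n; apply: (mfil_mul hR).
Qed.

End LengthMaps.

(** * Krull dimension *)

Section Dimension.
Variables (R : idomainType) (t : R) (n : nat).
Hypothesis hR : complete_dvr t.
Local Notation A := (pseries R n).
Implicit Types (I P : set A^o).

Lemma fin_gen_ring : fin_gen (A^o : lmodType A).
Proof.
exists [:: 1 : A^o] => x; have [_ sD] := span_submod [set` [:: 1 : A^o]].
have [s0 _] := span_submod [set` [:: 1 : A^o]].
have -> : x = x *: (1 : A^o) + 0 by rewrite addr0 [_ *: _]mulr1.
by apply: sD => //; apply: span_sub; rewrite /= inE.
Qed.

Lemma mfil_ring k : mfil (A^o : lmodType A) k = fil t k.
Proof.
apply/seteqP; split=> [|x hx].
  apply: (mfil_sub hR); last by move=> c x hc; rewrite [_ *: _]mulrC; apply: filMl.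
  split; [exact: filn0|by move=> x y; apply: filB|by move=> c x; apply: filMl].
by rewrite -[x]mulr1; apply: (mfilZ hR (1 : A^o)).
Qed.

Definition prime_set P : Prop := [/\ opsub (actA A^o) P, ~ P 1 &
  forall x y : A, P (x * y) -> P x \/ P y].

Definition addmul I (x : A) : set A^o := addset I ((fun c : A^o => c * x : A^o) @` setT).

Lemma lin_mulr (x : A) : linear (fun c : A^o => c * x : A^o).
Proof. by move=> a u v; rewrite mulrDl -scalerAl. Qed.

Lemma addmul_opsub I x : opsub (actA A^o) I -> opsub (actA A^o) (addmul I x).
Proof. by move=> sI; apply: addset_opsub => //; apply: image_opsub (lin_mulr x). Qed.

Lemma addmul_sub I x : I `<=` addmul I x.
Proof. exact: (addset_subl (image_opsub (lin_mulr x))). Qed.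

Lemma addmul_mem I x : opsub (actA A^o) I -> addmul I x x.
Proof. by move=> sI; apply: (addset_subr sI); exists 1 => //; rewrite mul1r. Qed.

Definition madic_closure I : set A^o :=
  [set x | forall k, addset I (mfil (A^o : lmodType A) k) x].

Lemma closure_opsub I : opsub (actA A^o) I -> opsub (actA A^o) (madic_closure I).
Proof.
move=> sI; have s k := addfil_opsub k sI; split=> [k|x y hx hy k|a x hx k].
- by case: (s k).
- exact: (opsubB (s k)).
- by have [_ _ sZ] := s k; apply: sZ.
Qed.

Lemma closure_sub I : I `<=` madic_closure I.
Proof. by move=> x Ix k; apply: (addset_subl (mfil_opsub _ k)). Qed.

Lemma addfil_closure I k : opsub (actA A^o) I ->
  addset (madic_closure I) (mfil (A^o : lmodType A) k) = addset I (mfil (A^o : lmodType A) k).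
Proof.
move=> sI; apply/seteqP; split.
  apply: (addset_min (addfil_opsub k sI)); first by move=> x; apply.
  exact: (addset_subr sI).
by move=> _ [x [y [Ix my ->]]]; exists x, y; split=> //; apply: closure_sub.
Qed.

Lemma colen_closure I k : opsub (actA A^o) I -> colen (madic_closure I) k = colen I k.
Proof. by move=> sI; rewrite /colen addfil_closure. Qed.

Local Notation e1 := (fun _ : unit => 1 : A^o).

Lemma gens_ring : gens e1.
Proof.
move=> x; exists [ffun=> x]; rewrite /comb (bigD1 tt) //= big1 ?addr0; last by case.
by rewrite ffunE [_ *: _]mulr1.
Qed.

(** Among the m-adically closed ideals over I which grow at least like k ^ d,
    pick one with largest set of leading monomials. If it contained x y but
    neither x nor y, the exact sequence for multiplication by x would bound
    its growth by that of two strictly larger ideals. *)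
Lemma prime_above d I : opsub (actA A^o) I -> ~ growth d (colen I) ->
  exists P, [/\ prime_set P, I `<=` P & ~ growth d (colen P)].
Proof.
move=> sI gI.
pose Pr I' := [/\ opsub (actA A^o) I', I `<=` I', madic_closure I' `<=` I' & ~ growth d (colen I')].
have Prcl I' : opsub (actA A^o) I' -> I `<=` I' -> ~ growth d (colen I') -> Pr (madic_closure I').
  move=> sI' II' gI'; have sc := closure_opsub sI'; split=> //.
  - exact: subset_trans II' (@closure_sub _).
  - by move=> x hx k; rewrite -(addfil_closure k sI'); apply: hx.
  - by move=> h; apply: gI'; apply: growth_ext h => k; apply: colen_closure.
pose PrK (K : set {ffun unit -> A^o}) := exists2 I', Pr I' & K = comb e1 @^-1` I'.
have sPrK K : PrK K -> opsub (fun (c : A) (x : {ffun unit -> A^o}) => c *: x) K.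
  move=> [I' [sI' _ _ _] ->].
  exact: comb_preim_opsub.
have PrK0 : PrK (comb e1 @^-1` (madic_closure I)) by exists (madic_closure I) => //; apply: Prcl.
have [_ [[P PP ->] maxP]] := inmon_maximal hR sPrK PrK0.
have [sP IP cP gP] := PP.
have hsE I' k : opsub (actA A^o) I' -> colen I' k = hs t (comb e1 @^-1` I') k.
  exact: (colen_hs hR fin_gen_ring k gens_ring).
have bigger I' x : opsub (actA A^o) I' -> P `<=` I' -> I' x -> ~ P x -> growth d (colen I').
  move=> sI' PI' I'x nPx; apply: contrapT => gI'; apply/nPx/cP => k.
  have PC := Prcl I' sI' (subset_trans IP PI') gI'.
  have PsubC : P `<=` madic_closure I' by apply: subset_trans PI' (@closure_sub _).
  have sC := closure_opsub sI'.
  have inE u : inmon t (comb e1 @^-1` P) u <-> inmon t (comb e1 @^-1` madic_closure I') u.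
    have up v : inmon t (comb e1 @^-1` P) v -> inmon t (comb e1 @^-1` madic_closure I') v.
      by move=> [y [Py gy ny]]; exists y; split=> //; apply: PsubC.
    by split=> [/up//|]; apply: maxP => //; exists (madic_closure I').
  have lenE : colen P k = colen (madic_closure I') k.
    rewrite !hsE //; apply: eq_count => u; congr (~~ _).
    by apply/asboolP/asboolP => /inE.
  have [||l1 [l2 [e c1 c2]]] := clen_split (@actRD _ _ _) (opsubR (addfil_opsub k sP)) (opsubT _)
     (opsubR (addfil_opsub k sC)) _ _ (colenP hR fin_gen_ring k sP) => //.
    by move=> _ [y [z [/PsubC ? ? ->]]]; exists y, z.
  have e2 := clen_uniq (@actRD _ _ _) (opsubR (addfil_opsub k sC)) (opsubT _) c2 (colenP hR fin_gen_ring k sC).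
  have l12 : l2 = (l1 + l2)%N := etrans e2 (etrans (esym lenE) e).
  have l10 : l1 = 0%N by clear -l12; lia.
  rewrite l10 in c1; have : addset (madic_closure I') (mfil (A^o : lmodType A) k) x.
    exact/(addset_subl (mfil_opsub _ k))/closure_sub.
  have E : addset P (mfil (A^o : lmodType A) k) =
    addset (madic_closure I') (mfil (A^o : lmodType A) k) by inversion c1.
  by rewrite -E.
exists P; split=> //; split=> //.
  move=> P1; apply: gP; apply: (@growth_le _ _ (fun=> 0%N)); last exact: growth0.
  move=> k; rewrite leqn0; apply/eqP/(clen_trivial _ (colenP hR fin_gen_ring k sP)) => // x _.
  apply: (addset_subl (mfil_opsub _ k)); have [_ _ sZ] := sP.
  by rewrite -[x]mulr1; apply: (sZ x 1).
move=> x y Pxy; apply: contrapT => /not_orP[nPx nPy]; apply: gP.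
have lx := lin_mulr x.
apply: (growth_le (colen_map_le hR fin_gen_ring fin_gen_ring lx sP)).
apply: growthD.
  apply: (@bigger (addmul P x) x) => //; [exact: addmul_opsub|exact: addmul_sub|exact: addmul_mem].
apply: (@bigger _ y) => //.
- exact: preim_opsub.
- by move=> z Pz /=; rewrite mulrC; have [_ _ sZ] := sP; apply: (sZ x).
- by rewrite /= mulrC.
Qed.

End Dimension.

Section PrimeChains.
Variables (R : idomainType) (t : R) (n : nat).
Hypothesis hR : complete_dvr t.
Local Notation A := (pseries R n).
Local Notation mA := (A^o : lmodType A).
Implicit Types (I P : set A^o).

Let fA : fin_gen mA := fin_gen_ring R n.

Definition prime_chain (c : nat -> set A^o) (d : nat) : Prop :=
  (forall i, (i <= d)%N -> prime_set (c i)) /\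
  (forall i, (i < d)%N -> c i `<=` c i.+1 /\ ~ c i.+1 `<=` c i).

(** Above a prime of growth at least d, adding one element of m outside it
    lowers the growth by at most one, and leaves room for the next prime. *)
Lemma growth_chain d I : opsub (actA mA) I -> ~ growth d (colen I) ->
  exists c, prime_chain c d /\ I `<=` c 0%N.
Proof.
elim: d I => [|d IH] I sI gI.
  by have [P [pP IP _]] := prime_above hR sI gI; exists (fun=> P); split=> //; split.
have [P [pP IP gP]] := prime_above hR sI gI; have [sP P1 PM] := pP.
have [x hx nPx] : exists2 x : A, fil t 1 x & ~ P x.
  apply: contrapT => h; apply: gP; apply: (@growth_mon 1) => //.
  exists (colen (E := mA) [set 0] 1) => k; rewrite expn0 muln1.
  apply: (clen_le (@actRD _ _ mA) _ _ _ _ _ _ (colenP hR fA 1 (opsub0 mA))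
    (colenP hR fA k sP)) => //.
  - exact/opsubR/addfil_opsub/opsub0.
  - exact/opsubR/addfil_opsub.
  rewrite (addset0 (actA mA)) (mfil_ring n hR) => y hy.
  apply: (addset_subl (mfil_opsub _ k)); apply: contrapT => nPy.
  by apply: h; exists y.
have gPx : ~ growth d (colen (addmul P x)).
  move=> g; apply: gP; apply: (growth_sum _ _ g).
    exact: (colen_n0 hR fA sP).
  move=> k; have := colen_mul_shift hR k fA sP hx.
  suff -> : addset P [set x *: y | y in [set: A^o]] = addmul P x by [].
  by congr addset; apply: eq_imagel => y _; rewrite mulrC.
have [c [[pc nc] Pc]] := IH _ (addmul_opsub x sP) gPx.
exists (fun i => if i is i'.+1 then c i' else P); split=> //; split=> [[|i]|[|i]] //=; [exact: pc| |exact: nc].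
move=> _; split; first exact: subset_trans (addmul_sub x) Pc.
by move=> h; apply/nPx/h/Pc/addmul_mem.
Qed.

Lemma prime_sub_max P : prime_set P -> P `<=` fil t 1.
Proof.
move=> [[P0 PB PZ] P1 _] x Px; apply: contrapT => /(fil_unit hR)[y xy].
by apply: P1; rewrite -xy mulrC; apply: (PZ y).
Qed.

(** An element x of c 1 outside the prime c 0 is a nonzerodivisor modulo c 0,
    so that the quotient by c 1 grows one order less. *)
Lemma chain_growth j d c : prime_chain c j -> growth d (colen (c 0%N)) -> (j < d)%N.
Proof.
elim: j d c => [|j IH] d c [pc nc] g.
  case: d g => // g; have pP := pc 0%N isT; have [sP P1 _] := pP.
  have := colenP hR fA 1 sP; rewrite (g 1%N) => c0.
  have E : addset (c 0%N) (mfil mA 1) = setT by inversion c0.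
  have : addset (c 0%N) (mfil mA 1) (1 : A) by rewrite E.
  rewrite (mfil_ring n hR) => -[x [y [/(prime_sub_max pP) hx hy e]]].
  have /fil1P : fil t 1 (1 : A) by rewrite e; apply: filD.
  by rewrite ps1E eqxx => /(tdvd1_1 hR).
case: d g => [|d] g; first by have : (0 < 0)%N by apply: (IH 0%N c); [split=> i ij; [apply: pc|apply: nc]; lia|].
have [s0 P1 PM] := pc 0%N isT; have [s1 _ _] := pc 1%N isT.
have [h01 n10] := nc 0%N isT.
have [x cx ncx] : exists2 x, c 1%N x & ~ c 0%N x.
  by apply: contrapT => h; apply: n10 => x cx; apply: contrapT => ncx; apply: h; exists x.
have lx := @lin_mulr _ n x.
have [k0 hk0] := colen_map_ge hR fA fA lx s0.
have pre : (fun y : A^o => y * x : A^o) @^-1` (c 0%N) = c 0%N.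
  apply/seteqP; split=> y /=; first by move=> /PM[].
  by move=> cy; rewrite mulrC; have [_ _ sZ] := s0; apply: (sZ x).
rewrite pre in hk0.
have gd : growth d (colen (c 1%N)).
  apply: (growth_average (c := k0) (g := colen (c 0%N))) => //.
  - exact: (colen_n0 hR fA s0).
  - by move=> i i' ii'; apply: (colen_mono hR fA s0 s0).
  - by move=> i i' ii'; apply: (colen_mono hR fA s1 s1).
  - move=> k; apply: leq_trans (hk0 k); rewrite addnC leq_add2l.
    apply: (colen_mono hR fA s1 (addmul_opsub x s0)) => //.
    apply: (addset_min s1) => // _ [y _ <-].
    by have [_ _ sZ] := s1; apply: (sZ y).
by rewrite ltnS; apply: (IH d (fun i => c i.+1)) gd; split=> i ij; [apply: pc|apply: nc]; lia.
Qed.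

Lemma prime_idealP (P : {pred A}) : prime_ideal P <-> prime_set [set x : A^o | x \in P].
Proof.
split.
  move=> [[P0 /negP P1 PD] PM].
  have PZ c x : x \in P -> c * x \in P by move=> Px; rewrite -[c * x]addr0; apply: PD.
  split=> //; last by move=> x y /PM/orP.
  split=> //= x y Px Py; rewrite addrC -mulN1r; exact: PD.
move=> [[P0 PB PZ] P1 PM]; split; last by move=> x y Pxy; apply/orP/PM.
split=> //; first exact/negP.
move=> a x y Px Py; rewrite -[y]opprK; apply: (PB _ _ (PZ a x Px)).
by rewrite -mulN1r; apply: (PZ _ y).
Qed.

Section ModuleDimension.
Variable E : lmodType A.
Hypothesis fE : fin_gen E.

Definition annset : set A^o := [set a | forall x : E, (a : A) *: x = 0].

Lemma annset_opsub : opsub (actA mA) annset.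
Proof.
split=> [x|x y hx hy z|a x hx z]; first exact: scale0r.
  by rewrite scalerBl hx hy subrr.
by rewrite /actA [_ *: x]/(_ * _) -scalerA hx scaler0.
Qed.

Lemma lin_scalel (x : E) : linear (fun c : A^o => (c : A) *: x).
Proof. by move=> a u v; rewrite scalerDl scalerA. Qed.

Lemma colen_gens (s : seq E) F0 : opsub (actA E) F0 ->
  exists F1, [/\ opsub (actA E) F1, F0 `<=` F1, forall x, x \in s -> F1 x &
    forall k, (colen F0 k <= colen F1 k + size s * colen annset k)%N].
Proof.
elim: s F0 => [|x s IH] F0 sF0.
  by exists F0; split=> // k; rewrite mul0n addn0.
have lx := lin_scalel x.
have sF : opsub (actA E) (addset F0 ((fun c : A^o => (c : A) *: x) @` setT)).
  by apply: addset_opsub => //; apply: image_opsub lx.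
have [F1 [s1 F01 hs hk]] := IH _ sF; exists F1; split=> //.
- apply: subset_trans F01; exact: (addset_subl (image_opsub lx)).
- move=> y; rewrite inE => /orP[/eqP ->|/hs //]; apply/F01/(addset_subr sF0).
  by exists 1 => //; apply: scale1r.
- move=> k; apply: leq_trans (colen_map_le hR fE fA lx sF0 k) _.
  rewrite /= mulSn addnCA addnC; apply: leq_add; last exact: hk.
  have : (colen ((fun c : A^o => (c : A) *: x) @^-1` F0) k <= colen annset k)%N.
    apply: (colen_mono hR fA (preim_opsub lx sF0) annset_opsub) => // a ha.
    by rewrite /= ha; case: sF0.
  by [].
Qed.

(** The annihilator has the same order of growth as E: generators of E bound E
    by copies of A / Ann E, and a prime over Ann E contains the annihilator of
    some generator. Then growth_chain and chain_growth bound chains of primes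
    from both sides. *)
Theorem mod_dimE d : growth d.+1 (colen [set (0 : E)]) ->
  ~ growth d (colen [set (0 : E)]) -> mod_dim E = d.
Proof.
move=> gE ngE; apply: max_chainP.
  have ngI : ~ growth d (colen annset).
    move=> gI; apply: ngE; have [s hs] := fE.
    have [F1 [s1 _ sF1 hk]] := colen_gens s (opsub0 E).
    apply: growth_le hk _; apply: growthD; last exact: growthM.
    apply: growth_ext (growth0 d) => k; apply/esym.
    apply: (clen_trivial _ (colenP hR fE k s1)) => // x _.
    apply: (addset_subl (mfil_opsub E k)).
    pose P : {pred E} := fun x => `[< F1 x >].
    have PF : [set x | x \in P] = F1 by apply/seteqP; split=> y /asboolP.
    have /asboolP : x \in P.
      apply: (span_min _ _ (hs x)); first by apply/opsub_pred; rewrite PF.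
      by move=> y /= ys; apply/asboolP/sF1.
    by [].
  have [c [[pc nc] Ic]] := growth_chain annset_opsub ngI.
  pose P i : {pred A} := fun x => `[< c i x >].
  have Pc i : [set x : A^o | x \in P i] = c i by apply/seteqP; split=> y /asboolP.
  exists P; split=> [i id|i id].
    split; first by apply/prime_idealP; rewrite Pc; apply: pc.
    move=> a /asboolP ha; apply/asboolP.
    have : forall j, (j <= i)%N -> c 0%N `<=` c j.
      elim=> [_|j IHj ji]; first exact: subset_refl.
      apply: subset_trans (IHj (ltnW ji)) _.
      by case: (nc j) => //; lia.
    by move=> /(_ i (leqnn i)); apply; apply: Ic.
  have [h1 h2] := nc i id; split=> [x /asboolP/h1 ?|h]; first exact/asboolP.
  by apply: h2 => x sx; apply/asboolP/h/asboolP.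
move=> j [c [pc nc]].
have chain : prime_chain (fun i => [set x : A^o | x \in c i]) j.
  by split=> [i /pc[/prime_idealP]|i /nc].
have [/prime_idealP pP annP] := pc 0%N isT; have [sP P1 PM] := pP.
have [q [e he]] := fin_genP fE.
have [i hi] : exists i, forall a : A, a *: e i = 0 -> a \in c 0%N.
  apply: contrapT => /forallNP h.
  have /choice[a ha] : forall i, exists a : A, a *: e i = 0 /\ ~ (a \in c 0%N).
    by move=> i; have /existsNP[a /not_implyP] := h i; exists a.
  have : (\prod_i a i) \in c 0%N.
    apply: annP; apply/asboolP => x; have [y ->] := he x.
    rewrite /comb scaler_sumr big1 // => i _.
    rewrite scalerA (bigD1 i) //=; set b := \prod_(_ | _) _.
    have -> : a i * b * (y i : A) = b * (y i : A) * a i by ring.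
    by rewrite -scalerA (ha i).1 scaler0.
  elim/big_ind: _ => // [x y hx hy /PM[]//|i _]; by case: (ha i).
have li := lin_scalel (e i).
have [k0 hk0] := colen_map_ge hR fE fA li (opsub0 E).
rewrite -ltnS; apply: (chain_growth chain).
apply: growth_le (growth_shift k0 gE) => k.
apply: leq_trans (leq_trans (leq_addr _ _) (hk0 (k + k0)%N)); rewrite addnK.
exact: (colen_mono hR fA sP (preim_opsub li (opsub0 E))).
Qed.

End ModuleDimension.
End PrimeChains.

(** * Completed tensor products *)

Section CompletedTensor.
Variables (R : comNzRingType) (n m : nat).
Local Notation A := (pseries R n).
Local Notation B := (pseries R m).
Local Notation C := (pseries R (n + m)).
Local Notation psX := (@psX R n m).
Local Notation psY := (@psY R n m).
Variables (M : lmodType A) (N : lmodType B).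
Local Notation P := (ctensor M N).

Definition ct (x : M) (y : N) : P :=
  tmul idfun (tmul psX x (1 : C^o)) (tmul psY y (1 : C^o)).

Lemma ctDl x x' y : ct (x + x') y = ct x y + ct x' y.
Proof. by rewrite /ct tmulDl tmulDl. Qed.

Lemma ctDr x y y' : ct x (y + y') = ct x y + ct x y'.
Proof. by rewrite /ct tmulDl tmulDr. Qed.

Lemma tmulZr1 (E : comNzRingType) (phi : {rmorphism E -> C}) (Q : lmodType E) (a : E) (x : Q) (c : C) :
  tmul phi (a *: x) (c : C^o) = phi a *: tmul phi x (c : C^o).
Proof. by rewrite tmulZl tmulZr. Qed.

Lemma ctZl a x y : ct (a *: x) y = psX a *: ct x y.
Proof. by rewrite /ct tmulZr1 tmulZl tmulZr. Qed.

Lemma ctZr b x y : ct x (b *: y) = psY b *: ct x y.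
Proof. by rewrite /ct tmulZr1 tmulZr. Qed.

Lemma ct0l y : ct 0 y = 0.
Proof. by apply: (@addrI _ (ct 0 y)); rewrite -ctDl !addr0. Qed.

Lemma ct0r x : ct x 0 = 0.
Proof. by apply: (@addrI _ (ct x 0)); rewrite -ctDr !addr0. Qed.

Lemma ctBl x x' y : ct (x - x') y = ct x y - ct x' y.
Proof. by apply/eqP; rewrite eq_sym subr_eq -ctDl subrK. Qed.

Lemma ctBr x y y' : ct x (y - y') = ct x y - ct x y'.
Proof. by apply/eqP; rewrite eq_sym subr_eq -ctDr subrK. Qed.

Lemma tmul_scalar (E : comNzRingType) (phi : {rmorphism E -> C}) (Q : lmodType E) (x : Q) (c : C^o) :
  tmul phi x c = (c : C) *: tmul phi x (1 : C^o).
Proof. by rewrite -tmulZr; congr tmul; rewrite [_ *: _]mulr1. Qed.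

(** Both inner tensor products are base changes to C, so their elements are
    C-combinations of x (x) 1 and of y (x) 1. *)
Lemma ct_ind (T : P -> Prop) : T 0 -> (forall p q, T p -> T q -> T (p + q)) ->
  (forall c x y, T (c *: ct x y)) -> forall p, T p.
Proof.
move=> T0 TD Tct; apply: tensor_ind => // c u v p Tp; apply: (TD) => // {p Tp}.
move: c; move: u; apply: tensor_ind => [c|d x a u IH c].
  rewrite (_ : tmul _ 0 v = 0) ?scaler0 //.
  by apply: (@addrI _ (tmul idfun 0 v)); rewrite -tmulDl !addr0.
rewrite tmulDl scalerDr; apply: (TD) => // {u IH}.
rewrite (tmul_scalar psX x a) scalerA tmulZl tmulZr scalerA; move: (c * _) => {d a} {}c.
move: v c; apply: tensor_ind => [c|d y a v IH c].
  rewrite (_ : tmul _ _ 0 = 0) ?scaler0 //.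
  by apply: (@addrI _ (tmul idfun (tmul psX x (1 : C^o)) 0)); rewrite -tmulDr !addr0.
rewrite tmulDr scalerDr; apply: (TD) => // {v IH}.
rewrite (tmul_scalar psY y a) scalerA tmulZr scalerA; exact: Tct.
Qed.

Section Lift.
Variables (Q : lmodType C) (beta : M -> N -> Q).
Hypothesis bDl : forall x x' y, beta (x + x') y = beta x y + beta x' y.
Hypothesis bDr : forall x y y', beta x (y + y') = beta x y + beta x y'.
Hypothesis bZl : forall a x y, beta (a *: x) y = psX a *: beta x y.
Hypothesis bZr : forall b x y, beta x (b *: y) = psY b *: beta x y.

Let g (x : M) : tensor psY N C^o -> Q := tensor_lift (fun y (c : C^o) => (c : C) *: beta x y).

Let g1 x (y y' : N) (c : C^o) : (c : C) *: beta x (y + y') = (c : C) *: beta x y + (c : C) *: beta x y'.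
Proof. by rewrite bDr scalerDr. Qed.
Let g2 x (y : N) : linear (fun c : C^o => (c : C) *: beta x y).
Proof. by move=> a c c'; rewrite scalerDl scalerA. Qed.
Let g3 x (b : B) (y : N) (c : C^o) : (c : C) *: beta x (b *: y) = ((psY b *: c : C^o) : C) *: beta x y.
Proof. by rewrite bZr scalerA mulrC. Qed.

Let gE x y c : g x (tmul psY y c) = (c : C) *: beta x y.
Proof. exact: (tensor_liftE (g1 x) (g2 x) (g3 x)). Qed.
Let glin x : linear (g x).
Proof. exact: (tensor_lift_linear (g1 x) (g2 x) (g3 x)). Qed.

Let gD x x' v : g (x + x') v = g x v + g x' v.
Proof.
move: v; apply: tensor_ind => [|c y p v IH]; first by rewrite !(lin0 (glin _)) addr0.
by rewrite !glin IH !gE bDl !scalerDr addrACA.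
Qed.
Let gZ a x v : g (a *: x) v = psX a *: g x v.
Proof.
move: v; apply: tensor_ind => [|c y p v IH]; first by rewrite !(lin0 (glin _)) scaler0.
rewrite !glin IH !gE bZl scalerDr !scalerA; congr (_ *: _ + _); ring.
Qed.

Let h (u : tensor psX M C^o) (v : tensor psY N C^o) : Q :=
  tensor_lift (fun x (c : C^o) => (c : C) *: g x v) u.

Let h1 v (x x' : M) (c : C^o) : (c : C) *: g (x + x') v = (c : C) *: g x v + (c : C) *: g x' v.
Proof. by rewrite gD scalerDr. Qed.
Let h2 v (x : M) : linear (fun c : C^o => (c : C) *: g x v).
Proof. by move=> a c c'; rewrite scalerDl scalerA. Qed.
Let h3 v (a : A) (x : M) (c : C^o) : (c : C) *: g (a *: x) v = ((psX a *: c : C^o) : C) *: g x v.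
Proof. by rewrite gZ scalerA mulrC. Qed.
Let hE v x c : h (tmul psX x c) v = (c : C) *: g x v.
Proof. exact: (tensor_liftE (h1 v) (h2 v) (h3 v)). Qed.
Let hlinl v : linear (h^~ v).
Proof. exact: (tensor_lift_linear (h1 v) (h2 v) (h3 v)). Qed.
Let hlinr u : linear (h u).
Proof.
move=> a v w; move: u; apply: tensor_ind => [|c x p u IH].
  by rewrite !(lin0 (hlinl _)) scaler0 addr0.
rewrite !(hlinl _ _ _ _) IH !hE glin !scalerDr !scalerA; rewrite addrACA; congr (_ + _ + _).
by congr (_ *: _); ring.
Qed.

Lemma ctensor_lift : exists theta : P -> Q,
  linear theta /\ forall x y, theta (ct x y) = beta x y.
Proof.
have k1 u u' v : h (u + u') v = h u v + h u' v by apply: (linD (hlinl v)).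
have k3 c u v : h (c *: u) v = h u (idfun c *: v).
  by rewrite (linZ (hlinl v)) (linZ (hlinr u)).
exists (tensor_lift h); split; first exact: (tensor_lift_linear k1 hlinr k3).
move=> x y; rewrite (tensor_liftE k1 hlinr k3) hE gE !scale1r //.
Qed.

End Lift.
End CompletedTensor.

Section Slices.
Variables (R : idomainType) (n m : nat).
Local Notation A := (pseries R n).
Local Notation B := (pseries R m).
Local Notation C := (pseries R (n + m)).
Local Notation psX := (@psX R n m).
Local Notation psY := (@psY R n m).

Definition mjoin (a : 'X_{1..n}) (g : 'X_{1..m}) : 'X_{1..(n + m)%N} :=
  [multinom (match split i with inl j => a j | inr j => g j end) | i < n + m].
Definition mleft (k : 'X_{1..(n + m)%N}) : 'X_{1..n} := [multinom k (lshift m i) | i < n].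
Definition mright (k : 'X_{1..(n + m)%N}) : 'X_{1..m} := [multinom k (rshift n i) | i < m].

Lemma mjoinl a g i : mjoin a g (lshift m i) = a i.
Proof. by rewrite mnmE -[lshift m i]/(unsplit (inl i)) unsplitK. Qed.

Lemma mjoinr a g i : mjoin a g (rshift n i) = g i.
Proof. by rewrite mnmE -[rshift n i]/(unsplit (inr i)) unsplitK. Qed.

Lemma mjoinLK a g : mleft (mjoin a g) = a.
Proof. by apply/mnmP => i; rewrite mnmE mjoinl. Qed.

Lemma mjoinRK a g : mright (mjoin a g) = g.
Proof. by apply/mnmP => i; rewrite mnmE mjoinr. Qed.

Lemma mjoinK k : mjoin (mleft k) (mright k) = k.
Proof. by apply/mnmP => i; rewrite mnmE; case: splitP => j ij; rewrite mnmE; congr (k _); apply: val_inj. Qed.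

Lemma mdeg_join a g : mdeg (mjoin a g) = (mdeg a + mdeg g)%N.
Proof.
rewrite !mdegE big_split_ord /=; congr (_ + _)%N; apply: eq_bigr => i _.
  by rewrite mjoinl.
by rewrite mjoinr.
Qed.

Lemma mjoinB a g a' g' : (mjoin a g - mjoin a' g')%MM = mjoin (a - a')%MM (g - g')%MM.
Proof. by apply/mnmP => i; rewrite mnmBE !mnmE; case: split => j; rewrite mnmBE. Qed.

Lemma mjoin_le a g a' g' : (mjoin a g <= mjoin a' g')%MM = (a <= a')%MM && (g <= g')%MM.
Proof.
apply/mnm_lepP/andP => [h|[/mnm_lepP ha /mnm_lepP hg] i].
  by split; apply/mnm_lepP => i; [have := h (lshift m i)|have := h (rshift n i)];
    rewrite ?mjoinl ?mjoinr.
by rewrite !mnmE; case: split.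
Qed.

Lemma psXE (f : A) k : psX f k = if mright k == 0%MM then f (mleft k) else 0.
Proof.
rewrite /Defs.psX /rename; congr (if _ then _ else _).
apply/forallP/eqP => [h|k0 j].
  apply/mnmP => i; rewrite mnmE mnm0E; apply/eqP; have := h (rshift n i).
  case/orP => // /codomP[i' /eqP]; by rewrite eq_rlshift.
rewrite -(splitK j); case: (split j) => i /=; first by rewrite codom_f.
by apply/orP; right; have /mnmP/(_ i) := k0; rewrite mnmE mnm0E => ->.
Qed.

Lemma psYE (f : B) k : psY f k = if mleft k == 0%MM then f (mright k) else 0.
Proof.
rewrite /Defs.psY /rename; congr (if _ then _ else _).
apply/forallP/eqP => [h|k0 j].
  apply/mnmP => i; rewrite mnmE mnm0E; apply/eqP; have := h (lshift m i).
  case/orP => // /codomP[i' /eqP]; by rewrite eq_lrshift.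
rewrite -(splitK j); case: (split j) => i /=; last by rewrite codom_f.
by apply/orP; right; have /mnmP/(_ i) := k0; rewrite mnmE mnm0E => ->.
Qed.

(** The coefficient of X ^ a when R[[X, Y]] is read as R[[Y]][[X]]. *)
Definition slice (c : C) (a : 'X_{1..n}) : B := fun g => c (mjoin a g).

Lemma sub_eq0 p (a b : 'X_{1..p}) : (a <= b)%MM -> ((b - a)%MM == 0%MM) = (b == a).
Proof.
move=> ab; apply/eqP/eqP => [e|->]; last by apply/mnmP => i; rewrite mnmBE subnn mnm0E.
by rewrite -(submK ab) e add0m.
Qed.

Lemma slice_mulX c f a D : (mdeg a < D)%N ->
  slice (c * psX f) a = \sum_(d : 'X_{1..n < D} | (d <= a)%MM) psC (f (a - d)%MM) * slice c d.
Proof.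
move=> aD; apply: funext => g; rewrite /slice.
have aD' : (mdeg (mjoin a g) < D + mdeg g)%N by rewrite mdeg_join ltn_add2r.
rewrite (psME _ _ aD') (bigID (fun k : 'X_{1..(n + m)%N < (D + mdeg g)%N} => mright (bmnm k) == g)) /=.
rewrite [X in _ + X]big1 ?addr0; last first.
  move=> k /andP[ka kg]; move: ka; rewrite -{1}[bmnm k]mjoinK mjoin_le => /andP[_ kg'].
  rewrite psXE -[bmnm k]mjoinK mjoinB mjoinRK sub_eq0 // eq_sym (negPf kg).
  by rewrite mulr0.
have hd (d : 'X_{1..n < D}) : (mdeg (mjoin d g) < D + mdeg g)%N.
  by rewrite mdeg_join ltn_add2r bmdeg.
have D0 : (mdeg (0%MM : 'X_{1..n}) < D)%N by rewrite mdeg0; apply: leq_ltn_trans aD.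
rewrite (reindex_onto (fun d => BMultinom (hd d)) (fun k => insubd (BMultinom D0) (mleft k))) /=; last first.
  move=> k /andP[ka /eqP kg]; apply/eqP; rewrite bmeqP /= val_insubd.
  move: ka; rewrite -{1}[bmnm k]mjoinK mjoin_le => /andP[ka _].
  have -> : (mdeg (mleft k) < D)%N by apply: leq_ltn_trans aD; apply/lemc_mdeg/lem_leo.
  by rewrite -{2}[bmnm k]mjoinK kg.
rewrite pssumE; apply: eq_big => [d|d da].
  rewrite mjoin_le mjoinRK eqxx lepm_refl andbT andbT.
  suff -> : insubd (BMultinom D0) (mleft (mjoin d g)) == d by rewrite andbT.
  by rewrite bmeqP /= val_insubd mjoinLK bmdeg.
have {}da : (d <= a)%MM by move: da; rewrite mjoin_le => /andP[/andP[/andP[]]].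
by rewrite psXE mjoinB mjoinRK mjoinLK sub_eq0 ?lepm_refl // eqxx psCmul mulrC.
Qed.

Lemma slice_mulY c f a : slice (c * psY f) a = slice c a * f.
Proof.
apply: funext => g; rewrite /slice.
have aD' : (mdeg (mjoin a g) < mdeg a + (mdeg g).+1)%N by rewrite mdeg_join ltn_add2l.
rewrite (psME _ _ aD').
rewrite (bigID (fun k : 'X_{1..(n + m)%N < (mdeg a + (mdeg g).+1)%N} => mleft (bmnm k) == a)) /=.
rewrite [X in _ + X]big1 ?addr0; last first.
  move=> k /andP[ka kg]; move: ka; rewrite -{1}[bmnm k]mjoinK mjoin_le => /andP[ka' _].
  rewrite psYE -[bmnm k]mjoinK mjoinB mjoinLK sub_eq0 // eq_sym (negPf kg).
  by rewrite mulr0.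
have hd (d : 'X_{1..m < (mdeg g).+1}) : (mdeg (mjoin a d) < mdeg a + (mdeg g).+1)%N.
  by rewrite mdeg_join ltn_add2l bmdeg.
have D0 : (mdeg (0%MM : 'X_{1..m}) < (mdeg g).+1)%N by rewrite mdeg0.
rewrite (reindex_onto (fun d => BMultinom (hd d)) (fun k => insubd (BMultinom D0) (mright k))) /=; last first.
  move=> k /andP[ka /eqP kg]; apply/eqP; rewrite bmeqP /= val_insubd.
  move: ka; rewrite -{1}[bmnm k]mjoinK mjoin_le => /andP[_ ka].
  have -> : (mdeg (mright k) < (mdeg g).+1)%N by rewrite ltnS; apply/lemc_mdeg/lem_leo.
  by rewrite -{2}[bmnm k]mjoinK kg.
rewrite (psME _ _ (ltnSn (mdeg g))); apply: eq_big => [d|d da].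
  rewrite mjoin_le mjoinLK eqxx lepm_refl andbT /=.
  suff -> : insubd (BMultinom D0) (mright (mjoin a d)) == d by rewrite andbT.
  by rewrite bmeqP /= val_insubd mjoinRK bmdeg.
have {}da : (d <= g)%MM by move: da; rewrite mjoin_le => /andP[/andP[/andP[]]].
by rewrite psYE mjoinB mjoinRK mjoinLK sub_eq0 ?lepm_refl // eqxx.
Qed.

Variable t : R.

Lemma fil_slice k c a : fil t k c -> fil t (k - mdeg a) (slice c a).
Proof. by move=> hc g; have := hc (mjoin a g); rewrite mdeg_join subnDA. Qed.

Lemma fil_psX k (f : A) : fil t k f -> fil t k (psX f).
Proof.
move=> hf l; rewrite psXE; case: eqP => [l0|_]; last exact: tdvdn0.
by have := hf (mleft l); rewrite -{3}[l]mjoinK mdeg_join l0 mdeg0 addn0.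
Qed.

Lemma fil_psY k (f : B) : fil t k f -> fil t k (psY f).
Proof.
move=> hf l; rewrite psYE; case: eqP => [l0|_]; last exact: tdvdn0.
by have := hf (mright l); rewrite -{3}[l]mjoinK mdeg_join l0 mdeg0 add0n.
Qed.

Lemma join_eq0 (k : 'X_{1..(n + m)%N}) :
  (k == 0%MM) = (mleft k == 0%MM) && (mright k == 0%MM).
Proof.
apply/eqP/andP => [->|[/eqP l0 /eqP r0]].
  by split; apply/eqP/mnmP => i; rewrite !mnmE.
by rewrite -[k]mjoinK l0 r0; apply/mnmP => i; rewrite !mnmE; case: split => j; rewrite mnmE.
Qed.

Lemma psX_psC (r : R) : psX (psC r) = psC r.
Proof.
apply: funext => k; rewrite psXE /psC.
rewrite join_eq0.
by case: (mright k == _); rewrite ?andbT ?andbF.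
Qed.

Lemma psY_psC (r : R) : psY (psC r) = psC r.
Proof.
apply: funext => k; rewrite psYE /psC.
rewrite join_eq0.
by case: (mleft k == _).
Qed.

Lemma slice_psC (r : R) c a : slice (psC r * c) a = psC r * slice c a.
Proof. by apply: funext => g; rewrite /slice !psCmul. Qed.

(** Only the slices of degree less than k matter modulo m ^ k. This lets an
    element of C act on x (x) y through A and B alone. *)
Lemma slice_decomp k c :
  fil t k (c - \sum_(d : 'X_{1..n < k}) psX (psmono d) * psY (slice c d)).
Proof.
move=> l; have [lk|kl] := leqP k (mdeg (mleft l)).
  have -> : (k - mdeg l = 0)%N; last exact: tdvd_0n.
  by rewrite -[l]mjoinK mdeg_join; lia.
rewrite psBE; have -> : (\sum_(d : 'X_{1..n < k}) psX (psmono d) * psY (slice c d)) l = c l.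
  have E (d : 'X_{1..n < k}) : slice (psX (psmono d)) (mleft l) = ((mleft l == d)%:R : B).
    apply: funext => g; rewrite /slice psXE mjoinLK mjoinRK /psmono.
    have -> (b : bool) : ((b%:R : B) g) = if b then (g == 0%MM)%:R else 0.
      by case: b; first exact: ps1E.
    by case: (mleft l == d); case: (g == 0%MM).
  have S : slice (\sum_(d : 'X_{1..n < k}) psX (psmono d) * psY (slice c d)) (mleft l) =
      slice c (mleft l).
    transitivity (\sum_(d : 'X_{1..n < k}) ((mleft l == d)%:R : B) * slice c d).
      apply: funext => g; rewrite /slice !pssumE; apply: eq_bigr => d _.
      by rewrite -[LHS]/(slice _ _ g) slice_mulY E.
    rewrite (bigD1 (BMultinom kl)) //= eqxx mul1r big1 ?addr0 // => d.
    by rewrite bmeqP /= eq_sym => /negPf ->; rewrite mul0r.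
  by rewrite -[l]mjoinK; apply: (congr1 (fun f : B => f (mright l)) S).
by rewrite subrr; apply: tdvdn0.
Qed.

End Slices.

Section TensorModules.
Variables (R : idomainType) (t : R) (n m : nat).
Hypothesis hR : complete_dvr t.
Local Notation A := (pseries R n).
Local Notation B := (pseries R m).
Local Notation C := (pseries R (n + m)).
Local Notation psX := (@psX R n m).
Local Notation psY := (@psY R n m).
Variables (M : lmodType A) (N : lmodType B).
Local Notation P := (ctensor M N : lmodType C).

Lemma gens_fin_gen (E : lmodType C) (J : finType) (e : J -> E) : gens e -> fin_gen E.
Proof.
move=> he; exists [seq e j | j <- enum J] => x; have [y ->] := he x.
set S := [set` _]; have [s0 sD] := span_submod S.
rewrite /comb; elim/big_ind: _ => [//|u v hu hv|j _].
  by rewrite -[u]scale1r; apply: sD.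
rewrite -[_ *: _]addr0; apply: sD => //; apply: span_sub.
by apply/mapP; exists j => //; rewrite mem_enum.
Qed.

Section Generators.
Variables (I J : finType) (e : I -> M) (f : J -> N).

Definition ctgen (ij : I * J) : ctensor M N := ct (e ij.1) (f ij.2).

Lemma ct_comb a b : ct (comb e a) (comb f b) =
  comb ctgen [ffun ij => psX (a ij.1 : A) * psY (b ij.2 : B) : C^o].
Proof.
rewrite /comb (big_morph (fun x => ct x _) (fun x y => ctDl x y _) (ct0l _ _)).
transitivity (\sum_i \sum_j (psX (a i : A) * psY (b j : B)) *: ct (e i) (f j)).
  apply: eq_bigr => i _; rewrite (big_morph (ct _) (ctDr _) (ct0r _ _)).
  by apply: eq_bigr => j _; rewrite ctZl ctZr scalerA.
by rewrite pair_bigA; apply: eq_bigr => -[i j] _; rewrite ffunE.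
Qed.

Lemma ct_gens : gens e -> gens f -> gens ctgen.
Proof.
move=> he hf; apply: ct_ind => [|p q [x ->] [y ->]|c x y].
- by exists 0; rewrite (opm0 (combB _)).
- by exists (x + y); rewrite (opmD (combB _)).
have [a ->] := he x; have [b ->] := hf y; rewrite ct_comb.
by exists (c *: [ffun ij => psX (a ij.1 : A) * psY (b ij.2 : B) : C^o]); rewrite combZ.
Qed.

End Generators.

Hypotheses (fM : fin_gen M) (fN : fin_gen N).

Lemma ctensor_fin_gen : fin_gen P.
Proof.
have [q [e he]] := fin_genP fM; have [r [f hf]] := fin_genP fN.
exact: gens_fin_gen (ct_gens he hf).
Qed.

(** Flatness applied to multiplication by t on R, with R (x) N identified with
    N. *)
Lemma flat_torsion_free : flat_over (@psC R m) N -> forall y : N, psC t *: y = 0 -> y = 0.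
Proof.
move=> flN y ty0.
have lt : linear (fun r : R^o => t * r : R^o) by move=> a u v; rewrite mulrDr mulrCA.
pose ft : {linear R^o -> R^o} :=
  HB.pack (fun r : R^o => t * r : R^o) (GRing.isLinear.Build _ _ _ _ _ lt).
have inj : injective ft by move=> u v /= e; apply: (mulfI (dvr_t0 hR)) e.
have h1 : tmul (@psC R m) (1 : R^o) y = 0.
  apply: (flN _ _ _ inj); rewrite tensor_mapE (lin0 (tensor_map_linear _)).
  rewrite (_ : ft 1 = t *: (1 : R^o)) // tmulZl ty0.
  by apply: (@addrI _ (tmul (@psC R m) (1 : R^o) (0 : N))); rewrite -tmulDr !addr0.
pose h (r : R^o) (z : N) : N := psC r *: z.
have hD r r' z : h (r + r') z = h r z + h r' z by rewrite /h raddfD scalerDl.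
have hl r : linear (h r) by move=> a u v; rewrite /h scalerDr !scalerA mulrC.
have hZ a r z : h (a *: r) z = h r (psC a *: z).
  by rewrite /h (_ : a *: r = r * a :> R) ?rmorphM ?scalerA //; apply: mulrC.
have := tensor_liftE (phi := @psC R m) hD hl hZ (1 : R^o) y.
by rewrite h1 (lin0 (tensor_lift_linear hD hl hZ)) /h rmorph1 scale1r.
Qed.

Lemma ct_mfil_l k x y : mfil M k x -> mfil P k (ct x y).
Proof.
pose D : set M := [set x | mfil P k (ct x y)].
have sm := mfil_opsub P k.
suff : mfil M k `<=` D by apply.
apply: (mfil_sub hR).
  split; rewrite /D /=.
  - by rewrite ct0l; case: sm.
  - by move=> u v hu hv; rewrite ctBl; apply: (opsubB sm).
  - by move=> a u hu; rewrite /actA ctZl; case: sm => _ _; apply.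
by move=> a u ha; rewrite /D /= ctZl; apply: (mfilZ hR); apply: fil_psX.
Qed.

Lemma ct_mfil_r k x y : mfil N k y -> mfil P k (ct x y).
Proof.
pose D : set N := [set y | mfil P k (ct x y)].
have sm := mfil_opsub P k.
suff : mfil N k `<=` D by apply.
apply: (mfil_sub hR).
  split; rewrite /D /=.
  - by rewrite ct0r; case: sm.
  - by move=> u v hu hv; rewrite ctBr; apply: (opsubB sm).
  - by move=> a u hu; rewrite /actA ctZr; case: sm => _ _; apply.
by move=> a u ha; rewrite /D /= ctZr; apply: (mfilZ hR); apply: fil_psY.
Qed.

(** The R-submodule of P generated by U (x) N and m ^ k P, as an
    intersection. *)
Definition tspan k (U : set M) : set P :=
  [set p | forall D : set P, opsub (actR P) D -> mfil P k `<=` D ->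
     (forall x y, U x -> D (ct x y)) -> D p].

Lemma tspan_opsub k U : opsub (actR P) (tspan k U).
Proof.
split=> [D sD _ _|p q hp hq D sD h1 h2|r p hp D sD h1 h2].
- by case: sD.
- by apply: (opsubB sD); [apply: hp|apply: hq].
- by have [_ _] := sD; apply; apply: hp.
Qed.

Lemma tspan_mfil k U : mfil P k `<=` tspan k U.
Proof. by move=> p hp D _ h _; apply: h. Qed.

Lemma tspan_ct k (U : set M) x y : U x -> tspan k U (ct x y).
Proof. by move=> Ux D _ _; apply. Qed.

Lemma tspan_setT k : tspan k setT = setT.
Proof.
apply/seteqP; split=> // p _ D sD mD ctD.
pose T (p : ctensor M N) := forall c : C, D (c *: p).
suff : T p by move=> /(_ 1); rewrite scale1r.
move: p; apply: ct_ind => [c|p q hp hq c|d x y c].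
- by rewrite scaler0; case: sD.
- by rewrite scalerDr; apply: (opsubD sD).
rewrite scalerA; move: (c * d) => {d}c.
rewrite -(subrK (\sum_(d : 'X_{1..n < k}) psX (psmono d) * psY (slice c d)) c) scalerDl.
apply: (opsubD sD); first exact/mD/(mfilZ hR)/slice_decomp.
rewrite scaler_suml; elim/big_ind: _ => [|u v|d _]; first by case: sD.
  exact: (opsubD sD).
by rewrite -scalerA -ctZr -ctZl; apply: ctD.
Qed.

Lemma tspan_mfilM k : tspan k (mfil M k) = mfil P k.
Proof.
apply/seteqP; split; last exact: tspan_mfil.
move=> p; apply=> //; first exact/opsubR/mfil_opsub.
by move=> x y; apply: ct_mfil_l.
Qed.

(** Were t z outside U, simplicity would give U1 = U + R t z, hence (1 - r t) z
    in U for some r; but 1 - r t is a unit and z is not in U. *)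
Lemma covers_cyclic (U U1 : set M) : opsub (actR M) U -> opsub (actR M) U1 ->
  covers (actR M) U U1 -> exists z, [/\ U1 z, U (psC t *: z) &
    forall x, U1 x -> exists r, U (x - psC r *: z)].
Proof.
move=> sU sU1 [UU1 nU cU].
have [z [U1z nUz]] : exists z, U1 z /\ ~ U z.
  by apply: contrapT => h; apply: nU => x U1x; apply: contrapT => nUx; apply: h; exists x.
pose G w := addset U [set psC r *: w | r in [set: R]].
have sG w : opsub (actR M) (G w).
  apply: opsub_add => //; first exact: actRD.
  split.
  - by exists 0 => //; rewrite raddf0 scale0r.
  - by move=> _ _ [r _ <-] [r' _ <-]; exists (r - r') => //; rewrite raddfB scalerBl.
  - by move=> a _ [r _ <-]; exists (a * r) => //; rewrite rmorphM -scalerA.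
have UG w : U `<=` G w.
  by move=> x Ux; exists x, 0; rewrite addr0; split=> //; exists 0 => //; rewrite raddf0 scale0r.
have GU1 w : U1 w -> G w `<=` U1.
  move=> U1w; apply: (addset_min sU1 UU1) => _ [r _ <-].
  by case: sU1 => _ _; apply.
have Gz w : U1 w -> G w w.
  by exists 0, w; rewrite add0r; split=> //; [case: sU|exists 1 => //; rewrite rmorph1 scale1r].
have U1tz : U1 (psC t *: z) by case: sU1 => _ _; apply.
exists z; split=> //.
  case: (cU _ (sG (psC t *: z)) (UG _) (GU1 _ U1tz)) => h; first exact/h/Gz.
  have [u [_ [Uu [r _ <-] zE]]] := h _ U1z.
  case: nUz; have [v hv] := geometric_unit hR r.
  have -> : z = psC v *: (u : M).
    have -> : u = psC (1 - r * t) *: z.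
      rewrite (rmorphB (@psC R n)) rmorph1 rmorphM scalerBl scale1r -scalerA.
      by rewrite {1}zE scalerA addrK.
    by rewrite scalerA -rmorphM mulrC hv rmorph1 scale1r.
  by case: sU => _ _; apply.
move=> x U1x; case: (cU _ (sG z) (UG z) (GU1 _ U1z)) => h; first by case: nUz; apply/h/Gz.
by have [u [_ [Uu [r _ <-] xE]]] := h _ U1x; exists r; rewrite xE addrK.
Qed.

Definition tN : set N := addset [set 0] ((fun y : N => psC t *: y) @` setT).

Lemma lin_t : linear (fun y : N => psC t *: y).
Proof. by move=> a u v; rewrite scalerDr !scalerA mulrC. Qed.

Lemma tN_opsub : opsub (actA N) tN.
Proof. by apply: addset_opsub; [exact: opsub0|apply: image_opsub lin_t]. Qed.

(** Filtering M by a composition series, each simple quotient tensored with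
    N is a quotient of N / (t N + m ^ k N). *)
Theorem colen_tensor_le k :
  (colen (E := P) [set 0%R] k <= colen (E := M) [set 0%R] k * colen tN k)%N.
Proof.
have step U U1 l : opsub (actR M) U -> opsub (actR M) U1 -> clen (actR M) U U1 l ->
    exists2 l', (l' <= l * colen tN k)%N & clen (actR P) (tspan k U) (tspan k U1) l'.
  move=> sU sU1 c; elim: c sU sU1 => {U U1 l} [U|U U' U1 l sU' cU c IH] sU sU1.
    by exists 0%N => //; apply: clen0.
  have [l1 l1l c1] := IH sU' sU1.
  have [z [U'z Utz U'E]] := covers_cyclic sU sU' cU.
  have fB (y y' : N) : ct z (y - y') = ct z y - ct z y' by apply: ctBr.
  have fZ r (y : N) : ct z (actR N r y) = actR P r (ct z y).
    by rewrite /actR ctZr psY_psC.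
  have sD : opsub (actR N) [set y : N | tspan k U (ct z y)].
    have := opsub_preim fB fZ (opsubT (actR N)) (tspan_opsub k U).
    by rewrite setTI.
  have [|l2 l2l c2] := clen_image (@actRD _ _ P) fB fZ (opsubR (addfil_opsub k tN_opsub))
    (opsubT (actR N)) (tspan_opsub k U) (colenP hR fN k tN_opsub).
    move=> _ [w [x [v [[x0 [b [-> [y _ <-] ->]]] mv ->]]] <-].
    rewrite add0r ctDr; apply: (opsubD (tspan_opsub k U)).
      rewrite ctZr psY_psC -psX_psC -ctZl; exact: tspan_ct.
    by apply: tspan_mfil; apply: (ct_mfil_r (k := k)).
  have E : addset (tspan k U) [set ct z y | y in [set: N]] = tspan k U'.
    apply/seteqP; split.
      apply: (addset_min (tspan_opsub k U')); last by move=> _ [y _ <-]; apply: tspan_ct.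
      move=> p hp D sD' mD ctD; apply: hp => // x y Ux; apply: ctD.
      by case: cU => h _ _; apply: h.
    have sI : opsub (actR P) [set ct z y | y in [set: N]].
      by apply: (opsub_image fB fZ); apply: opsubT.
    move=> p; apply.
    - by apply: opsub_add; [exact: actRD|exact: tspan_opsub|].
    - by move=> q /(@tspan_mfil k U); apply: (addset_subl sI).
    - move=> x y /U'E[r Ux]; exists (ct (x - psC r *: z) y), (ct (psC r *: z) y).
      split; [exact: tspan_ct| |by rewrite -ctDl subrK].
      by exists (psC r *: y) => //; rewrite ctZl ctZr psX_psC psY_psC.
  rewrite E in c2; exists (l2 + l1)%N; last exact: clen_cat c2 c1.
  by rewrite mulSn leq_add.
have cM := colenP hR fM k (opsub0 M); rewrite (addset0 (actR M)) in cM.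
have [l' ll' c] := step _ _ _ (opsubR (mfil_opsub M k)) (opsubT _) cM.
have cP := colenP hR ctensor_fin_gen k (opsub0 P); rewrite (addset0 (actR P)) in cP.
rewrite tspan_setT tspan_mfilM in c.
by rewrite (clen_uniq (@actRD _ _ P) (opsubR (mfil_opsub P k)) (opsubT _) cP c).
Qed.

End TensorModules.

(** * A lower bound for the length of the tensor product *)

Section MonomialSums.
Variables (R : idomainType) (n : nat) (J : finType).
Implicit Types (S : pred (mon n J)) (phi : nat -> nat).

Lemma perm_mons i k : (i <= k)%N ->
  perm_eq (mons n J i) [seq u <- mons n J k | (mondeg u < i)%N].
Proof.
move=> ik; apply: uniq_perm; [exact: uniq_mons|exact/filter_uniq/uniq_mons|].
by move=> u; rewrite mem_filter !mem_mons; apply/idP/andP => [|[]//]; split=> //; lia.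
Qed.

Lemma sum_mons S phi k : (\sum_(u <- mons n J k | S u) phi (mondeg u) =
  \sum_(i < k) (count S (mons n J i.+1) - count S (mons n J i)) * phi i)%N.
Proof.
have E (i : 'I_k) : (count S (mons n J i.+1) - count S (mons n J i) =
    count (fun u => S u && (mondeg u == i)) (mons n J k))%N.
  have -> : count S (mons n J i.+1) = (count S (mons n J i) +
      count (fun u => S u && (mondeg u == i)) (mons n J k))%N; last by rewrite addKn.
  have /permP -> := perm_mons (ltnW (ltn_ord i)); have /permP -> := perm_mons (ltn_ord i).
  rewrite !count_filter; elim: (mons n J k) => //= u s ->.
  case: (S u) => //=; have -> : (mondeg u < i.+1)%N = (mondeg u == i) || (mondeg u < i)%N.
    by rewrite ltnS leq_eqVlt.
  by case: eqP => [->|_]; rewrite ?ltnn /=; lia.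
transitivity (\sum_(u <- mons n J k | S u) \sum_(i < k | mondeg u == i) phi i)%N.
  rewrite big_seq_cond [RHS]big_seq_cond; apply: eq_bigr => u; rewrite mem_mons => /andP[uk _].
  rewrite (bigD1 (Ordinal uk)) //= big1 ?addn0 // => i /andP[/eqP ui].
  by rewrite -val_eqE /= ui eqxx.
rewrite (exchange_big_dep xpredT) //=; apply: eq_bigr => i _.
by rewrite E big_const_seq iter_addn addn0 mulnC.
Qed.

Lemma telescope_sub (G : nat -> nat) K L : (L <= K)%N ->
  (forall i j, (i <= j)%N -> (G i <= G j)%N) ->
  (\sum_(s < L) (G (K - s) - G (K - s).-1) = G K - G (K - L))%N.
Proof.
move=> LK mG; elim: L LK => [|L IH] LK; first by rewrite big_ord0 subn0 subnn.
rewrite big_ord_recr /= IH; last exact: ltnW.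
have -> : (K - L).-1 = (K - L.+1)%N by lia.
have := mG (K - L.+1)%N (K - L)%N ltac:(lia); have := mG (K - L)%N K ltac:(lia); lia.
Qed.

End MonomialSums.

Lemma ffun_basis (C : pzRingType) (K : finType) (c : {ffun K -> C^o}) :
  c = \sum_k (c k : C) *: ([ffun k' => (k' == k)%:R] : {ffun K -> C^o}).
Proof.
apply/ffunP => k; rewrite sum_ffunE (bigD1 k) //= !ffunE eqxx [_ *: _]mulr1.
by rewrite big1 ?addr0 // => k' /negPf h; rewrite !ffunE eq_sym h [_ *: _]mulr0.
Qed.

Section LowerBound.
Variables (R : idomainType) (t : R) (n m : nat).
Hypothesis hR : complete_dvr t.
Local Notation A := (pseries R n).
Local Notation B := (pseries R m).
Local Notation C := (pseries R (n + m)).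
Local Notation psX := (@psX R n m).
Local Notation psY := (@psY R n m).
Variables (M : lmodType A) (N : lmodType B).
Variables (I J : finType) (e : I -> M) (f : J -> N) (k : nat).
Hypotheses (he : gens e) (hf : gens f) (fN : fin_gen N).
Local Notation FM := {ffun I -> A^o}.
Local Notation FC := {ffun I * J -> C^o}.

(* A strand X ^ a e_i, indexed by (a, i), carries the monomials t ^ s X ^ a e_i
   for all s. *)
Local Notation Gam := ('X_{1..n < k} * I)%type.
Local Notation G := {ffun Gam -> N}.

Let KM : set FM := comb e @^-1` [set 0].
Let K' : set FM := addset KM (filF t k).
Let pdeg (b : Gam) : nat := mdeg (bmnm b.1).

Let sKM : opsub (fun (c : A) (x : FM) => c *: x) KM.
Proof.
apply: comb_preim_opsub; exact: opsub0.
Qed.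

Let sK' : opsub (fun (c : A) (x : FM) => c *: x) K'.
Proof. by apply: opsub_add => //; [move=> *; apply: scalerDr|apply: filF_opsub]. Qed.

Let pdeg_lt b : (pdeg b < k)%N.
Proof. exact: bmdeg. Qed.

(* On a strand, the leading monomials of K' are the multiples of the least one
   by powers of t; L b is its exponent and lam b an element with that leading
   monomial. *)
Let strand : forall b : Gam, exists Lx : nat * FM,
  [/\ (pdeg b + Lx.1 <= k)%N, K' Lx.2, mge t (Lx.1, bmnm b.1, b.2) Lx.2,
      ~ small t Lx.2 (Lx.1, bmnm b.1, b.2) &
      forall s, inmon t K' (s, bmnm b.1, b.2) -> (Lx.1 <= s)%N].
Proof.
move=> b; pose Q s := `[< inmon t K' (s, bmnm b.1, b.2) >].
have bk := pdeg_lt b.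
have Qk : Q (k - pdeg b)%N.
  apply/asboolP; pose u : mon n I := ((k - pdeg b)%N, bmnm b.1, b.2).
  have uk : mondeg u = k by rewrite /mondeg /= -/(pdeg b); lia.
  exists (monelt t u); split; last exact: monelt_small.
    by apply: (addset_subr sKM); have := mge_filF (@monelt_mge R t n I u); rewrite uk.
  exact: monelt_mge.
have exQ : exists s, Q s by exists (k - pdeg b)%N.
case: (ex_minnP exQ) => L /asboolP[x [Kx gx nx]] Lmin; exists (L, x); split=> //=.
  by have := Lmin _ Qk; lia.
by move=> s hs; apply: Lmin; apply/asboolP.
Qed.

Let Ll := projT1 (choice strand).
Let hL := projT2 (choice strand).
Let L b : nat := (Ll b).1.
Let lam b : FM := (Ll b).2.

(** The image of x (x) y in the sum over the strands of copies of N, the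
    coefficients of x in R acting on y. *)
Definition dot (x : FM) (y : N) : G := [ffun b : Gam => psC ((x b.2 : A) (bmnm b.1)) *: y].

Let actG (r : R) (g : G) : G := [ffun b => psC r *: g b].
Let Ftot : set G := [set g | forall b, mfil N (k - pdeg b) (g b)].

Let actGD r (g g' : G) : actG r (g + g') = actG r g + actG r g'.
Proof. by apply/ffunP => b; rewrite !ffunE scalerDr. Qed.

Let sFtot : opsub actG Ftot.
Proof.
have s b := mfil_opsub N (k - pdeg b); split=> [b|g g' hg hg' b|r g hg b]; rewrite !ffunE.
- by case: (s b).
- exact: (opsubB (s b)).
- by case: (s b) => _ _; apply.
Qed.

Lemma dotBr x y y' : dot x (y - y') = dot x y - dot x y'.
Proof. by apply/ffunP => b; rewrite !ffunE scalerBr. Qed.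

Lemma dotBl x x' y : dot (x - x') y = dot x y - dot x' y.
Proof. by apply/ffunP => b; rewrite !ffunE psBE rmorphB scalerBl. Qed.

Lemma dotZr r x y : dot x (psC r *: y) = actG r (dot x y).
Proof. by apply/ffunP => b; rewrite !ffunE !scalerA mulrC. Qed.

Lemma dotZl r x y : dot (psC r *: x) y = dot x (psC r *: y).
Proof.
apply/ffunP => b; rewrite !ffunE.
have -> : (psC r *: x b.2 : A) (bmnm b.1) = r * (x b.2 : A) (bmnm b.1) by apply: psCmul.
by rewrite rmorphM mulrC scalerA.
Qed.

Lemma dot_filF d x y : (d <= k)%N -> filF t d x -> mfil N (k - d) y -> Ftot (dot x y).
Proof.
move=> dk hx hy b; rewrite ffunE.
have h := mfil_mul hR (@fil_psC R t m _ _ (hx b.2 (bmnm b.1))) hy.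
by apply: (mfil_le hR _ h); rewrite /pdeg; lia.
Qed.

Let Qs (s : seq Gam) : set G := foldr (fun b W => addset W (dot (lam b) @` setT)) Ftot s.

Let sI b : opsub actG (dot (lam b) @` setT).
Proof. exact: (opsub_image (dotBr (lam b)) (fun r y => dotZr r (lam b) y) (opsubT (actR N))). Qed.

Let sQs s : opsub actG (Qs s).
Proof. by elim: s => //= b s IH; apply: opsub_add. Qed.

Let Ftot_Qs s : Ftot `<=` Qs s.
Proof. by elim: s => //= b s IH; apply: subset_trans IH (addset_subl (sI b)). Qed.

Let dot_Qs s b y : b \in s -> Qs s (dot (lam b) y).
Proof.
elim: s => //= b' s IH; rewrite inE => /orP[/eqP <-|bs].
  by apply: (addset_subr (sQs s)); exists y.
exact/(addset_subl (sI b'))/IH.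
Qed.

Let GN := colen (E := N) [set 0].

Let clen_Qs s : exists2 l, (l <= \sum_(b <- s) GN (k - pdeg b - L b))%N & clen actG Ftot (Qs s) l.
Proof.
elim: s => [|b s [l ll cl]] /=; first by exists 0%N => //; apply: clen0.
have [bL Klam glam nlam Lmin] := hL b.
have c := colenP hR fN (k - pdeg b - L b) (opsub0 N); rewrite (addset0 (actR N)) in c.
have [|l' ll' cl'] := clen_image actGD (dotBr (lam b)) (fun r y => dotZr r (lam b) y)
  (opsubR (mfil_opsub N _)) (opsubT _) (sQs s) c.
  move=> _ [y hy <-]; apply: Ftot_Qs; apply: (@dot_filF (pdeg b + L b)) => //.
    by have := mge_filF glam; rewrite /mondeg /= addnC.
  by rewrite subnDA.
exists (l + l')%N; last exact: clen_cat cl cl'.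
by rewrite big_cons addnC leq_add.
Qed.

Let clen_Ftot : clen actG Ftot setT (\sum_(b : Gam) GN (k - pdeg b)).
Proof.
pose W (s : seq Gam) : set G := [set g | forall b, b \notin s -> mfil N (k - pdeg b) (g b)].
have sW s : opsub actG (W s).
  have h b := mfil_opsub N (k - pdeg b); split=> [b bs|g g' hg hg' b bs|r g hg b bs]; rewrite !ffunE.
  - by case: (h b).
  - by apply: (opsubB (h b)); [apply: hg|apply: hg'].
  - by case: (h b) => _ _; apply; apply: hg.
have main s : uniq s -> clen actG Ftot (W s) (\sum_(b <- s) GN (k - pdeg b)).
  elim: s => [_|b s IH /= /andP[bs us]].
    rewrite big_nil; have -> : W [::] = Ftot; last exact: clen0.
    by apply/seteqP; split=> g hg b; [apply: hg|move=> _; apply: hg].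
  rewrite big_cons addnC; apply: clen_cat (IH us) _.
  have c := colenP hR fN (k - pdeg b) (opsub0 N); rewrite (addset0 (actR N)) in c.
  have evB (g g' : G) : (g - g') b = g b - g' b by rewrite !ffunE.
  have evZ r (g : G) : (actG r g) b = actR N r (g b) by rewrite ffunE.
  have := clen_preim evB evZ (sW (b :: s)) (opsubR (mfil_opsub N _)) (opsubT _) _ c.
  have -> : W (b :: s) `&` (fun g : G => g b) @^-1` mfil N (k - pdeg b) = W s.
    apply/seteqP; split=> [g [hg gb] b' bs'|g hg].
      have [->//|bb] := eqVneq b' b; by apply: hg; rewrite inE negb_or bb.
    by split=> [b'|]; [rewrite inE negb_or => /andP[_]; apply: hg|apply: hg].
  have -> : W (b :: s) `&` (fun g : G => g b) @^-1` setT = W (b :: s) by rewrite preimage_setT setIT.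
  apply=> y _; exists [ffun b' => if b' == b then y else 0]; last by rewrite ffunE eqxx.
  move=> b'; rewrite inE negb_or => /andP[/negPf bb _]; rewrite ffunE bb.
  by case: (mfil_opsub N (k - pdeg b')).
have := main (enum {: Gam}) (enum_uniq _); rewrite big_enum /=.
suff -> : W (enum {: Gam}) = setT by [].
by apply/seteqP; split=> // g _ b; rewrite mem_enum.
Qed.

Let Q := Qs (enum {: Gam}).
Let sQ : opsub actG Q := sQs _.
Let dotQ b y : Q (dot (lam b) y).
Proof. by apply: dot_Qs; rewrite mem_enum. Qed.

(* Division by the lam b removes the leading monomials of x one by one: only
   powers of t are needed as multipliers, and these move across to y. *)
Let dot_K' x y : K' x -> Q (dot x y).
Proof.
move=> Kx; have [l il pl] := initial_mons n I k.
have lk u : u \in l -> (mondeg u < k)%N by rewrite (perm_mem pl) mem_mons.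
suff [x' [Kx' sx' dx']] : exists x', [/\ K' x', smallon t l x' & Q (dot x y - dot x' y)].
  rewrite -(subrK (dot x' y) (dot x y)); apply: (opsubD sQ) => //; apply: Ftot_Qs.
  apply: (@dot_filF k) => //; last by rewrite subnn (mfil0 hR).
  by rewrite -(@smallon_mons _ t _ _ k l) //; apply: perm_mem.
elim: il lk => {l pl} [|l u il IH lu] lk.
  by exists x; split=> //; rewrite subrr; case: sQ.
have [|x1 [Kx1 sx1 dx1]] := IH; first by move=> v vl; apply: lk; rewrite mem_rcons inE vl orbT.
have gx1 : mge t u x1 by move=> v vu; apply: sx1; rewrite lu.
case: (EM (small t x1 u)) => su.
  by exists x1; split=> // v; rewrite mem_rcons inE => /orP[/eqP -> //|]; apply: sx1.
have uk : (mondeg u < k)%N by apply: lk; rewrite mem_rcons inE eqxx.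
have ak : (mdeg u.1.2 < k)%N by move: uk; rewrite /mondeg; lia.
pose b : Gam := (BMultinom ak, u.2).
have [bL Klam glam nlam Lmin] := hL b.
have uu : (u.1.1, bmnm b.1, b.2) = u by rewrite /b /=; case: (u) => [[]].
have Lu : (L b <= u.1.1)%N by apply: Lmin; rewrite uu; exists x1.
pose c : A := psC (t ^+ (u.1.1 - L b)) * psmono 0%MM.
have uE : u = monmul (u.1.1 - L b) 0%MM (L b, bmnm b.1, b.2).
  by rewrite -[LHS]uu /monmul /= subnK // add0m.
have gy : mge t u (c *: lam b) by rewrite {1}uE; apply: monmul_mge.
have ny : ~ small t (c *: lam b) u by rewrite uE monmul_small.
have [r [gr sr]] := mge_reduce hR gy gx1 ny.
have cE : c = psC (t ^+ (u.1.1 - L b)) by rewrite /c psmono0 mulr1.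
exists (x1 - psC r *: (c *: lam b)); split.
- by apply: (opsubB sK') => //; have [_ _ Z] := sK'; apply: (Z (psC r)); apply: (Z c).
- by move=> v; rewrite mem_rcons inE => /orP[/eqP -> //|]; rewrite lu; apply: gr.
- rewrite dotBl opprB addrCA addrC; apply: (opsubD sQ) => //.
  by rewrite cE !dotZl; apply: dotQ.
Qed.

(** The surjection from the free module over C onto the sum of the copies of N;
    modulo the relations of M it factors through the tensor product. *)
Definition cpsi (c : FC) : G :=
  [ffun b : Gam => \sum_j slice (c (b.2, j) : C) (bmnm b.1) *: f j].

Lemma cpsiB c c' : cpsi (c - c') = cpsi c - cpsi c'.
Proof.
apply/ffunP => b; rewrite !ffunE -sumrB; apply: eq_bigr => j _.
by rewrite !ffunE -scalerBl.
Qed.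

Lemma cpsiZ r c : cpsi (psC r *: c) = actG r (cpsi c).
Proof.
apply/ffunP => b; rewrite !ffunE scaler_sumr; apply: eq_bigr => j _.
rewrite scalerA ffunE; congr (_ *: _); exact: slice_psC.
Qed.

Let cpsi_fil c : filF t k c -> Ftot (cpsi c).
Proof.
move=> hc b; rewrite ffunE; have s := mfil_opsub N (k - pdeg b).
elim/big_ind: _ => [|x y|j _]; first by case: s.
  exact: (opsubD s).
exact/(mfilZ hR)/fil_slice/hc.
Qed.

Lemma cpsi_surj g : exists c, cpsi c = g.
Proof.
have /choice[v hv] : forall b : Gam, exists y, g b = comb f y by move=> b; apply: hf.
have [kk|kpos] := leqP k 0.
  by exists 0; apply/ffunP => b; exfalso; have := pdeg_lt b; lia.
have k0 : (mdeg (0%MM : 'X_{1..n}) < k)%N by rewrite mdeg0.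
pose c (ij : I * J) : C := fun l =>
  (v (insubd (BMultinom k0) (mleft l), ij.1) ij.2 : B) (mright l).
exists [ffun ij => c ij : C^o]; apply/ffunP => b; rewrite ffunE hv /comb.
apply: eq_bigr => j _; congr (_ *: _); rewrite ffunE /slice /c; apply: funext => g'.
rewrite mjoinLK mjoinRK /=; suff -> : insubd (BMultinom k0) (bmnm b.1) = b.1 by case: b.
by apply/eqP; rewrite bmeqP /= val_insubd bmdeg.
Qed.

Let sumQ (D : finType) (Pd : pred D) (F : D -> G) : (forall d, Q (F d)) -> Q (\sum_(d | Pd d) F d).
Proof.
move=> h; elim/big_ind: _ => [|x y|d _]; [by case: sQ|exact: (opsubD sQ)|exact: h].
Qed.

(* Slicing expresses a C-multiple of the relation a by the A-multiples
   X ^ d a, which are relations again. *)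
Let cpsi_relM (a : FM) (v : J -> C) : K' a ->
  Q (cpsi [ffun ij => psX (a ij.1 : A) * v ij.2 : C^o]).
Proof.
move=> Ka.
have -> : cpsi [ffun ij => psX (a ij.1 : A) * v ij.2 : C^o] =
   \sum_(d : 'X_{1..n < k}) dot (psmono d *: a) (\sum_j slice (v j) d *: f j).
  apply/ffunP => b; rewrite sum_ffunE ffunE.
  transitivity (\sum_j \sum_(d : 'X_{1..n < k}) psC ((psmono d * (a b.2 : A)) (bmnm b.1)) *: (slice (v j) d *: f j)).
    apply: eq_bigr => j _; rewrite ffunE /= mulrC (slice_mulX _ _ (bmdeg b.1)) scaler_suml.
    rewrite big_mkcond; apply: eq_bigr => d _; rewrite psmonoE.
    by case: ifP => _; rewrite ?raddf0 ?scale0r // scalerA.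
  rewrite exchange_big; apply: eq_bigr => d _; rewrite ffunE scaler_sumr.
  by apply: eq_bigr => j _; rewrite ffunE.
by apply: sumQ => d; apply: dot_K'; have [_ _ Z] := sK'; apply: Z.
Qed.

(* A relation of N dies on each strand separately. *)
Let cpsi_relN (u : I -> C) b : comb f b = 0 ->
  cpsi [ffun ij => u ij.1 * psY (b ij.2 : B) : C^o] = 0.
Proof.
move=> b0; apply/ffunP => g; rewrite !ffunE.
transitivity (slice (u g.2) (bmnm g.1) *: comb f b); last by rewrite b0 scaler0.
rewrite /comb scaler_sumr; apply: eq_bigr => j _.
by rewrite ffunE /= slice_mulY scalerA.
Qed.

Let S' : {pred FC} := fun c => `[< forall d : C, Q (cpsi (d *: c)) >].

Let sS' : GRing.submod_closed S'.
Proof.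
split=> [|a c c' /asboolP hc /asboolP hc']; apply/asboolP => d.
  by rewrite scaler0 (opm0 cpsiB); case: sQ.
by rewrite scalerDr scalerA (opmD cpsiB); apply: (opsubD sQ).
Qed.

Let relM_S' a (v : J -> C) : K' a -> [ffun ij => psX (a ij.1 : A) * v ij.2 : C^o] \in S'.
Proof.
move=> Ka; apply/asboolP => d.
have -> : d *: [ffun ij => psX (a ij.1 : A) * v ij.2 : C^o] =
    [ffun ij => psX (a ij.1 : A) * (d * v ij.2) : C^o] :> FC.
  by apply/ffunP => ij; rewrite !ffunE; apply: mulrCA.
exact: (cpsi_relM (fun j => d * v j)).
Qed.

Let relN_S' (u : I -> C) b : comb f b = 0 -> [ffun ij => u ij.1 * psY (b ij.2 : B) : C^o] \in S'.
Proof.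
move=> b0; apply/asboolP => d.
have -> : d *: [ffun ij => u ij.1 * psY (b ij.2 : B) : C^o] =
    [ffun ij => (d * u ij.1) * psY (b ij.2 : B) : C^o] :> FC.
  by apply/ffunP => ij; rewrite !ffunE; apply: mulrA.
by rewrite (cpsi_relN (fun i => d * u i)) //; case: sQ.
Qed.

Let KP : set FC := comb (ctgen e f) @^-1` [set 0].

(* By the universal property the projection modulo S' factors through comb, so
   that all relations between the generators lie in S'. *)
Let KP_S' c : KP c -> c \in S'.
Proof.
have /choice[xh hxh] : forall x : M, exists a, x = comb e a by exact: he.
have /choice[yh hyh] : forall y : N, exists b, y = comb f b by exact: hf.
pose T0 := quot_mod [set x | x \in S'].
have spanS : {subset Defs.span [set x | x \in S'] <= S'} by apply: span_min.
pose pi : FC -> T0 := quot_pi [set x | x \in S'].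
have piE x y : x - y \in S' -> pi x = pi y.
  by move=> hxy; apply/eqP; rewrite quot_pi_eq; apply: span_sub.
have piD x y : pi (x + y) = pi x + pi y by apply: quot_piD.
have piZ (a : C) x : pi (a *: x) = a *: pi x by rewrite /pi linearZ.
pose kap (a : FM) (b : {ffun J -> B^o}) : FC := [ffun ij => psX (a ij.1 : A) * psY (b ij.2 : B) : C^o].
have kapl a a' b : comb e a = comb e a' -> pi (kap a b) = pi (kap a' b).
  move=> aa; apply: piE; have -> : kap a b - kap a' b = kap (a - a') b.
    by apply/ffunP => ij; rewrite !ffunE rmorphB mulrBl.
  apply: (relM_S' (fun j => psY (b j : B))); apply: (addset_subl (@filF_opsub R t n I k)).
  by rewrite /KM /= combB aa subrr.
have kapr a b b' : comb f b = comb f b' -> pi (kap a b) = pi (kap a b').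
  move=> bb; apply: piE; have -> : kap a b - kap a b' = kap a (b - b').
    by apply/ffunP => ij; rewrite !ffunE rmorphB mulrBr.
  by apply: (relN_S' (fun i => psX (a i : A))); rewrite combB bb subrr.
pose beta x y : T0 := pi (kap (xh x) (yh y)).
have bDl x x' y : beta (x + x') y = beta x y + beta x' y.
  rewrite /beta -piD (kapl _ (xh x + xh x')); last by rewrite (opmD (combB e)) -!hxh.
  by congr pi; apply/ffunP => ij; rewrite !ffunE rmorphD mulrDl.
have bDr x y y' : beta x (y + y') = beta x y + beta x y'.
  rewrite /beta -piD (kapr _ _ (yh y + yh y')); last by rewrite (opmD (combB f)) -!hyh.
  by congr pi; apply/ffunP => ij; rewrite !ffunE rmorphD mulrDr.
have bZl a x y : beta (a *: x) y = psX a *: beta x y.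
  rewrite /beta -piZ (kapl _ (a *: xh x)); last by rewrite combZ -!hxh.
  by congr pi; apply/ffunP => ij; rewrite !ffunE rmorphM -mulrA.
have bZr b x y : beta x (b *: y) = psY b *: beta x y.
  rewrite /beta -piZ (kapr _ _ (b *: yh y)); last by rewrite combZ -!hyh.
  by congr pi; apply/ffunP => ij; rewrite !ffunE rmorphM mulrCA.
have [theta [lth thE]] := ctensor_lift bDl bDr bZl bZr.
have thg ij : theta (ctgen e f ij) = pi [ffun ij' => (ij' == ij)%:R].
  rewrite thE /beta (kapl _ [ffun i => (i == ij.1)%:R]); last by rewrite -hxh comb_delta.
  rewrite (kapr _ _ [ffun j => (j == ij.2)%:R]); last by rewrite -hyh comb_delta.
  congr pi; apply/ffunP => -[i j]; case: ij => i0 j0; rewrite !ffunE /= !rmorph_nat -natrM mulnb.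
  by [].
move=> c0; apply: spanS; suff /eqP : pi c = 0.
  by rewrite -(opm0 (quot_piB [set x | x \in S'])) quot_pi_eq subr0.
have pi0 : pi 0 = 0 by apply: (opm0 (quot_piB _)).
have -> : pi c = \sum_ij (c ij : C) *: pi [ffun ij' => (ij' == ij)%:R].
  transitivity (pi (\sum_ij (c ij : C) *: ([ffun ij' => (ij' == ij)%:R] : FC))).
    by congr pi; apply: ffun_basis.
  by apply: (etrans (big_morph pi piD pi0 _ _ _)); apply: eq_bigr => ij _; apply: piZ.
transitivity (theta (comb (ctgen e f) c)); last by rewrite c0 (lin0 lth).
rewrite /comb (lin_sum lth); apply: eq_bigr => ij _.
by rewrite (linZ lth) thg.
Qed.

(** The Euler characteristic estimate: modulo m ^ k, the tensor product is
    the sum over the strands of N / m ^ (k - deg b) N, modulo one relation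
    lam b (x) y for each strand, which kills y of order k - deg b - L b. *)
Lemma strand_bound p : clen (fun (r : R) (x : FC) => psC r *: x) (addset KP (filF t k)) setT p ->
  (\sum_(b : Gam) GN (k - pdeg b) <= \sum_(b : Gam) GN (k - pdeg b - L b) + p)%N.
Proof.
move=> cp; have [l ll cl] := clen_Qs (enum {: Gam}).
have sKP : opsub (fun (c : C) (x : FC) => c *: x) KP.
  apply: comb_preim_opsub; exact: opsub0.
have sU := opsub_restrict (opsub_add (fun c x y => scalerDr c x y) sKP (@filF_opsub R t _ _ k)).
have [|l' l'p cl'] := clen_image actGD cpsiB cpsiZ sU (opsubT _) sQ cp.
  move=> _ [_ [x [y [Kx fy ->]]] <-]; rewrite (opmD cpsiB); apply: (opsubD sQ).
    by have /asboolP/(_ 1) := KP_S' Kx; rewrite scale1r.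
  exact/Ftot_Qs/cpsi_fil.
have E : addset Q [set cpsi x | x in [set: FC]] = setT.
  apply/seteqP; split=> // g _; have [c <-] := cpsi_surj g.
  by apply: (addset_subr sQ); exists c.
rewrite E in cl'.
have -> := clen_uniq actGD sFtot (opsubT _) clen_Ftot (clen_cat cl cl').
by apply: leq_add => //; rewrite big_enum in ll.
Qed.

Let std_strand (u : mon n I) (uk : (mondeg u < k)%N) (ak : (mdeg u.1.2 < k)%N) :
  stdmon t KM u -> (u.1.1 < L (BMultinom ak, u.2))%N.
Proof.
move=> /asboolP nu; rewrite ltnNge; apply/negP => Lu; apply: nu.
set b : Gam := (BMultinom ak, u.2) in Lu.
have [bL Klam glam nlam _] := hL b.
have uE : u = monmul (u.1.1 - L b) 0%MM (L b, bmnm b.1, b.2).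
  by rewrite /monmul /= subnK // add0m; case: (u) => [[]].
have [x [[y [z [KMy fz xE]]] gx nx]] : inmon t K' u.
  by rewrite uE; apply: (inmonM hR) => //; exists (lam b).
have small_z v : (mondeg v < k)%N -> small t z v.
  have [l _ pl] := initial_mons n I k; move=> vk.
  have := fz; rewrite -(@smallon_mons _ t _ _ k l); last exact: perm_mem.
  by apply; rewrite (perm_mem pl) mem_mons.
have yE : y = x - z by rewrite xE addrK.
exists y; split=> //.
  move=> v vu; rewrite yE; apply: smallB; first exact: gx.
  by apply: small_z; apply: leq_ltn_trans uk; apply: mlt_le_deg.
move=> sy; apply: nx; rewrite xE -[z]opprK; apply: smallB => //.
by rewrite -sub0r; apply: smallB; [exact: small0|exact: small_z].
Qed.

(** A standard monomial on the strand b has exponent s < L b, and the loss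
    G (k - deg b) - G (k - deg b - L b) along it telescopes into one term for
    each such s. *)
Theorem colen_tensor_ge : fin_gen M ->
  (\sum_(i < k) (colen (E := M) [set 0%R] i.+1 - colen (E := M) [set 0%R] i) *
     (colen (E := N) [set 0%R] (k - i) - colen (E := N) [set 0%R] (k - i).-1) <=
   colen (E := (ctensor M N : lmodType C)) [set 0%R] k)%N.
Proof.
move=> fM; pose phi i := (GN (k - i) - GN (k - i).-1)%N.
have mG i j : (i <= j)%N -> (GN i <= GN j)%N.
  by apply: (colen_mono hR fN); [exact: opsub0|exact: opsub0|].
have sKP : opsub (fun (c : C) (x : FC) => c *: x) KP by apply: comb_preim_opsub; exact: opsub0.
have gP := ct_gens he hf; have fP := gens_fin_gen gP.
have [_ cp] := clen_hs hR k sKP; have := strand_bound cp.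
rewrite -(colen_hs hR fP k gP (opsub0 _)) => bound.
apply: (@leq_trans (\sum_(b : Gam) \sum_(s < L b) phi (pdeg b + s))); last first.
  rewrite -(leq_add2l (\sum_(b : Gam) GN (k - pdeg b - L b))); apply: leq_trans bound.
  rewrite -big_split; apply: leq_sum => b _; have [bL _ _ _ _] := hL b.
  have -> : (\sum_(s < L b) phi (pdeg b + s) = GN (k - pdeg b) - GN (k - pdeg b - L b))%N.
    rewrite -telescope_sub //; last by rewrite -/(L b) in bL; lia.
    by apply: eq_bigr => s _; rewrite /phi subnDA.
  by rewrite /= subnKC // mG // leq_subr.
under eq_bigr do rewrite !(colen_hs hR fM _ he (opsub0 M)).
rewrite -[X in (X <= _)%N](sum_mons (stdmon t KM) phi k).
pose g (x : (Gam * 'I_k)%type) : mon n I := (x.2 : nat, bmnm x.1.1, x.1.2).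
have g_inj : injective g.
  move=> [[a i] s] [[a' i'] s'] [ss aa ii]; congr (_, _, _) => //; exact: val_inj.
pose below (x : (Gam * 'I_k)%type) := (x.2 < L x.1)%N.
pose r := map g (seq.filter below (enum {: (Gam * 'I_k)%type})).
apply: (@leq_trans (\sum_(u <- r) phi (mondeg u))).
  rewrite -big_filter; apply: (@uniq_sub_le_big _ addn leq leqnn (fun x y => leq_addr y x)).
  - exact/filter_uniq/uniq_mons.
  - by rewrite map_inj_uniq // filter_uniq // enum_uniq.
  move=> u; rewrite mem_filter mem_mons => /andP[su uk].
  have ak : (mdeg u.1.2 < k)%N by move: uk; rewrite /mondeg; lia.
  have sk : (u.1.1 < k)%N by move: uk; rewrite /mondeg; lia.
  apply/mapP; exists ((BMultinom ak, u.2), Ordinal sk); last by case: (u) ak sk => [[]].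
  by rewrite mem_filter mem_enum andbT; apply: std_strand.
rewrite big_map big_filter big_enum_cond /=.
rewrite [X in (_ <= X)%N](_ : _ = \sum_(b : Gam) \sum_(s < k | (s < L b)%N) phi (pdeg b + s)); last first.
  apply: eq_bigr => b _; have [bL _ _ _ _] := hL b.
  by rewrite (big_ord_widen_cond k xpredT (fun s => phi (pdeg b + s)%N)) //; rewrite -/(L b) in bL; lia.
rewrite pair_big_dep /=; apply/eq_leq/eq_bigr => -[b s] _.
by rewrite /mondeg /= addnC.
Qed.

End LowerBound.

(** * Convolutions and leading coefficients *)

Section Convolution.

Lemma sum_bin_shift d k : (\sum_(j < k.+1) 'C(j + d, d) = 'C(k + d.+1, d.+1))%N.
Proof.
elim: k => [|k IH]; first by rewrite big_ord1 add0n !binn.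
by rewrite big_ord_recr IH /= [(k.+1 + d.+1)%N]addnS binS addSnnS.
Qed.

(** Vandermonde's identity, for the upper index. *)
Lemma conv_bin k a b : (\sum_(i < k.+1) 'C(i, a) * 'C(k - i, b) = 'C(k.+1, (a + b).+1))%N.
Proof.
elim: k b => [|k IH] b.
  by rewrite big_ord1 subnn binS !bin0n addn_eq0; case: a b => [|a] [|b].
rewrite big_ord_recr /= subnn; case: b => [|b].
  rewrite (eq_bigr (fun i : 'I_k.+1 => 'C(i, a) * 'C(k - i, 0))%N); last first.
    by move=> i _; rewrite !bin0.
  by rewrite IH !addn0 bin0 muln1 [in RHS]binS.
rewrite bin0n muln0 addn0.
transitivity (\sum_(i < k.+1) 'C(i, a) * 'C(k - i, b.+1) + \sum_(i < k.+1) 'C(i, a) * 'C(k - i, b))%N.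
  rewrite -big_split /=; apply: eq_bigr => i _; rewrite -mulnDr subSn ?binS //.
  by rewrite -ltnS.
by rewrite !IH addnS -binS.
Qed.

Lemma ffact_le_exp x m : (x ^_ m <= x ^ m)%N.
Proof.
elim: m => [|m IH]; first by rewrite ffactn0.
by rewrite ffactnSr expnSr leq_mul // leq_subr.
Qed.

Lemma bin_le_exp x m : ('C(x, m) <= x ^ m)%N.
Proof.
apply: leq_trans (ffact_le_exp x m); rewrite -bin_ffact.
by rewrite leq_pmulr // fact_gt0.
Qed.

Lemma exp_le_ffact y m : (y ^ m <= (y + m) ^_ m)%N.
Proof.
elim: m => [|m IH]; first by rewrite ffactn0.
by rewrite addnS ffactSS expnS leq_mul //; lia.
Qed.

Lemma exp_add_le c E : exists X, forall y, (0 < y)%N ->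
  ((y + c) ^ E.+1 <= y ^ E.+1 + X * y ^ E)%N.
Proof.
elim: E => [|E [X hX]]; first by exists c => y _; rewrite !expn1 expn0; lia.
exists (c + X * c.+1)%N => y y0; rewrite expnS; apply: leq_trans (leq_mul (leqnn _) (hX y y0)) _.
have : (c * (X * y ^ E) <= X * c * y ^ E.+1)%N.
  by rewrite [(y ^ E.+1)%N]expnS; nia.
rewrite !expnS; nia.
Qed.


Variable K : realType.
Implicit Types (f g : nat -> K).

Definition conv f g k : K := \sum_(i < k.+1) f i * g (k - i)%N.
Definition cum f k : K := \sum_(i < k.+1) f i.

Lemma convC f g k : conv f g k = conv g f k.
Proof.
rewrite /conv (reindex_inj rev_ord_inj) /=; apply: eq_bigr => i _.
by rewrite subSS mulrC subKn // -ltnS.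
Qed.

Lemma cumS f k : cum f k.+1 = cum f k + f k.+1.
Proof. by rewrite /cum big_ord_recr. Qed.

Lemma cum_conv f g k : cum (conv f g) k = conv f (cum g) k.
Proof.
elim: k => [|k IH]; first by rewrite /cum /conv !big_ord1.
rewrite cumS IH /conv [in RHS]big_ord_recr [in X in _ + X]big_ord_recr /= subnn.
rewrite addrA -big_split /=; congr (_ + _ * _); last by rewrite /cum big_ord1.
apply: eq_bigr => i _; rewrite -mulrDr; congr (_ * _).
have ik : (i <= k)%N by rewrite -ltnS.
by rewrite subSn // cumS.
Qed.

Lemma ler_cum f g k : (forall i, f i <= g i) -> cum f k <= cum g k.
Proof. by move=> h; apply: ler_sum. Qed.

(** Summing twice turns the convolution of the increments of F and G into the
    convolution of F and G, which can be compared with binomial coefficients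
    by Vandermonde's identity; the leading terms in k ^ (d + 2) remain. *)
Lemma conv_leading (F G p : nat -> nat) a b d (al be ga : K) k0 k1 :
  (forall k, (\sum_(i < k) (F i.+1 - F i) * (G (k - i) - G (k - i).-1) <= p k)%N) ->
  F 0%N = 0%N -> G 0%N = 0%N ->
  (forall i j, (i <= j)%N -> (F i <= F j)%N) -> (forall i j, (i <= j)%N -> (G i <= G j)%N) ->
  0 <= al -> 0 <= be -> 0 <= ga ->
  (forall i, (k0 <= i)%N -> al * 'C(i, a)%:R <= (F i.+1)%:R) ->
  (forall i, (k0 <= i)%N -> be * 'C(i, b)%:R <= (G i.+1)%:R) ->
  (forall i, (k1 <= i)%N -> (p i.+1)%:R <= ga * 'C(i + d, d)%:R) ->
  d.+1 = (a + b)%N -> al * be <= ga.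
Proof.
move=> hp F0 G0 mF mG al0 be0 ga0 hF hG hpu dab.
pose f i : K := (F i.+1 - F i)%:R; pose g i : K := (G i.+1 - G i)%:R.
pose A i : K := (F i.+1)%:R; pose B i : K := (G i.+1)%:R.
have cumE (H : nat -> nat) : H 0%N = 0%N -> (forall i j, (i <= j)%N -> (H i <= H j)%N) ->
    forall k, cum (fun i => (H i.+1 - H i)%:R) k = (H k.+1)%:R.
  move=> H0 mH; elim=> [|k IH]; first by rewrite /cum big_ord1 H0 subn0.
  by rewrite cumS IH -natrD addnC subnK // mH.
have pf k : conv f g k <= (p k.+1)%:R.
  apply: le_trans (_ : ((\sum_(i < k.+1) (F i.+1 - F i) * (G (k.+1 - i) - G (k.+1 - i).-1))%N)%:R <= _).
    rewrite natr_sum; apply: ler_sum => i _; rewrite natrM subSn //.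
    by rewrite -ltnS.
  by rewrite ler_nat.
have lower k : conv A B k <= cum (cum (fun i => (p i.+1)%:R)) k.
  have -> : conv A B k = cum (cum (conv f g)) k.
    have -> : cum (cum (conv f g)) k = cum (conv (cum g) f) k.
      by apply: eq_bigr => i _; rewrite cum_conv convC.
    rewrite cum_conv convC; apply: eq_bigr => i _.
    by rewrite /f /g !cumE.
  by apply: ler_cum => i; apply: ler_cum.
pose P1 : K := \sum_(j < k1) (p j.+1)%:R.
have P10 : 0 <= P1 by apply: sumr_ge0.
have ind k c : \sum_(i < k.+1) ((i < c)%N%:R : K) <= c%:R.
  rewrite -natr_sum ler_nat; elim: k => [|k IH]; first by rewrite big_ord1; case: c.
  have : (\sum_(i < k.+2) (i < c) <= minn k.+2 c)%N.
    elim: (k.+2) => [|l IHl]; first by rewrite big_ord0.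
    by rewrite big_ord_recr /=; move: IHl; case: (ltnP l c) => /=; lia.
  by move/leq_trans; apply; apply: geq_minr.
have pup i : (p i.+1)%:R <= ga * 'C(i + d, d)%:R + P1 * (i < k1)%N%:R.
  case: (ltnP i k1) => ik; last by rewrite mulr0 addr0; apply: hpu.
  rewrite mulr1 -[leLHS]add0r; apply: lerD; first by rewrite mulr_ge0.
  by rewrite /P1 (bigD1 (Ordinal ik)) //= lerDl sumr_ge0.
have up1 l : cum (fun i => (p i.+1)%:R) l <= ga * 'C(l + d.+1, d.+1)%:R + P1 * k1%:R.
  apply: le_trans (ler_cum _ pup) _; rewrite /cum big_split /= -!mulr_sumr.
  apply: lerD; last by rewrite ler_wpM2l // ind.
  by rewrite -natr_sum sum_bin_shift.
have up2 k : cum (cum (fun i => (p i.+1)%:R)) k <=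
    ga * 'C(k + d.+2, d.+2)%:R + P1 * k1%:R * k.+1%:R.
  apply: le_trans (ler_cum _ up1) _; rewrite /cum big_split /= -mulr_sumr.
  apply: lerD; first by rewrite -natr_sum sum_bin_shift.
  by rewrite sumr_const card_ord -[leLHS]mulr_natr.
have low2 k : al * be * 'C(k.+1, d.+2)%:R <= conv A B k + 2 * k0%:R * (al * be * (k ^ d.+1)%:R).
  rewrite dab -conv_bin natr_sum mulr_sumr.
  apply: le_trans (_ : \sum_(i < k.+1) (A i * B (k - i)%N +
      ((i < k0)%N%:R + (k - i < k0)%N%:R) * (al * be * (k ^ (a + b))%:R)) <= _).
    apply: ler_sum => i _; rewrite natrM mulrACA.
    have ik : (i <= k)%N by rewrite -ltnS.
    have e0 : 0 <= al * be * (k ^ (a + b))%:R by rewrite !mulr_ge0.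
    have triv : al * 'C(i, a)%:R * (be * 'C(k - i, b)%:R) <= al * be * (k ^ (a + b))%:R.
      rewrite mulrACA expnD natrM ler_wpM2l ?mulr_ge0 // ler_pM // ler_nat.
        by apply: leq_trans (bin_le_exp _ _) _; apply: leq_expl.
      by apply: leq_trans (bin_le_exp _ _) _; apply: leq_expl; apply: leq_subr.
    have AB0 : 0 <= A i * B (k - i)%N by rewrite mulr_ge0.
    case: (ltnP i k0) => ik0.
      apply: le_trans triv _; rewrite -[leLHS]add0r lerD // mulrDl mul1r lerDl.
      by rewrite mulr_ge0.
    case: (ltnP (k - i) k0) => jk0.
      by apply: le_trans triv _; rewrite add0r mul1r lerDr.
    by rewrite addr0 mul0r addr0; apply: ler_pM => //; rewrite ?mulr_ge0 ?hF ?hG.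
  rewrite big_split /= lerD2l -mulr_suml ler_wpM2r ?mulr_ge0 //.
  rewrite big_split /= [2]mulr2n mulrDl mul1r; apply: lerD; first exact: ind.
  rewrite (reindex_inj rev_ord_inj) /=; apply: le_trans (ind k k0).
  by apply: ler_sum => i _; rewrite subSS subKn // -ltnS.
pose E := d.+2.
have [X hX] := exp_add_le (2 * E) d.+1.
pose M' : K := ga * X%:R + E`!%:R * (P1 * k1%:R * E.+1%:R + 2 * k0%:R * (al * be * (E.+1 ^ d.+1)%:R)).
have key y : (0 < y)%N -> al * be * (y ^ E)%:R <= ga * (y ^ E)%:R + M' * (y ^ d.+1)%:R.
  move=> y0; pose k := (y + d.+1)%N.
  have kE : k.+1 = (y + E)%N by rewrite /k /E !addnS.
  have h := le_trans (low2 k) (lerD (le_trans (lower k) (up2 k)) (lexx _)).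
  have hE : E`!%:R * (al * be * 'C(k.+1, E)%:R) <= E`!%:R * (ga * 'C(k + E, E)%:R +
      P1 * k1%:R * k.+1%:R + 2 * k0%:R * (al * be * (k ^ d.+1)%:R)).
    by rewrite ler_wpM2l.
  have l1 : al * be * (y ^ E)%:R <= E`!%:R * (al * be * 'C(k.+1, E)%:R).
    rewrite mulrCA ler_wpM2l ?mulr_ge0 // -natrM ler_nat mulnC bin_ffact kE.
    exact: exp_le_ffact.
  apply: le_trans l1 (le_trans hE _).
  have u1 : E`!%:R * (ga * 'C(k + E, E)%:R) <= ga * (y ^ E)%:R + ga * X%:R * (y ^ d.+1)%:R.
    rewrite mulrCA -mulrA -mulrDr ler_wpM2l // -!natrM -natrD ler_nat mulnC bin_ffact.
    apply: leq_trans (ffact_le_exp _ _) _; apply: leq_trans (hX y y0).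
    by apply: leq_expl; rewrite /k /E; lia.
  set Q1 := P1 * k1%:R; set Q2 := 2 * k0%:R * (al * be).
  have Q10 : 0 <= Q1 by rewrite mulr_ge0.
  have Q20 : 0 <= Q2 by rewrite !mulr_ge0.
  have -> : ga * (y ^ E)%:R + M' * (y ^ d.+1)%:R = ga * (y ^ E)%:R + ga * X%:R * (y ^ d.+1)%:R +
      E`!%:R * (Q1 * (E.+1%:R * (y ^ d.+1)%:R) + Q2 * ((E.+1 ^ d.+1)%:R * (y ^ d.+1)%:R)).
    by rewrite /M' /Q1 /Q2; move: (_%:R) (_%:R) (_%:R) => *; ring.
  rewrite [2 * _ * _]mulrA -/Q2 -addrA mulrDr; apply: lerD u1 _.
  rewrite ler_wpM2l //; apply: lerD; rewrite ler_wpM2l // -natrM ler_nat.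
    rewrite kE expnS; have : (0 < y ^ d)%N by rewrite expn_gt0 y0.
    by rewrite /E; nia.
  by rewrite -expnMn; apply: leq_expl; rewrite /k /E; nia.
rewrite leNgt; apply/negP => lt.
have M0 : 0 <= M' by rewrite addr_ge0 ?mulr_ge0 ?addr_ge0 ?mulr_ge0.
have q0 : 0 <= M' / (al * be - ga) by rewrite divr_ge0 // subr_ge0 ltW.
have := archi_boundP q0; set y := Num.Def.archi_bound _ => hy.
have y0 : (0 < y)%N by rewrite -(ltr_nat K); apply: le_lt_trans hy.
have := key y y0; rewrite -lerBlDl -mulrBl [(y ^ E)%N]expnS natrM mulrA.
rewrite ler_pM2r ?ltr0n ?expn_gt0 ?y0 // leNgt => /negP; apply.
by rewrite mulrC -ltr_pdivrMr ?subr_gt0.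
Qed.

End Convolution.

(** * Existence and value of the multiplicity *)

Section Limits.
Variable K : realType.
Implicit Types (f : nat -> int) (h : nat -> nat).

Lemma delta_bin e k : delta (fun k => 'C(k, e.+1)%:Z) k = 'C(k, e)%:Z.
Proof. by rewrite /delta binS PoszD addrAC subrr add0r. Qed.

Lemma iter_delta_bin e k : iter e delta (fun k => 'C(k, e)%:Z) k = 1.
Proof.
elim: e k => [|e IH] k; first by rewrite /= bin0.
rewrite iterSr -[RHS](IH k).
by apply: (@iter_delta_ext _ _ _ 0%N) => // i _; apply: delta_bin.
Qed.

Lemma iter_deltaZ e (c : int) f k :
  iter e delta (fun k => c * f k) k = c * iter e delta f k.
Proof. by elim: e k => [//|e IH] k /=; rewrite /delta !IH mulrBr. Qed.

Lemma order_growth e f k0 : (forall k, (k0 <= k)%N -> iter e delta f k = 0) ->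
  exists2 h, growth e h & forall k, (k0 <= k)%N -> (`|f k| <= h k)%N.
Proof.
elim: e f => [|e IH] f hf.
  by exists (fun=> 0%N) => // k /hf /= ->.
have [|h gh hh] := IH (delta f); first by move=> k kk; rewrite -iterSr hf.
pose H k := (\sum_(j < k) h j)%N.
exists (fun k => `|f k0| + H k)%N.
  apply: growthD; first by exists `|f k0|%N => k; rewrite leq_pmulr // expn_gt0.
  apply: (@growth_sum _ _ (fun k => h k.-1)); first by rewrite /H big_ord0.
    by move=> k; rewrite /H big_ord_recr.
  case: e gh {IH hf} => [gh k|e [C hC]]; first exact: gh.
  exists C => k; apply: leq_trans (hC _) _; rewrite leq_mul2l leq_expl ?orbT //; lia.
move=> k /subnKC <-; elim: (k - k0)%N => [|i IHi]; first by rewrite addn0 leq_addr.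
have := hh (k0 + i)%N (leq_addr _ _); rewrite /delta addnS /H big_ord_recr /= -/(H _) => hi.
by move: IHi hi; lia.
Qed.

Lemma harmonic_cvg0 : (fun n : nat => (n%:R : K)^-1) @ \oo --> (0 : K).
Proof. by rewrite -cvg_shiftS; apply: cvg_harmonic. Qed.

Lemma growth_cvg0 d f h k0 : growth d h -> (forall k, (k0 <= k)%N -> (`|f k| <= h k)%N) ->
  (fun n : nat => (f n.+1)%:~R / (n%:R : K) ^+ d) @ \oo --> (0 : K).
Proof.
move=> gh fh; apply: norm_cvg0.
have [C hC] : exists C, forall n, (maxn 1 k0 <= n)%N ->
    `|(f n.+1)%:~R / (n%:R : K) ^+ d| <= C * (n%:R)^-1.
  case: d gh => [gh|d [C hC]].
    exists 0 => n hn; rewrite mul0r expr0 divr1 -intr_norm.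
    have := fh n.+1; rewrite gh leqn0 absz_eq0 => /(_ _)/eqP ->; [by rewrite normr0|lia].
  exists ((C * 3 ^ d)%N%:R) => n hn; rewrite normrM normfV normrX normr_nat.
  have n0 : 0 < n%:R :> K by rewrite ltr0n; lia.
  rewrite exprSr invfM mulrA ler_pM2r ?invr_gt0 //.
  rewrite ler_pdivrMr ?exprn_gt0 // -intr_norm -abszE -natrX -natrM.
  rewrite -pmulrn ler_nat; apply: leq_trans (fh _ _) _; first by lia.
  apply: leq_trans (hC _) _; rewrite -mulnA -expnMn leq_mul2l leq_expl ?orbT //; lia.
apply: (@squeeze_cvgr _ _ _ _ (fun=> 0) (fun n => C * n%:R^-1)).
- near=> n; rewrite normr_ge0 hC //; near: n; exact: nbhs_infty_ge.
- exact: cvg_cst.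
- by rewrite -(mulr0 C); apply: cvgM; [exact: cvg_cst|exact: harmonic_cvg0].
Unshelve. all: by end_near. Qed.

Lemma cvg_tail (u v : nat -> K) (l : K) k0 : (forall n, (k0 <= n)%N -> u n = v n) ->
  u @ \oo --> l -> v @ \oo --> l.
Proof.
move=> uv; apply: cvg_trans; apply: near_eq_cvg; near=> n.
by apply: uv; near: n; exact: nbhs_infty_ge.
Unshelve. all: by end_near. Qed.

Lemma cvg_scale (u : nat -> K) (c l : K) :
  u @ \oo --> l -> (fun n => c * u n) @ \oo --> (c * l : K).
Proof. by move=> ul; apply: cvgM => //; exact: cvg_cst. Qed.

Lemma bin_cvg e : (fun n : nat => 'C(n.+1, e)%:R / (n%:R : K) ^+ e) @ \oo --> ((e`!)%:R^-1 : K).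
Proof.
elim: e => [|e IH].
  have -> : (fun n : nat => 'C(n.+1, 0%N)%:R / (n%:R : K) ^+ 0) = fun=> 0`!%:R^-1.
    by apply: funext => n; rewrite bin0 expr0 divr1 invr1.
  exact: cvg_cst.
have r : (fun n : nat => e.+1%:R^-1 * (1 + (1 - e%:R) * (n%:R : K)^-1)) @ \oo --> (e.+1%:R^-1 : K).
  have {2}-> : (e.+1%:R^-1 : K) = e.+1%:R^-1 * (1 + (1 - e%:R) * 0) by rewrite mulr0 addr0 mulr1.
  apply: cvgM; first exact: cvg_cst.
  apply: cvgD; first exact: cvg_cst.
  by apply: cvgM; [exact: cvg_cst|exact: harmonic_cvg0].
have := cvgM IH r; rewrite -invfM -natrM mulnC -factS.
move=> /(_ _); apply: (@cvg_tail _ _ _ e.+1) => n en.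
have n0 : n%:R != 0 :> K by rewrite pnatr_eq0; lia.
have e0 : e.+1%:R != 0 :> K by rewrite pnatr_eq0.
have E : (e.+1%:R * 'C(n.+1, e.+1)%:R : K) = (n%:R + 1 - e%:R) * 'C(n.+1, e)%:R.
  by rewrite -natrM mul_bin_left natrM natrB -?natr1 //; lia.
rewrite /= exprSr; apply: (mulfI e0); rewrite [RHS]mulrA E.
move: {E} e.+1%:R e0 n%:R n0 => a a0 b b0.
by field; rewrite a0 expf_neq0 b0.
Qed.

(** The constant d-th difference c is that of c 'C(k, d); the remainder has
    order d, hence is negligible before k ^ d. *)
Lemma order_cvg d f k0 : (forall k, (k0 <= k)%N -> iter d.+1 delta f k = 0) ->
  (fun n : nat => (f n.+1)%:~R / (n%:R : K) ^+ d) @ \oo --> (iter d delta f k0)%:~R * (d`!%:R^-1 : K)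
  /\ forall k, (k0 <= k)%N -> iter d delta f k = iter d delta f k0.
Proof.
move=> hf; set c := iter d delta f k0.
have cE k : (k0 <= k)%N -> iter d delta f k = c.
  move=> /subnKC <-; elim: (k - k0)%N => [|i IH]; first by rewrite addn0.
  by rewrite addnS; apply/eqP; rewrite -IH -subr_eq0; apply/eqP/(hf (k0 + i)%N)/leq_addr.
split=> //; pose g k := f k + (- c) * 'C(k, d)%:Z.
have [|h gh hh] := @order_growth d g k0.
  by move=> k kk; rewrite iter_deltaD iter_deltaZ iter_delta_bin cE // mulr1 subrr.
have cb : (fun n : nat => c%:~R * ('C(n.+1, d)%:R / (n%:R : K) ^+ d)) @ \oo --> c%:~R * (d`!%:R^-1 : K).
  exact/cvg_scale/bin_cvg.
have -> : c%:~R / d`!%:R = 0 + c%:~R / d`!%:R :> K by rewrite add0r.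
have : (fun n : nat => (g n.+1)%:~R / (n%:R : K) ^+ d + c%:~R * ('C(n.+1, d)%:R / n%:R ^+ d))
    @ \oo --> (0 + c%:~R / d`!%:R : K).
  by apply: cvgD; [exact: growth_cvg0 gh hh|exact: cb].
apply: (@cvg_tail _ _ _ 0%N) => n _.
rewrite /g intrD intrM mulrNz -[('C(_, _))%:~R]pmulrn mulrDl mulNr mulrA.
by rewrite mulNr subrK.
Qed.

(** A larger nonzero leading difference would make h of exact order k ^ e,
    against the bound. *)
Lemma growth_order d h k0 e : growth d.+1 h ->
  (forall k, (k0 <= k)%N -> iter e delta (fun k => (h k)%:Z) k = 0) ->
  forall k, (k0 <= k)%N -> iter d.+1 delta (fun k => (h k)%:Z) k = 0.
Proof.
move=> gh; elim: e => [|e IH] he; first exact: iter_delta_le he.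
case: (leqP e d) => [ed|de]; first exact: iter_delta_le he.
apply: IH => k kk; have [cv cE] := order_cvg he; rewrite cE //.
have c0 : (fun n : nat => (h n.+1)%:Z%:~R / (n%:R : K) ^+ e) @ \oo --> (0 : K).
  exact: (@growth_cvg0 e (fun k => (h k)%:Z) h 0%N (growth_mon de gh) (fun k _ => leqnn _)).
have : (iter e delta (fun k => (h k)%:Z) k0)%:~R * (e`!%:R^-1 : K) = 0.
  exact: (cvg_unique (@norm_hausdorff _ K^o) cv c0).
by move/eqP; rewrite mulf_eq0 invr_eq0 pnatr_eq0 eqn0Ngt fact_gt0 /= orbF intr_eq0 => /eqP.
Qed.

(** The sequence whose limit defines the multiplicity. *)
Definition hseq d h : nat -> K := fun n => d`!%:R * (h n.+1)%:R / n%:R ^+ d.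

Lemma hseq_cvg d h : evpoly (fun k => (h k)%:Z) -> growth d.+1 h -> cvg (hseq d h @ \oo).
Proof.
move=> [e [k0 he]] gh; have [cv _] := order_cvg (growth_order gh he).
apply/cvg_ex; eexists; have := @cvg_scale _ d`!%:R _ cv.
by apply: (@cvg_tail _ _ _ 0%N) => n _; rewrite /hseq /= mulrA.
Qed.

Lemma hseq_lim_ge0 d h : 0 <= lim (hseq d h @ \oo).
Proof.
have [cv|/dvgP ->] := pselect (cvg (hseq d h @ \oo)); last exact: lexx.
by apply: limr_ge => //; near=> n; rewrite /hseq !mulr_ge0 // invr_ge0 exprn_ge0.
Unshelve. all: by end_near. Qed.

Lemma hseq_growth d h : (forall i j, (i <= j)%N -> (h i <= h j)%N) ->
  cvg (hseq d h @ \oo) -> growth d.+1 h.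
Proof.
move=> mh /cvg_seq_bounded[M [_ /(_ (M + 1))]]; rewrite ltrDl ltr01 => /(_ isT) bM.
have M0 : 0 <= M + 1 by apply: le_trans (normr_ge0 _) (bM 0%N I).
exists (Num.Def.archi_bound (M + 1)) => k; apply: leq_trans (mh _ _ (leq_trans (leqnSn k) (leqnSn k.+1))) _.
rewrite -(ler_nat K) natrM natrX.
have k0 : 0 < k.+1%:R ^+ d :> K by rewrite exprn_gt0.
rewrite -ler_pdivrMr //; apply: le_trans (ltW (archi_boundP M0)).
apply: le_trans (bM k.+1 I); apply: le_trans (ler_norm _).
by rewrite /hseq ler_pM2r ?invr_gt0 // ler_peMl // ler1n fact_gt0.
Qed.

Lemma hseq_lower d h (al : K) : cvg (hseq d h @ \oo) -> 0 <= al ->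
  al < lim (hseq d h @ \oo) ->
  exists k0, forall i, (k0 <= i)%N -> al * 'C(i, d)%:R <= (h i.+1)%:R.
Proof.
move=> cv al0 hal; have [k0 _ hk] := cvgr_ge _ cv _ hal.
exists k0.+1 => i hi; have := hk i (ltnW hi); rewrite /= /hseq.
have i0 : 0 < i%:R ^+ d :> K by rewrite exprn_gt0 // ltr0n; lia.
have f0 : 0 < d`!%:R :> K by rewrite ltr0n fact_gt0.
rewrite ler_pdivlMr // => hi'; rewrite -(ler_pM2l f0); apply: le_trans hi'.
by rewrite mulrCA ler_wpM2l // -natrM -natrX ler_nat mulnC bin_ffact ffact_le_exp.
Qed.

Lemma hseq_upper d h (ga : K) : cvg (hseq d h @ \oo) -> lim (hseq d h @ \oo) < ga -> 0 <= ga ->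
  exists k0, forall i, (k0 <= i)%N -> (h i.+1)%:R <= ga * 'C(i + d, d)%:R.
Proof.
move=> cv hga ga0; have [k0 _ hk] := cvgr_le _ cv _ hga.
exists k0.+1 => i hi; have := hk i (ltnW hi); rewrite /= /hseq.
have i0 : 0 < i%:R ^+ d :> K by rewrite exprn_gt0 // ltr0n; lia.
have f0 : 0 < d`!%:R :> K by rewrite ltr0n fact_gt0.
rewrite ler_pdivrMr // => hi'; rewrite -(ler_pM2l f0); apply: (le_trans hi').
by rewrite mulrCA ler_wpM2l // -natrM -natrX ler_nat mulnC bin_ffact exp_le_ffact.
Qed.

Lemma growth_hseq0 d h : growth d h -> hseq d h @ \oo --> (0 : K).
Proof.
move=> gh; have cv := @growth_cvg0 d (fun k => (h k)%:Z) h 0%N gh (fun k _ => leqnn _).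
rewrite -(mulr0 d`!%:R); have := @cvg_scale _ d`!%:R _ cv.
by apply: (@cvg_tail _ _ _ 0%N) => n _; rewrite /hseq /= mulrA.
Qed.

End Limits.

(** * Multiplicity of the completed tensor product *)

Section LeadingCoefficients.
Variables (K : realType) (F G p u : nat -> nat) (a b : nat).
Hypotheses (F0 : F 0%N = 0%N) (G0 : G 0%N = 0%N).
Hypothesis mF : forall i j, (i <= j)%N -> (F i <= F j)%N.
Hypothesis mG : forall i j, (i <= j)%N -> (G i <= G j)%N.
Hypothesis evp : evpoly (fun k => (p k)%:Z).
Hypothesis lower : forall k,
  (\sum_(i < k) (F i.+1 - F i) * (G (k - i) - G (k - i).-1) <= p k)%N.
Hypothesis upper : forall k, (p k <= F k * u k)%N.
Hypothesis growth_u : forall d, growth d.+1 G -> growth d u.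
Let eF := lim (hseq K a F @ \oo).
Let eG := lim (hseq K b G @ \oo).
Hypotheses (eF_gt0 : 0 < eF) (eG_gt0 : 0 < eG).

Let cvg_pos d h : 0 < lim (hseq K d h @ \oo) -> cvg (hseq K d h @ \oo).
Proof. by move=> lt; apply: contrapT => /dvgP E; move: lt; rewrite E ltxx. Qed.

Lemma hseq_increment d h : h 0%N = 0%N -> 0 < lim (hseq K d h @ \oo) ->
  exists i, (h i < h i.+1)%N.
Proof.
move=> h0 lt; apply: contrapT => /forallNP nlt.
have {}h0 i : h i = 0%N.
  by elim: i => // i IH; apply/eqP; rewrite -leqn0 -IH leqNgt; apply/negP/nlt.
move: lt; rewrite (cvg_lim (@norm_hausdorff _ K^o) (growth_hseq0 _)) ?ltxx //.
exact: growth_ext (growth0 d).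
Qed.

(** One positive increment of F and one of G give a positive term. *)
Lemma conv_pos : exists k, (0 < p k)%N.
Proof.
have [i hi] := hseq_increment F0 eF_gt0; have [j hj] := hseq_increment G0 eG_gt0.
exists (i + j).+1; apply: leq_trans (lower _).
have ik : (i < (i + j).+1)%N by rewrite ltnS leq_addr.
rewrite (bigD1 (Ordinal ik)) //= ltn_addr // muln_gt0 !subn_gt0 hi.
by rewrite -addnS addKn.
Qed.

Let growth_uG : growth b u.
Proof. exact/growth_u/(hseq_growth mG)/cvg_pos. Qed.

Let b_gt0 : (0 < b)%N.
Proof.
case: (b) growth_uG => [u0|//]; have [k] := conv_pos.
by have := upper k; rewrite u0 muln0 leqn0 => /eqP ->.
Qed.

Let d := (a + b.-1)%N.
Let dE : d.+1 = (a + b)%N. Proof. by rewrite /d -addnS prednK. Qed.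

Let growth_p : growth d.+1 p.
Proof.
have [C hC] := hseq_growth mF (cvg_pos eF_gt0).
have [D hD] : growth b.-1.+1 u by rewrite prednK.
exists (C * D)%N => k; apply: leq_trans (upper k) _.
by rewrite expnD mulnACA leq_mul.
Qed.

Let cvg_p : cvg (hseq K d p @ \oo). Proof. exact: hseq_cvg. Qed.

Let scaled_le (s ga : K) : 0 < s < 1 -> lim (hseq K d p @ \oo) < ga ->
  s * eF * (s * eG) <= ga.
Proof.
move=> /andP[s0 s1] hga.
have ga0 : 0 <= ga by apply: le_trans (ltW hga); apply: hseq_lim_ge0.
have small e : 0 < e -> 0 <= s * e < e by move=> e0; rewrite mulr_ge0 ?gtr_pMl //; exact: ltW.
have /andP[sF0 sF] := small _ eF_gt0; have /andP[sG0 sG] := small _ eG_gt0.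
have [k0 h0] := hseq_lower (cvg_pos eF_gt0) sF0 sF.
have [k1 h1] := hseq_lower (cvg_pos eG_gt0) sG0 sG.
have [k2 h2] := hseq_upper cvg_p hga ga0.
apply: (conv_leading lower F0 G0 mF mG sF0 sG0 ga0 (k0 := maxn k0 k1) _ _ h2 dE) => i.
  by rewrite geq_max => /andP[/h0].
by rewrite geq_max => /andP[_ /h1].
Qed.

(** The convolution estimate holds with e(M) and e(N) replaced by smaller and
    e(P) by larger numbers; these are chosen proportional to e(M), e(N) and
    e(M) e(N) so as to contradict a strict inequality. *)
Lemma leading_le : eF * eG <= lim (hseq K d p @ \oo).
Proof.
set ep := lim _; rewrite leNgt; apply/negP => lt.
have e0 : 0 < eF * eG by apply: mulr_gt0.
have ep0 : 0 <= ep by apply: hseq_lim_ge0.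
pose r := ep / (eF * eG).
have r1 : r < 1 by rewrite ltr_pdivrMr // mul1r.
have r0 : 0 <= r by rewrite divr_ge0 // ltW.
have epE : ep = r * (eF * eG) by rewrite /r divfK // gt_eqF.
(* s ^ 2 > q since r < 1: the difference is (1 - r) ^ 2 / 16 *)
pose s := (3 + r) / 4; pose q := (1 + r) / 2.
have /scaled_le h : 0 < s < 1 by rewrite /s; lra.
have /h : ep < q * (eF * eG) by rewrite epE ltr_pM2r // /q; lra.
by rewrite mulrACA ler_pM2r // /s /q; nra.
Qed.

Lemma leading_degree : growth d.+1 p /\ ~ growth d p.
Proof.
split=> // gp; have := leading_le.
by rewrite (cvg_lim (@norm_hausdorff _ K^o) (growth_hseq0 gp)) leNgt mulr_gt0.
Qed.

End LeadingCoefficients.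

Theorem theorem2p2 (K : realType) (R : idomainType) (t : R) (n m : nat)
    (M : lmodType (pseries R n)) (N : lmodType (pseries R m)) :
  complete_dvr t ->
  fin_gen M ->
  fin_gen N ->
  flat_over (@psC R m) N ->
  multiplicity K (ctensor M N) >= multiplicity K M * multiplicity K N.
Proof.
move=> hR fM fN flatN.
pose H n' (E : lmodType (pseries R n')) := colen [set (0 : E)].
have multE n' (E : lmodType (pseries R n')) : fin_gen E ->
    multiplicity K E = lim (hseq K (mod_dim E) (H _ E) @ \oo).
  move=> fE; congr (lim (_ @ \oo)); apply: funext => k.
  by rewrite (mod_length_colen hR _ fE).
have fP := ctensor_fin_gen fM fN.
rewrite (multE _ _ fM) (multE _ _ fN) (multE _ _ fP).
have H0 n' (E : lmodType (pseries R n')) : fin_gen E -> H _ E 0%N = 0%N.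
  by move=> fE; apply: (colen_n0 hR fE); apply: opsub0.
have mH n' (E : lmodType (pseries R n')) : fin_gen E ->
    forall i j, (i <= j)%N -> (H _ E i <= H _ E j)%N.
  by move=> fE i j; apply: (colen_mono hR fE); [exact: opsub0|exact: opsub0|].
have := hseq_lim_ge0 K (mod_dim M) (H _ M); rewrite le_eqVlt => /orP[/eqP <-|eM].
  by rewrite mul0r hseq_lim_ge0.
have := hseq_lim_ge0 K (mod_dim N) (H _ N); rewrite le_eqVlt => /orP[/eqP <-|eN].
  by rewrite mulr0 hseq_lim_ge0.
have evP := colen_evpoly hR fP (opsub0 _).
have lower k : (\sum_(i < k) (H _ M i.+1 - H _ M i) * (H _ N (k - i) - H _ N (k - i).-1) <=
    H _ (ctensor M N : lmodType _) k)%N.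
  have [q [e he]] := fin_genP fM; have [q' [f hf]] := fin_genP fN.
  exact: (colen_tensor_ge hR k he hf fN fM).
have upper k := colen_tensor_le hR fM fN k.
have growth_tN d : growth d.+1 (H _ N) -> growth d (colen (tN t (N := N))).
  have [c hc] := colen_map_ge hR fN fN (@lin_t _ t _ N) (opsub0 N).
  have pre : (fun y : N => psC t *: y) @^-1` [set 0] = [set 0].
    apply/seteqP; split=> y /=; first exact: (flat_torsion_free hR flatN).
    by move=> ->; rewrite scaler0.
  rewrite pre in hc.
  apply: (growth_average (H0 _ _ fN) (mH _ _ fN) (c := c)).
    by move=> i j; apply: (colen_mono hR fN); [exact: tN_opsub|exact: tN_opsub|].
  by move=> k; rewrite addnC; apply: hc.
have [gP ngP] := leading_degree (H0 _ _ fM) (H0 _ _ fN) (mH _ _ fM) (mH _ _ fN) evP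
  lower upper growth_tN eM eN.
rewrite (mod_dimE hR fP gP ngP).
exact: (leading_le (H0 _ _ fM) (H0 _ _ fN) (mH _ _ fM) (mH _ _ fN) evP lower upper growth_tN eM eN).
Qed.
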